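(* Let $\mathbb{F}=\mathbb{R}$ or $\mathbb{C}$, let $E$ be the subspace of $\mathbb{F}$-self-adjoint matrices in $\mathcal{M}_n(\mathbb{F})$ (real symmetric, respectively Hermitian, $n\times n$ matrices), and let $\overline{B_E}$ be the volume-one homothetic copy of the unit ball of the operator norm on $E$. Then the following hold. (1) $\int_{\overline{B_E}}|T_{i,j}|^2\,dT\simeq 1$ for all $1\leq i,j\leq n$. (2) For index pairs with $(l,k)\notin\{(i,j),(j,i)\}$, $\int_{\overline{B_E}}T_{i,j}T_{l,k}\,dT=0$ except when $i=j\neq l=k$. (3) If $\mathbb{F}=\mathbb{C}$, $i\neq j$ and $(l,k)\notin\{(i,j),(j,i)\}$, then $$\int_{\overline{B_E}}\mathrm{Re}(T_{i,j})\mathrm{Re}(T_{l,k})\,dT=\int_{\overline{B_E}}\mathrm{Im}(T_{i,j})\mathrm{Im}(T_{l,k})\,dT=\int_{\overline{B_E}}\mathrm{Re}(T_{i,j})\mathrm{Im}(T_{l,k})\,dT=0,$$ and moreover, for $i\neq j$, $\int_{\overline{B_E}}\mathrm{Re}(T_{i,j})\mathrm{Im}(T_{i,j})\,dT=0$. (4) When $i=j\neq l=k$, $$\int_{\overline{B_E}}T_{i,i}T_{k,k}\,dT\simeq-\frac1n .$$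
   Context: $E$ is a real vector space with the Euclidean structure given by the Hilbert-Schmidt norm $\|T\|_{S_2^n}=(\mathrm{Tr}(TT^* ))^{1/2}$; volume and $dT$ refer to the corresponding Lebesgue measure on $E$. With $d_n=\dim_{\mathbb{R}}E$ and $B_E=\{T\in E: s_{\max}(T)\leq 1\}$ (largest singular value at most $1$), $\overline{B_E}=B_E/[\mathrm{vol}(B_E)]^{1/d_n}$. The notation $A\simeq B$ for positive quantities means that there are absolute constants $c_1,c_2>0$ (independent of $n$ and the indices) with $c_1A\leq B\leq c_2A$; $A\simeq-\frac1n$ means $-A\simeq\frac1n$. *)

(* Defs.v *)
From HB Require Import structures.
From mathcomp Require Import all_boot all_order all_algebra.
From mathcomp Require Import all_classical all_reals all_analysis.
From mathcomp Require Import complex.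

Set Implicit Arguments.
Unset Strict Implicit.
Unset Printing Implicit Defensive.

Import Order.TTheory GRing.Theory Num.Theory.
Import numFieldNormedType.Exports.

Local Open Scope classical_set_scope.
Local Open Scope ring_scope.

Section lebesgue_tuple.
Context {R : realType}.
Local Notation T := (measurableTypeR R).

Definition tuple_cons d (p : T * d.-tuple T) : d.+1.-tuple T :=
  [tuple of p.1 :: p.2].

Definition tuple_uncons d (t : d.+1.-tuple T) : T * d.-tuple T :=
  (thead t, [tuple of behead t]).

Lemma tuple_consK d : cancel (@tuple_cons d) (@tuple_uncons d).
Proof.
by case=> x t; rewrite /tuple_uncons /tuple_cons theadE; congr (_, _); apply/val_inj.
Qed.

Lemma tuple_unconsK d : cancel (@tuple_uncons d) (@tuple_cons d).
Proof. by move=> t; rewrite [RHS]tuple_eta; apply/val_inj. Qed.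

Lemma measurable_tuple_cons d : measurable_fun setT (@tuple_cons d).
Proof. by apply: measurable_cons. Qed.

Lemma measurable_tuple_uncons d : measurable_fun setT (@tuple_uncons d).
Proof.
apply/measurable_fun_pair; last exact: measurable_behead.
exact: (measurable_tnth ord0).
Qed.

Fixpoint lebesgue_tuple (d : nat) : set (d.-tuple T) -> \bar R :=
  match d with
  | 0 => \d_ ([tuple] : 0.-tuple T)
  | d'.+1 =>
      pushforward (lebesgue_measure \x @lebesgue_tuple d')%E (@tuple_cons d')
  end.

Section step.
Context d (m : {sigma_finite_measure set (d.-tuple T) -> \bar R}).
Local Notation P := (lebesgue_measure \x m)%E.

Definition lebesgue_tuple_step := pushforward P (@tuple_cons d).
Local Notation step := lebesgue_tuple_step.

HB.instance Definition _ := Measure.copy step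
  (measure_function_pushforward__canonical__measure_function_Measure
     P (@measurable_tuple_cons d)).

Let sigma_finite_step : sigma_finite setT step.
Proof.
have /sigma_finiteP[F [TF ndF Foo]] := sigma_finiteT (@lebesgue_measure R).
have /sigma_finiteP[G [TG ndG Goo]] := sigma_finiteT m.
exists (fun k => @tuple_uncons d @^-1` (F k `*` G k)).
  rewrite -preimage_bigcup (_ : \bigcup_k _ = setT) ?preimage_setT//.
  apply/seteqP; split=> // -[x y] _.
  have [i _ Fix] : (\bigcup_i F i) x by rewrite -TF.
  have [j _ Gjy] : (\bigcup_j G j) y by rewrite -TG.
  exists (maxn i j) => //; split => /=.
  - by move: x Fix; exact/subsetPset/ndF/leq_maxl.
  - by move: y Gjy; exact/subsetPset/ndG/leq_maxr.
move=> k; have [mF Fk] := Foo k; have [mG Gk] := Goo k.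
have mFG : measurable (F k `*` G k) by exact: measurableX.
split; first by rewrite -[X in measurable X]setTI; exact: measurable_tuple_uncons.
rewrite /step /pushforward -comp_preimage.
rewrite (_ : _ \o _ = id) ?preimage_id; last first.
  by apply/funext => x; exact: tuple_consK.
by rewrite product_measure1E// lte_mul_pinfty// ge0_fin_numE.
Qed.

HB.instance Definition _ :=
  Measure_isSigmaFinite.Build _ _ _ step sigma_finite_step.

End step.

Let lebesgue_tupleP d :
  exists m : {sigma_finite_measure set (d.-tuple T) -> \bar R},
    @lebesgue_tuple d = m.
Proof.
elim: d => [|d [m mE]] /=; first by exists (\d_ ([tuple] : 0.-tuple T)).
by rewrite mE; exists (lebesgue_tuple_step m).
Qed.

Let lebesgue_tuple0 d : @lebesgue_tuple d set0 = 0%E.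
Proof. by have [m ->] := lebesgue_tupleP d; exact: measure0. Qed.

Let lebesgue_tuple_ge0 d A : (0 <= @lebesgue_tuple d A)%E.
Proof. by have [m ->] := lebesgue_tupleP d; exact: measure_ge0. Qed.

Let lebesgue_tuple_sigma_additive d : semi_sigma_additive (@lebesgue_tuple d).
Proof.
by have [m ->] := lebesgue_tupleP d; exact: measure_semi_sigma_additive.
Qed.

HB.instance Definition _ d := isMeasure.Build _ _ _ (@lebesgue_tuple d)
  (lebesgue_tuple0 d) (@lebesgue_tuple_ge0 d) (@lebesgue_tuple_sigma_additive d).

Let lebesgue_tuple_sigma_finite d : sigma_finite setT (@lebesgue_tuple d).
Proof. by have [m ->] := lebesgue_tupleP d; exact: sigma_finiteT. Qed.

HB.instance Definition _ d := Measure_isSigmaFinite.Build _ _ _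
  (@lebesgue_tuple d) (@lebesgue_tuple_sigma_finite d).

End lebesgue_tuple.

Arguments lebesgue_tuple {R} d.

Inductive scalar_kind := RealK | ComplexK.

Section scalars.
Variable R : realType.

Definition scal (K : scalar_kind) : numFieldType :=
  match K with RealK => R | ComplexK => R[i] end.

(* a + ib; over the reals b is dropped *)
Definition mkF (K : scalar_kind) : R -> R -> scal K :=
  match K return R -> R -> scal K with
  | RealK => fun a _ => a
  | ComplexK => fun a b => Complex a b
  end.

Definition inF (K : scalar_kind) (a : R) : scal K := mkF K a 0.

Definition reF (K : scalar_kind) : scal K -> R :=
  match K return scal K -> R with
  | RealK => id
  | ComplexK => @complex.Re R
  end.

Definition imF (K : scalar_kind) : scal K -> R :=
  match K return scal K -> R with
  | RealK => fun _ => 0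
  | ComplexK => @complex.Im R
  end.

Definition conjF (K : scalar_kind) (z : scal K) : scal K :=
  mkF K (reF z) (- imF z).

(* the norm of [scal K] takes its values in [scal K] *)
Definition absF (K : scalar_kind) (z : scal K) : R := reF `|z|.

End scalars.

Section selfadjoint.
Variables (R : realType) (K : scalar_kind) (n : nat).
Local Notation M := 'M[scal R K]_n.

Definition adjmx (T : M) : M := map_mx (@conjF R K) T^T.

Definition selfadjoint : set M := [set T | adjmx T = T].

Definition hs_norm (T : M) : R := Num.sqrt (reF (\tr (T *m adjmx T))).

Definition singular_value (T : M) : set R :=
  [set s | 0 <= s /\ eigenvalue (T *m adjmx T) (inF K s ^+ 2)].

(* for n > 0 this set is finite and nonempty, and the supremum is its maximum *)
Definition s_max (T : M) : R := sup (singular_value T).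

(* The coordinates of a self-adjoint matrix are indexed by the pairs (i, j) with
   i <= j and, over the complex numbers, also by the pairs with i > j, which
   carry the imaginary parts. *)
Definition coord_pairs : seq ('I_n * 'I_n) :=
  enum [pred p : 'I_n * 'I_n |
    match K with RealK => (p.1 <= p.2)%N | ComplexK => true end].

Definition dimE : nat := size coord_pairs.

(* This is 0 when p is not one of the coordinate pairs. *)
Definition coord_at (x : dimE.-tuple (measurableTypeR R)) (p : 'I_n * 'I_n) : R :=
  nth 0 x (index p coord_pairs).

(* Coordinates in the orthonormal basis (for the Hilbert-Schmidt inner product)
   e_ii, (e_ij + e_ji) / sqrt 2 and, over the complex numbers,
   sqrt(-1) (e_ij - e_ji) / sqrt 2, for i < j. *)
Definition coordmx (x : dimE.-tuple (measurableTypeR R)) : M :=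
  \matrix_(i, j)
    if i == j then inF K (coord_at x (i, i))
    else if (i < j)%N then
      mkF K (coord_at x (i, j) / Num.sqrt 2) (coord_at x (j, i) / Num.sqrt 2)
    else
      mkF K (coord_at x (j, i) / Num.sqrt 2) (- (coord_at x (i, j) / Num.sqrt 2)).

End selfadjoint.

Section coordmx_theory.
Variables (R : realType) (K : scalar_kind) (n : nat).
Local Notation T := (measurableTypeR R).

Lemma scal_eqP (z w : scal R K) : reF z = reF w -> imF z = imF w -> z = w.
Proof. by case: K z w => //= -[a b] [c d] /= -> ->. Qed.

Lemma reF_mkF a b : reF (mkF K a b) = a :> R.
Proof. by case: K. Qed.

Lemma imF_mkF a b : imF (mkF K a b) = (if K is RealK then 0 else b) :> R.
Proof. by case: K. Qed.

Lemma imF_mkF0 a : imF (mkF K a 0) = 0 :> R.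
Proof. by case: K. Qed.

Lemma reFB (z w : scal R K) : reF (z - w) = reF z - reF w.
Proof. by case: K z w => //= -[a b] [c d]. Qed.

Lemma imFB (z w : scal R K) : imF (z - w) = imF z - imF w.
Proof. by case: K z w => [z w|[a b] [c d]] //=; rewrite subr0. Qed.

Lemma reFD (z w : scal R K) : reF (z + w) = reF z + reF w.
Proof. by case: K z w => //= -[a b] [c d]. Qed.

Lemma reF0 : reF (0 : scal R K) = 0.
Proof. by case: K. Qed.

Lemma reF_sum I (r : seq I) (P : pred I) (F : I -> scal R K) :
  reF (\sum_(i <- r | P i) F i) = \sum_(i <- r | P i) reF (F i).
Proof. exact: (big_morph _ reFD reF0). Qed.

Lemma reF_mulconj (z : scal R K) : reF (z * conjF z) = reF z ^+ 2 + imF z ^+ 2.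
Proof.
case: K z => [z|[a b]] /=; first by rewrite expr0n addr0 expr2.
by rewrite mulrN opprK !expr2.
Qed.

Lemma hs_norm_sqr (A : 'M[scal R K]_n) :
  hs_norm A ^+ 2 = \sum_i \sum_j (reF (A i j) ^+ 2 + imF (A i j) ^+ 2).
Proof.
have E : reF (\tr (A *m adjmx A)) =
    \sum_i \sum_j (reF (A i j) ^+ 2 + imF (A i j) ^+ 2).
  rewrite /mxtrace reF_sum; apply: eq_bigr => i _; rewrite mxE reF_sum.
  by apply: eq_bigr => j _; rewrite !mxE reF_mulconj.
rewrite /hs_norm E sqr_sqrtr//.
by do 2!apply: sumr_ge0 => ? _; rewrite addr_ge0 ?sqr_ge0.
Qed.

Lemma conjF_mkF a b : conjF (mkF K a b) = mkF K a (- b) :> scal R K.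
Proof. by rewrite /conjF; case: K. Qed.

Lemma coordmx_selfadjoint (x : (dimE K n).-tuple T) : selfadjoint (coordmx x).
Proof.
apply/matrixP => i j; rewrite !mxE eq_sym; case: eqVneq => [->|ij].
  by rewrite conjF_mkF oppr0.
have [ltij|ltji|/val_inj eij] := ltngtP i j; last by rewrite eij eqxx in ij.
- by rewrite conjF_mkF opprK.
- by rewrite conjF_mkF.
Qed.

Lemma coord_at_notin (x : (dimE K n).-tuple T) p :
  p \notin coord_pairs K n -> coord_at x p = 0.
Proof. by move=> pN; rewrite /coord_at nth_default// size_tuple leqNgt index_mem. Qed.

Lemma coord_at_real (x : (dimE K n).-tuple T) (i j : 'I_n) :
  (i < j)%N -> K = RealK -> coord_at x (j, i) = 0.
Proof.
move=> ij KR; apply: coord_at_notin.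
by rewrite mem_enum inE/= leqNgt ij; case: (K) KR.
Qed.

Lemma coordmx_diag (x : (dimE K n).-tuple T) i :
  reF (coordmx x i i) = coord_at x (i, i) /\ imF (coordmx x i i) = 0.
Proof. by rewrite !mxE eqxx reF_mkF imF_mkF0. Qed.

Lemma coordmx_upper (x : (dimE K n).-tuple T) (i j : 'I_n) : (i < j)%N ->
  reF (coordmx x i j) = coord_at x (i, j) / Num.sqrt 2 /\
  imF (coordmx x i j) = coord_at x (j, i) / Num.sqrt 2.
Proof.
move=> ij; rewrite !mxE -val_eqE/= (ltn_eqF ij) ij reF_mkF imF_mkF; split=> //.
move: (coord_at_real x ij); move: (coord_at x (j, i)) => r.
by case: K => // ->//; rewrite mul0r.
Qed.

Lemma coordmx_lower (x : (dimE K n).-tuple T) (i j : 'I_n) : (i < j)%N ->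
  reF (coordmx x j i) = coord_at x (i, j) / Num.sqrt 2 /\
  imF (coordmx x j i) = - (coord_at x (j, i) / Num.sqrt 2).
Proof.
move=> ij; have [<- <-] := coordmx_upper x ij.
have -> : coordmx x j i = conjF (coordmx x i j).
  by rewrite -[in LHS](coordmx_selfadjoint x) /adjmx [LHS]mxE [X in conjF X]mxE.
move: (coordmx x i j) => z.
by rewrite /conjF reF_mkF imF_mkF; split=> //; case: (K) z => //= _; rewrite oppr0.
Qed.

Lemma coordmx_isometry (x y : (dimE K n).-tuple T) :
  hs_norm (coordmx x - coordmx y) ^+ 2 = \sum_k (tnth x k - tnth y k : R) ^+ 2.
Proof.
pose D p := coord_at x p - coord_at y p.
have s2 : (Num.sqrt 2)^-1 ^+ 2 = 2^-1 :> R by rewrite exprVn sqr_sqrtr.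
have E i j : reF ((coordmx x - coordmx y) i j) ^+ 2 +
    imF ((coordmx x - coordmx y) i j) ^+ 2 = (D (i, j) ^+ 2 + D (j, i) ^+ 2) / 2.
  have -> : (coordmx x - coordmx y) i j = coordmx x i j - coordmx y i j.
    by rewrite [LHS]mxE; congr (_ + _); exact: mxE.
  rewrite reFB imFB; have [lt_ij|lt_ji|/val_inj <-] := ltngtP i j.
  - have [-> ->] := coordmx_upper x lt_ij; have [-> ->] := coordmx_upper y lt_ij.
    by rewrite -!mulrBl !exprMn s2 mulrDl.
  - have [-> ->] := coordmx_lower x lt_ji; have [-> ->] := coordmx_lower y lt_ji.
    by rewrite -opprD sqrrN -!mulrBl !exprMn s2 addrC mulrDl.
  - have [-> ->] := coordmx_diag x i; have [-> ->] := coordmx_diag y i.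
    by rewrite subr0 expr0n addr0 -mulr2n -[_ *+ 2]mulr_natr mulfK// pnatr_eq0.
rewrite hs_norm_sqr; under eq_bigr do under eq_bigr do rewrite E.
transitivity (\sum_p D p ^+ 2).
  under eq_bigr do rewrite -mulr_suml big_split/=.
  rewrite -mulr_suml big_split/= [X in _ + X]exchange_big/=.
  rewrite (pair_bigA _ (fun i j => D (i, j) ^+ 2))/=.
  by rewrite -mulr2n -[_ *+ 2]mulr_natr mulfK ?pnatr_eq0//; apply: eq_bigr => -[].
rewrite (bigID (mem (coord_pairs K n)))/= [X in _ + X]big1 ?addr0; last first.
  by move=> p pN; rewrite /D !coord_at_notin// subr0 expr0n.
rewrite -big_uniq ?enum_uniq//=.
case def_r: (coord_pairs K n) => [|p0 r0].
  rewrite big_nil big1// => k; have := ltn_ord k.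
  by rewrite [X in (_ < X)%N](_ : _ = 0%N)// /dimE def_r.
rewrite -def_r (big_nth p0) big_mkord; apply: eq_bigr => k _.
by rewrite /D /coord_at index_uniq ?enum_uniq// -!tnth_nth.
Qed.

Lemma coordmx_surj (A : 'M[scal R K]_n) :
  selfadjoint A -> exists x : (dimE K n).-tuple T, coordmx x = A.
Proof.
move=> Aadj.
pose F (p : 'I_n * 'I_n) : R :=
  if p.1 == p.2 then reF (A p.1 p.1)
  else if (p.1 < p.2)%N then reF (A p.1 p.2) * Num.sqrt 2
  else imF (A p.2 p.1) * Num.sqrt 2.
have szF : size (map F (coord_pairs K n)) == dimE K n by rewrite size_map.
pose x : (dimE K n).-tuple T := Tuple szF.
have s2 : Num.sqrt 2 != 0 :> R by rewrite sqrtr_eq0 -ltNge.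
have AE i j : A i j = conjF (A j i) by rewrite -[in LHS]Aadj !mxE.
have xE p : p \in coord_pairs K n -> coord_at x p = F p.
  move=> pin; rewrite /coord_at (nth_map p) ?index_mem// nth_index//.
have reE (i j : 'I_n) : (i <= j)%N -> coord_at x (i, j) = F (i, j).
  by move=> ij; apply: xE; rewrite mem_enum inE/=; case: (K).
have imE (i j : 'I_n) : (i < j)%N -> coord_at x (j, i) = F (j, i).
  move=> ij; case: (boolP ((j, i) \in coord_pairs K n)) => [/xE//|jiN].
  rewrite coord_at_notin// /F/= -val_eqE/= (gtn_eqF ij) ltnNge (ltnW ij)/=.
  move: jiN; rewrite mem_enum inE/=; move: (A i j).
  by case: (K) => //= z _; rewrite mul0r.
have upper (i j : 'I_n) : (i < j)%N -> coordmx x i j = A i j.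
  move=> ij; have [re im] := coordmx_upper x ij.
  apply: scal_eqP; rewrite ?re ?im ?(reE _ _ (ltnW ij)) ?imE// /F/= -val_eqE/=.
    by rewrite (ltn_eqF ij) ij mulfK.
  by rewrite (gtn_eqF ij) ltnNge (ltnW ij)/= mulfK.
exists x; apply/matrixP => i j; have [ij|ji|/val_inj <-] := ltngtP i j.
- exact: upper.
- rewrite AE -upper// -[in LHS](coordmx_selfadjoint x).
  by rewrite /adjmx [LHS]mxE [X in conjF X]mxE.
- have [re im] := coordmx_diag x i.
  apply: scal_eqP; rewrite ?re ?im ?reE// /F/= ?eqxx//.
  have := AE i i; move: (A i i); case: (K) => //= -[a b] [] /= bE.
  by apply/eqP; rewrite eq_sym -eqNr -bE.
Qed.

End coordmx_theory.

(* By coordmx_selfadjoint, coordmx_isometry and coordmx_surj, coordmx is an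
   isometry from Euclidean space onto the self-adjoint matrices with the
   Hilbert-Schmidt norm, so it carries the Lebesgue measure of the former to that
   of the latter. *)
Section volume.
Variables (R : realType) (K : scalar_kind) (n : nat).
Local Notation M := 'M[scal R K]_n.
Implicit Types (A : set M) (f : M -> R).

Definition volE A : \bar R :=
  lebesgue_tuple (dimE K n) (@coordmx R K n @^-1` A).

Definition intE A f : \bar R :=
  (\int[lebesgue_tuple (dimE K n)]_(x in @coordmx R K n @^-1` A)
     (f (coordmx x))%:E)%E.

Definition op_ball : set M := [set T | selfadjoint T /\ s_max T <= 1].

Definition normalized A : set M :=
  [set inF K (fine (volE A) `^ (dimE K n)%:R^-1)^-1 *: T | T in A].

End volume.

Definition simeq (R : realType) (c1 c2 : R) (A B : \bar R) : Prop :=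
  (c1%:E * A <= B /\ B <= c2%:E * A)%E.

(* Main.v *)
From HB Require Import structures.
Require Import Defs.
From mathcomp Require Import all_boot all_order all_algebra.
From mathcomp Require Import all_classical all_reals all_analysis.
From mathcomp Require Import measurable_realfun complex spectral sesquilinear.
From mathcomp Require Import perm ring lra.

(** Let D be the unit ball, delta T = det (1 - T^2) and beta = 1 (symmetric
    matrices) or 2 (Hermitian matrices). The polynomial delta is nonnegative on D
    and vanishes on its boundary. Everything rests on the fields
    V_A(T) = A - T A T, the infinitesimal Moebius transformations of D. They
    are tangent to the boundary in the precise sense that the derivative of delta
    along V_A is - 2 tr(A T) delta ([ddet_mobius]), and the divergence of V_A is
    - kappa tr(A T) with kappa = beta n + 2 - beta ([frame_trace_sqr],
    [divergence_flux]).

    Apply the divergence theorem to T_lk w(delta) V_A, where w is a polynomial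
    with w(0) = 0. It reduces to the fundamental theorem of calculus
    ([ball_ibp]): a line parallel to a basis vector meets D in a segment, at the
    ends of which delta vanishes ([ball_slice]), and along which the integrand is a
    polynomial. With w(x) = x^s and A a matrix unit, this is a system of linear
    equations between the second moments of the entries of T for the weight
    delta^s ([wick_eq]). The weight s = 0 is the limit of the weights
    w(x) = 1 - (1 - x)^m ([cint_limit]), since the boundary is a null set
    ([boundary_null]). The system couples two or three moments at a time, and its
    solution ([real_moment], [complex_moment]) gives the averages over D
      - of T_ii^2: 1 / (kappa + 1),
      - of |T_ij|^2, i <> j: beta kappa / ((kappa + 1) (2 kappa - beta)),
      - of T_ii T_kk, i <> k: - beta / ((kappa + 1) (2 kappa - beta)),
    while the other second moments vanish. The first two are of order 1/n and the
    third is of order - 1/n^2.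

    Normalising the volume multiplies these averages by the square of the
    dilation factor r of D, r = vol(D)^(-1/d) where 2 d = n kappa, so that it
    remains to see that r^2 is of order n ([dilation_bounds]). The volume is
    bounded above by comparison with a Gaussian density, because D lies in the
    Hilbert-Schmidt ball of radius sqrt n ([volume_upper]). For the lower bound
    ([volume_lower]) let Z(s) be the integral of delta^s over D ([wvol]). From
    delta e^(tr T^2) <= 1 and the mean of tr T^2 for the weight delta^(s+1) one
    gets Z(s) >= e^(d / (kappa + 2 s + 3)) Z(s+1) ([wvol_step]); these factors
    telescope up to s = 2 d, where the mass in a small cube is enough
    ([wvol_cube]). *)

Set Implicit Arguments.
Unset Strict Implicit.
Unset Printing Implicit Defensive.

Import Order.TTheory GRing.Theory Num.Theory.
Import numFieldNormedType.Exports.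

Local Open Scope classical_set_scope.
Local Open Scope ring_scope.

(** * Polynomial functions of a matrix and their derivatives *)

Section polyfun.
Variables (F : fieldType) (n : nat).
Local Notation M := 'M[F]_n.
Implicit Types (f g : M -> F) (Df Dg : M -> M -> F).

(** A polynomial function comes with its derivative, which thus makes sense over
    any field and satisfies the rules of calculus by construction. The last
    constructor lets both be written in whatever form is convenient. *)
Inductive polyfun : (M -> F) -> (M -> M -> F) -> Prop :=
| polyfun_cst c : polyfun (fun=> c) (fun _ _ => 0)
| polyfun_entry i j : polyfun (fun T => T i j) (fun _ H => H i j)
| polyfun_add f g Df Dg : polyfun f Df -> polyfun g Dg ->
    polyfun (fun T => f T + g T) (fun T H => Df T H + Dg T H)
| polyfun_mul f g Df Dg : polyfun f Df -> polyfun g Dg ->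
    polyfun (fun T => f T * g T) (fun T H => Df T H * g T + f T * Dg T H)
| polyfun_ext f g Df Dg : polyfun f Df -> f =1 g -> Df =2 Dg -> polyfun g Dg.

(** Along a line, the formal derivative is that of a univariate polynomial: this
    is how analysis enters. *)
Lemma polyfun_line f Df : polyfun f Df -> forall T H, exists p : {poly F},
  forall t, p.[t] = f (T + t *: H) /\ p^`().[t] = Df (T + t *: H) H.
Proof.
elim=> {f Df} [c|i j|f g Df Dg _ IHf _ IHg|f g Df Dg _ IHf _ IHg
    |f g Df Dg _ IHf fg Dfg] T H.
- by exists c%:P => t; rewrite derivC !hornerE.
- exists ((T i j)%:P + (H i j)%:P * 'X) => t.
  by rewrite !poly.derivE !hornerE !mxE mulrC.
- have [p pE] := IHf T H; have [q qE] := IHg T H; exists (p + q) => t.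
  by rewrite derivD !hornerE; have [-> ->] := pE t; have [-> ->] := qE t.
- have [p pE] := IHf T H; have [q qE] := IHg T H; exists (p * q) => t.
  by rewrite derivM !hornerE; have [-> ->] := pE t; have [-> ->] := qE t.
- have [p pE] := IHf T H; exists p => t; rewrite -fg -Dfg; exact: pE.
Qed.

Lemma polyfun_dlinear f Df (I : finType) (c : I -> F) (e : I -> M) T :
  polyfun f Df -> Df T (\sum_k c k *: e k) = \sum_k c k * Df T (e k).
Proof.
elim=> {f Df} [x|i j|f g Df Dg _ IHf _ IHg|f g Df Dg _ IHf _ IHg
    |f g Df Dg _ IHf fg Dfg].
- by rewrite big1 // => k _; rewrite mulr0.
- by rewrite summxE; apply: eq_bigr => k _; rewrite mxE.
- by rewrite IHf IHg -big_split; apply: eq_bigr => k _; rewrite mulrDr.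
- rewrite IHf IHg mulr_suml mulr_sumr -big_split /=; apply: eq_bigr => k _.
  by rewrite mulrDr (mulrCA (f T)) (mulrA (c k)).
- by rewrite -Dfg IHf; apply: eq_bigr => k _; rewrite Dfg.
Qed.

(** The divergence of a polynomial field is thus measurable and bounded on bounded
    sets. *)
Lemma polyfun_derivative f Df H : polyfun f Df ->
  exists D, polyfun (fun T => Df T H) D.
Proof.
elim=> {f Df} [x|i j|f g Df Dg fP [D1 IHf] gP [D2 IHg]
    |f g Df Dg fP [D1 IHf] gP [D2 IHg]|f g Df Dg _ [D IHf] _ Dfg].
- by eexists; exact: (polyfun_cst 0).
- by eexists; exact: (polyfun_cst (H i j)).
- by eexists; exact: polyfun_add IHf IHg.
- by eexists; exact: polyfun_add (polyfun_mul IHf gP) (polyfun_mul fP IHg).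
- by exists D; apply: (polyfun_ext IHf) => // T; exact: Dfg.
Qed.

Lemma polyfun_sum (I : finType) (f : I -> M -> F) (Df : I -> M -> M -> F) :
  (forall i, polyfun (f i) (Df i)) ->
  polyfun (fun T => \sum_i f i T) (fun T H => \sum_i Df i T H).
Proof.
move=> fP; elim: index_enum => [|i r IH].
  by apply: (polyfun_ext (polyfun_cst 0)) => [T|T H]; rewrite big_nil.
by apply: (polyfun_ext (polyfun_add (fP i) IH)) => [T|T H]; rewrite big_cons.
Qed.

Lemma polyfun_prod m (f : 'I_m -> M -> F) (Df : 'I_m -> M -> M -> F) :
  (forall i, polyfun (f i) (Df i)) ->
  polyfun (fun T => \prod_i f i T)
    (fun T H => \sum_i \prod_j (if j == i then Df j T H else f j T)).
Proof.
elim: m f Df => [|m IH] f Df fP.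
  by apply: (polyfun_ext (polyfun_cst 1)) => [T|T H]; rewrite big_ord0.
have := polyfun_mul (fP ord0) (IH _ _ (fun i => fP (lift ord0 i))).
move/polyfun_ext; apply=> [T|T H] /=; first by rewrite big_ord_recl.
rewrite big_ord_recl; congr (_ + _).
  by rewrite big_ord_recl.
rewrite mulr_sumr; apply: eq_bigr => i _; rewrite big_ord_recl.
by congr (_ * _); apply: eq_bigr => j _; rewrite (inj_eq lift_inj).
Qed.

Lemma polyfun_horner (p : {poly F}) f Df : polyfun f Df ->
  polyfun (fun T => p.[f T]) (fun T H => p^`().[f T] * Df T H).
Proof.
move=> fP; elim/poly_ind: p => [|p c IH].
  apply: (polyfun_ext (polyfun_cst 0)) => [T|T H] /=; rewrite ?derivC ?horner0 //.
  by rewrite mul0r.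
have := polyfun_add (polyfun_mul IH fP) (polyfun_cst c).
move/polyfun_ext; apply=> [T|T H] /=; first by rewrite !hornerE.
by rewrite !poly.derivE !hornerE mulrDl addrC mulrAC.
Qed.

Definition polymx p q (G : M -> 'M[F]_(p, q)) (DG : M -> M -> 'M[F]_(p, q)) :=
  forall i j, polyfun (fun T => G T i j) (fun T H => DG T H i j).

Lemma polymx_cst p q (A : 'M[F]_(p, q)) : polymx (fun=> A) (fun _ _ => 0).
Proof.
by move=> i j; apply: (polyfun_ext (polyfun_cst (A i j))) => // T H; rewrite mxE.
Qed.

Lemma polymx_id : polymx id (fun _ H => H).
Proof. exact: polyfun_entry. Qed.

Lemma polymxM p q r (G : M -> 'M[F]_(p, q)) (G' : M -> 'M[F]_(q, r)) DG DG' :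
  polymx G DG -> polymx G' DG' ->
  polymx (fun T => G T *m G' T) (fun T H => DG T H *m G' T + G T *m DG' T H).
Proof.
move=> GP GP' i j; have := polyfun_sum (fun k => polyfun_mul (GP i k) (GP' k j)).
move/polyfun_ext; apply=> [T|T H] /=; rewrite !mxE //.
by rewrite big_split.
Qed.

Lemma polymxB p q (G G' : M -> 'M[F]_(p, q)) DG DG' :
  polymx G DG -> polymx G' DG' ->
  polymx (fun T => G T - G' T) (fun T H => DG T H - DG' T H).
Proof.
move=> GP GP' i j.
have := polyfun_add (GP i j) (polyfun_mul (polyfun_cst (-1)) (GP' i j)).
by move/polyfun_ext; apply=> [T|T H] /=; rewrite !mxE ?mul0r ?add0r mulN1r.
Qed.

Lemma polyfun_trace p (G : M -> 'M[F]_p) DG : polymx G DG ->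
  polyfun (fun T => \tr (G T)) (fun T H => \tr (DG T H)).
Proof. by move=> GP; apply: polyfun_sum => i; exact: GP. Qed.

(** Jacobi's formula. Differentiating the Leibniz expansion in the factor of index
    i amounts to replacing the i-th row by its derivative; the Laplace expansion
    along this row brings in the adjugate. *)
Lemma polyfun_det p (G : M -> 'M[F]_p) DG : polymx G DG ->
  polyfun (fun T => \det (G T)) (fun T H => \tr (DG T H *m \adj (G T))).
Proof.
move=> GP.
have := polyfun_sum (fun s : {perm 'I_p} => polyfun_mul (polyfun_cst ((-1) ^+ s))
  (polyfun_prod (fun i => GP i (s i)))).
move/polyfun_ext; apply=> [T|T H] /=; first by [].
under eq_bigr do rewrite mul0r add0r mulr_sumr.
rewrite exchange_big; apply: eq_bigr => i _.
pose B := \matrix_(k, j) (if k == i then DG T H k j else G T k j).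
transitivity (\det B).
  apply: eq_bigr => s _; congr (_ * _).
  by apply: eq_bigr => j _; rewrite !mxE.
rewrite (expand_det_row B i) mxE; apply: eq_bigr => j _.
rewrite !mxE eqxx; congr (_ * (_ * \det _)).
by apply/matrixP => a b; rewrite !mxE eq_sym (negPf (neq_lift _ _)).
Qed.

End polyfun.
Arguments polymx_id F n : clear implicits.

(** * The Moebius vector fields *)

Section mobius_field.
Variables (F : fieldType) (n : nat).
Local Notation M := 'M[F]_n.
Implicit Types (A T H V W : M).

(** For a self-adjoint T this is the product of the 1 - l^2 over the eigenvalues l
    of T: a polynomial which is positive inside the unit ball and zero on its
    boundary. *)
Definition bdet T : F := \det (1%:M - T *m T).
(** The velocity at time 0 of the Moebius transformations of the matrix ball that
    move 0 in the direction A. *)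
Definition mobius A T : M := A - T *m A *m T.
Definition ddet T H : F := \tr (- (H *m T + T *m H) *m \adj (1%:M - T *m T)).

Lemma polyfun_bdet : polyfun bdet ddet.
Proof.
have := polyfun_det (polymxB (polymx_cst _ 1%:M)
  (polymxM (polymx_id F n) (polymx_id F n))).
by move/polyfun_ext; apply=> // T H; rewrite /ddet sub0r.
Qed.

Lemma polymx_mobius A :
  polymx (mobius A) (fun T H => - (H *m A *m T + T *m A *m H)).
Proof.
have := polymxB (polymx_cst _ A)
  (polymxM (polymxM (polymx_id F n) (polymx_cst _ A)) (polymx_id F n)).
move=> + i j; move=> /(_ i j)/polyfun_ext; apply=> // T H.
by rewrite mulmx0 addr0 sub0r.
Qed.

(** For H = A - T A T, H T + T H = (1 - T^2) A T + T A (1 - T^2), and the adjugate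
    of 1 - T^2 turns either factor 1 - T^2 into the scalar [bdet T]. *)
Lemma ddet_mobius A T : ddet T (mobius A T) = - (2 * \tr (A *m T) * bdet T).
Proof.
rewrite /ddet /mobius; set P := 1%:M - T *m T; set Q := \adj P.
have T2 : T *m T = 1%:M - P by rewrite /P opprB addrC subrK.
have QT2 : Q *m (T *m T) = Q - (bdet T)%:M.
  by rewrite T2 mulmxBr mulmx1 mul_adj_mx.
have T2Q : T *m T *m Q = Q - (bdet T)%:M.
  by rewrite T2 mulmxBl mul1mx mul_mx_adj.
rewrite mulNmx linearN /=; congr (- _).
rewrite mulmxBl mulmxBr !mulmxDl !mulNmx !linearD !linearN /=.
have -> : \tr (T *m A *m T *m T *m Q) = \tr (T *m A *m Q) - bdet T * \tr (A *m T).
  rewrite -(mulmxA _ T T) -(mulmxA _ (T *m T)) T2Q mulmxBr linearB /=.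
  by rewrite mul_mx_scalar linearZ /= (mxtrace_mulC T).
have -> : \tr (T *m (T *m A *m T) *m Q) = \tr (A *m T *m Q) - bdet T * \tr (A *m T).
  have -> : T *m (T *m A *m T) *m Q = T *m T *m (A *m T *m Q) by rewrite !mulmxA.
  rewrite mxtrace_mulC -(mulmxA _ Q) QT2 mulmxBr linearB /=.
  by rewrite mul_mx_scalar linearZ.
ring.
Qed.

(** In the real case, where the frame turns a field into its symmetric part, the
    derivative of [bdet] along this part is the one along the field. *)
Lemma ddet_tr T H : T^T = T -> ddet T H^T = ddet T H.
Proof.
move=> Ts; rewrite /ddet -mxtrace_tr trmx_mul linearN linearD /= !trmx_mul.
rewrite trmxK Ts trmx_adj linearB /= trmx_mul Ts trmx1 mxtrace_mulC.
by rewrite (addrC (T *m H)).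
Qed.

Variables (d : nat) (e : 'I_d -> M) (tau : F).
Hypothesis frameP : forall V,
  \sum_k \tr (e k *m V) *: e k = (1 - tau) *: V + tau *: V^T.

Definition frame_dim : F := (1 - tau) * n%:R + tau.

(** On matrix units, the frame identity gives the sum over k of any product of two
    entries of [e k]; it follows that the sum of the squares of the [e k] is a
    scalar matrix. *)
Lemma frame_trace_sqr W :
  \sum_k \tr (e k *m e k *m W) = frame_dim * \tr W.
Proof.
have tr_delta (B : M) p q : \tr (B *m delta_mx q p) = B p q.
  rewrite /mxtrace (bigD1 p) //= big1 ?addr0 => [|i ip].
    rewrite mxE (bigD1 q) //= big1 ?addr0 => [|j jq].
      by rewrite mxE !eqxx mulr1.
    by rewrite mxE (negPf jq) mulr0.
  by rewrite mxE big1 // => j _; rewrite mxE (negPf ip) andbF mulr0.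
have ee p q s :
    \sum_k e k p q * e k q s = (1 - tau) * (s == p)%:R + tau * ((q == p) && (s == q))%:R.
  have /matrixP/(_ q s) := frameP (delta_mx q p).
  rewrite summxE trmx_delta !mxE !eqxx /= => <-; apply: eq_bigr => k _.
  by rewrite tr_delta mxE.
have esq : \sum_k e k *m e k = frame_dim%:M.
  apply/matrixP => p s; rewrite summxE mxE.
  under eq_bigr do rewrite mxE.
  rewrite exchange_big /=; under eq_bigr do rewrite ee.
  rewrite big_split /= sumr_const card_ord -mulr_sumr (bigD1 p) //= eqxx /=.
  rewrite big1 => [|i /negPf ->]; last by [].
  rewrite addr0 /frame_dim eq_sym; case: eqP => _; rewrite ?mulr1 ?mulr0 ?mul0rn ?addr0//.
  by rewrite mulr1n mulr_natr.
rewrite -linear_sum -mulmx_suml esq /= mul_scalar_mx.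
by rewrite linearZ.
Qed.

Variables (A : M) (g : M -> F) (Dg : M -> M -> F) (w : {poly F}).
Hypothesis gP : polyfun g Dg.

Definition flux k T : F := \tr (e k *m mobius A T) * (g T * w.[bdet T]).
Definition dflux k T H : F :=
  \tr (e k *m - (H *m A *m T + T *m A *m H)) * (g T * w.[bdet T]) +
  \tr (e k *m mobius A T) *
    (Dg T H * w.[bdet T] + g T * (w^`().[bdet T] * ddet T H)).

Lemma polyfun_flux k : polyfun (flux k) (dflux k).
Proof.
apply: polyfun_mul; last first.
  exact: polyfun_mul gP (polyfun_horner w polyfun_bdet).
have := polyfun_trace (polymxM (polymx_cst _ (e k)) (polymx_mobius A)).
by move/polyfun_ext; apply=> // T H; rewrite mul0mx add0r.
Qed.

(** The three contributions are the divergence of the Moebius field, a multiple of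
    tr(A T) by [frame_trace_sqr], the derivative of [g] along the field, and that
    of the weight, which contains the factor [bdet T] by [ddet_mobius]. *)
Lemma divergence_flux T : tau *: T^T = tau *: T ->
  \sum_k dflux k T (e k) =
    w.[bdet T] * (Dg T ((1 - tau) *: mobius A T + tau *: (mobius A T)^T)
                  - 2 * frame_dim * \tr (A *m T) * g T)
    - 2 * (w^`().[bdet T] * bdet T) * (\tr (A *m T) * g T).
Proof.
move=> Ts; rewrite big_split /= -mulr_suml.
have -> : \sum_k \tr (e k *m - (e k *m A *m T + T *m A *m e k)) =
    - (2 * frame_dim * \tr (A *m T)).
  under eq_bigr => k _.
    rewrite mulmxN mulmxDr linearN linearD /= opprD -!mulmxA.
    rewrite (mxtrace_mulC (e k) (T *m _)) -!mulmxA (mxtrace_mulC T) -!mulmxA.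
    rewrite (mxtrace_mulC A) -!mulmxA !(mulmxA (e k) (e k)).
    over.
  rewrite big_split /= !sumrN !frame_trace_sqr (mxtrace_mulC T).
  by ring.
pose S := (1 - tau) *: mobius A T + tau *: (mobius A T)^T.
have sumD (f : M -> F) Df : polyfun f Df ->
    \sum_k \tr (e k *m mobius A T) * Df T (e k) = Df T S.
  by move=> fP; rewrite -(polyfun_dlinear _ _ _ fP) frameP.
have -> : \sum_k \tr (e k *m mobius A T) * (Dg T (e k) * w.[bdet T] +
      g T * (w^`().[bdet T] * ddet T (e k))) =
    Dg T S * w.[bdet T] + g T * (w^`().[bdet T] * ddet T S).
  rewrite -(sumD _ _ gP) -(sumD _ _ polyfun_bdet) mulr_suml !mulr_sumr -big_split.
  by apply: eq_bigr => k _ /=; ring.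
have -> : ddet T S = - (2 * \tr (A *m T) * bdet T).
  have [tau0|tau0] := eqVneq tau 0.
    by rewrite /S tau0 subr0 scale0r addr0 scale1r ddet_mobius.
  have /ddet_tr Tt : T^T = T by exact: (scalerI tau0).
  pose c (b : bool) := if b then 1 - tau else tau.
  pose m (b : bool) := if b then mobius A T else (mobius A T)^T.
  have -> : S = \sum_b c b *: m b by rewrite big_bool.
  rewrite (polyfun_dlinear _ _ _ polyfun_bdet) big_bool /= Tt -mulrDl subrK mul1r.
  exact: ddet_mobius.
by rewrite -/S; ring.
Qed.

End mobius_field.

(** * Real and imaginary parts of scalars *)

Section scalar_parts.
Variables (R : realType) (K : scalar_kind).
Implicit Types (a b : R) (z : scal R K).

Lemma reF_inF a : reF (inF K a) = a.
Proof. exact: reF_mkF. Qed.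

Lemma imF_inF a : imF (inF K a) = 0.
Proof. exact: imF_mkF0. Qed.

Lemma reF_mul z w : reF (z * w) = reF z * reF w - imF z * imF w.
Proof. by case: K z w => [z w|[a b] [c d]] //=; rewrite mul0r subr0. Qed.

Lemma imF_mul z w : imF (z * w) = reF z * imF w + imF z * reF w.
Proof. by case: K z w => [z w|[a b] [c d]] //=; rewrite mulr0 mul0r addr0. Qed.

Lemma imFD (z w : scal R K) : imF (z + w) = imF z + imF w.
Proof. by case: K z w => [z w|[a b] [c d]] //=; rewrite addr0. Qed.

Lemma imF0 : imF (0 : scal R K) = 0.
Proof. by case: K. Qed.

Lemma imF_sum I (r : seq I) (P : pred I) (F : I -> scal R K) :
  imF (\sum_(i <- r | P i) F i) = \sum_(i <- r | P i) imF (F i).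
Proof. exact: (big_morph _ imFD imF0). Qed.

Lemma reF_inFM a z : reF (inF K a * z) = a * reF z.
Proof. by rewrite reF_mul reF_inF imF_inF mul0r subr0. Qed.

Lemma imF_inFM a z : imF (inF K a * z) = a * imF z.
Proof. by rewrite imF_mul reF_inF imF_inF mul0r addr0. Qed.

Lemma inF_zmod_morphism : zmod_morphism (@inF R K).
Proof. by move=> a b; apply: scal_eqP; rewrite ?reFB ?imFB ?reF_inF ?imF_inF ?subr0. Qed.

Lemma inF_monoid_morphism : monoid_morphism (@inF R K).
Proof.
split=> [|a b]; first by rewrite /inF; case: K.
by apply: scal_eqP; rewrite ?reF_inFM ?imF_inFM ?reF_inF ?imF_inF ?mulr0.
Qed.

HB.instance Definition _ :=
  GRing.isZmodMorphism.Build R (scal R K) (@inF R K) inF_zmod_morphism.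
HB.instance Definition _ :=
  GRing.isMonoidMorphism.Build R (scal R K) (@inF R K) inF_monoid_morphism.

Lemma reF_conj z : reF (conjF z) = reF z.
Proof. exact: reF_mkF. Qed.

Lemma imF_conj z : imF (conjF z) = - imF z.
Proof. by rewrite imF_mkF; case: K z => //= _; rewrite oppr0. Qed.

Lemma inF_conj a : conjF (inF K a) = inF K a.
Proof. by rewrite conjF_mkF oppr0. Qed.

Lemma conjFD z w : conjF (z + w) = conjF z + conjF w.
Proof.
apply: scal_eqP; rewrite ?(reF_conj, imF_conj, reFD, imFD) ?(reF_conj, imF_conj)//.
by rewrite opprD.
Qed.

Lemma conjFM z w : conjF (z * w) = conjF z * conjF w.
Proof.
apply: scal_eqP; rewrite ?(reF_conj, imF_conj, reF_mul, imF_mul) ?(reF_conj, imF_conj).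
  by rewrite mulrNN.
by rewrite mulrN mulNr opprD.
Qed.

Lemma conjF_sum I (r : seq I) (P : pred I) (F : I -> scal R K) :
  conjF (\sum_(i <- r | P i) F i) = \sum_(i <- r | P i) conjF (F i).
Proof.
apply: (big_morph _ conjFD).
by apply: scal_eqP; rewrite ?reF_conj ?imF_conj ?imF0 ?oppr0.
Qed.

Lemma conjFK : involutive (@conjF R K).
Proof. by move=> z; apply: scal_eqP; rewrite !(reF_conj, imF_conj) ?opprK. Qed.

End scalar_parts.

(** * The coordinates as an orthonormal frame *)

Section frame.
Variables (R : realType) (K : scalar_kind) (n : nat).
Local Notation M := 'M[scal R K]_n.
Local Notation X := ((dimE K n).-tuple (measurableTypeR R)).

Lemma coord_at_sum (I : finType) (c : I -> R) (y : I -> X) (z : X) p :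
  (forall k, tnth z k = \sum_i c i * tnth (y i) k :> R) ->
  coord_at z p = \sum_i c i * coord_at (y i) p.
Proof.
move=> zE; have [pin|pN] := boolP (p \in coord_pairs K n); last first.
  by rewrite coord_at_notin// big1// => i _; rewrite coord_at_notin// mulr0.
have pk : (index p (coord_pairs K n) < dimE K n)%N by rewrite index_mem.
transitivity (tnth z (Ordinal pk)); first by rewrite (tnth_nth 0).
by rewrite zE; apply: eq_bigr => i _; rewrite (tnth_nth 0).
Qed.

Lemma coordmx_sum (I : finType) (c : I -> R) (y : I -> X) (z : X) :
  (forall k, tnth z k = \sum_i c i * tnth (y i) k :> R) ->
  coordmx z = \sum_i inF K (c i) *: coordmx (y i).
Proof.
move=> zE; have cE p := coord_at_sum p zE.
have mkE (a b : I -> R) : mkF K (\sum_i c i * a i) (\sum_i c i * b i) =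
    \sum_i inF K (c i) * mkF K (a i) (b i).
  apply: scal_eqP; rewrite ?reF_sum ?imF_sum ?reF_mkF ?imF_mkF.
    by apply: eq_bigr => i _; rewrite reF_inFM reF_mkF.
  under [RHS]eq_bigr do rewrite imF_inFM imF_mkF.
  by case: K => //; rewrite big1// => i _; rewrite mulr0.
apply/matrixP => i j; rewrite summxE.
under [RHS]eq_bigr do rewrite mxE mxE.
rewrite mxE; case: ifP => _.
  by rewrite cE rmorph_sum; apply: eq_bigr => k _; rewrite rmorphM.
by case: ifP => _; rewrite !cE !mulr_suml -?sumrN -mkE;
  congr (mkF _ _ _); apply: eq_bigr => k _; rewrite ?mulrN mulrA.
Qed.

Lemma coordmx_lin t (x y z : X) :
  (forall k, tnth z k = tnth x k + t * tnth y k :> R) ->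
  coordmx z = coordmx x + inF K t *: coordmx y.
Proof.
move=> zE.
have := @coordmx_sum bool (fun b => if b then 1 else t) (fun b => if b then x else y) z.
rewrite !big_bool /= rmorph1 scale1r; apply => k.
by rewrite big_bool mul1r.
Qed.

Lemma coordmx_scale t (x z : X) :
  (forall k, tnth z k = t * tnth x k :> R) -> coordmx z = inF K t *: coordmx x.
Proof.
move=> zE; have := @coordmx_sum unit (fun=> t) (fun=> x) z.
by rewrite !big_const card_unit /= addr0; apply=> k; rewrite big_const card_unit/= addr0.
Qed.

Definition basis_tuple (k : 'I_(dimE K n)) : X := [tuple (j == k)%:R | j < dimE K n].
Definition basis k : M := coordmx (basis_tuple k).

Lemma coordmx_basis (x : X) : coordmx x = \sum_k inF K (tnth x k) *: basis k.
Proof.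
apply: coordmx_sum => k; rewrite (bigD1 k)//= big1 => [|j jk].
  by rewrite tnth_mktuple eqxx mulr1 addr0.
by rewrite tnth_mktuple eq_sym (negPf jk) mulr0.
Qed.

Lemma trace_conj (A B : M) : selfadjoint A -> selfadjoint B ->
  conjF (\tr (A *m B)) = \tr (A *m B).
Proof.
move=> sA sB; rewrite [RHS]mxtrace_mulC -[in RHS]sA -[in RHS]sB conjF_sum.
apply: eq_bigr => i _; rewrite !mxE conjF_sum; apply: eq_bigr => j _.
by rewrite !mxE conjFM mulrC.
Qed.

(** The isometry property of the coordinates gives the case x = y, and
    polarisation does the rest. *)
Lemma trace_coordmx (x y : X) :
  \tr (coordmx x *m coordmx y) = inF K (\sum_k tnth x k * tnth y k).
Proof.
have trE (u v : X) : imF (\tr (coordmx u *m coordmx v)) = 0.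
  have /(congr1 (@imF R K)) := trace_conj (coordmx_selfadjoint u) (coordmx_selfadjoint v).
  by rewrite imF_conj => /eqP; rewrite eqNr => /eqP.
have sqE (u : X) : reF (\tr (coordmx u *m coordmx u)) = \sum_k (tnth u k : R) ^+ 2.
  pose z : X := [tuple 0 | k < dimE K n].
  have := coordmx_isometry u z.
  have -> : coordmx z = 0.
    rewrite coordmx_basis big1// => k _.
    by rewrite tnth_mktuple rmorph0 scale0r.
  rewrite subr0 /hs_norm sqr_sqrtr.
    rewrite coordmx_selfadjoint => ->; apply: eq_bigr => k _.
    by rewrite tnth_mktuple subr0.
  rewrite /mxtrace reF_sum; apply: sumr_ge0 => i _; rewrite mxE reF_sum.
  by apply: sumr_ge0 => j _; rewrite !mxE reF_mulconj addr_ge0 ?sqr_ge0.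
apply: scal_eqP; rewrite ?reF_inF ?imF_inF ?trE//.
pose s : X := [tuple (tnth x k : R) + tnth y k | k < dimE K n].
have sE : coordmx s = coordmx x + coordmx y.
  rewrite (@coordmx_lin 1 x y s) ?rmorph1 ?scale1r// => k.
  by rewrite tnth_mktuple mul1r.
have := sqE s; rewrite sE mulmxDl !mulmxDr !linearD /= !reFD.
rewrite (mxtrace_mulC (coordmx y) (coordmx x)) !sqE.
have -> : \sum_k (tnth s k : R) ^+ 2 = \sum_k (tnth x k : R) ^+ 2
   + (\sum_k tnth x k * tnth y k) *+ 2 + \sum_k (tnth y k : R) ^+ 2.
  rewrite -sumrMnl -!big_split /=; apply: eq_bigr => k _.
  by rewrite tnth_mktuple sqrrD.
by move=> E; lra.
Qed.

Lemma frame_selfadjoint (H : M) : selfadjoint H ->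
  \sum_k \tr (basis k *m H) *: basis k = H.
Proof.
move=> /coordmx_surj[x <-]; rewrite [RHS]coordmx_basis; apply: eq_bigr => k _.
congr (_ *: _); rewrite trace_coordmx; congr inF.
rewrite (bigD1 k)//= big1 => [|j jk]; rewrite tnth_mktuple.
  by rewrite eqxx mul1r addr0.
by rewrite (negPf jk) mul0r.
Qed.

Lemma frame_lin a (H H' : M) :
  \sum_k \tr (basis k *m (H + a *: H')) *: basis k =
  \sum_k \tr (basis k *m H) *: basis k +
    a *: \sum_k \tr (basis k *m H') *: basis k.
Proof.
rewrite scaler_sumr -big_split; apply: eq_bigr => k _ /=.
by rewrite mulmxDr -scalemxAr linearD linearZ /= scalerDl scalerA.
Qed.

End frame.
Arguments basis {R K n} k.

(** The Hermitian matrices span all the matrices over the complex numbers, while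
    the real symmetric ones span only themselves: [tau] is the weight of the
    transpose in the projection onto the span. *)
Definition tau (R : realType) K : scal R K := if K is RealK then 2^-1 else 0.

(** The identity holds on self-adjoint matrices because the basis is orthonormal.
    It extends by linearity to the combinations of two Hermitian matrices in the
    complex case, and in the real case [V] and its symmetric part have the same
    inner products with the basis. *)
Lemma frameP (R : realType) K n (V : 'M[scal R K]_n) :
  \sum_k \tr (basis k *m V) *: basis k = (1 - tau R K) *: V + tau R K *: V^T.
Proof.
case: K V => V.
  have half : 1 - tau R RealK = tau R RealK.
    by have : 1 - 2^-1 = 2^-1 :> R by lra.
  have adjE (A : 'M[scal R RealK]_n) : adjmx A = A^T.
    by apply/matrixP => i j; rewrite !mxE.
  have trT k : \tr (basis k *m V^T) = \tr (basis k *m V).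
    rewrite -mxtrace_tr trmx_mul trmxK mxtrace_mulC -adjE; congr (\tr (_ *m _)).
    exact: coordmx_selfadjoint.
  have /frame_selfadjoint <- :
      selfadjoint ((1 - tau R RealK) *: V + tau R RealK *: V^T).
    by rewrite half /selfadjoint /mkset adjE linearD !linearZ /= trmxK addrC.
  apply: eq_bigr => k _; congr (_ *: _).
  rewrite mulmxDr -!scalemxAr linearD !linearZ /= trT -mulrDl.
  by rewrite [1 - _ + _]subrK mul1r.
rewrite /tau subr0 scale1r scale0r addr0.

pose j : scal R ComplexK := Complex 0 1.
have jj : j * j = -1 by apply: scal_eqP => /=; ring.
have cj : conjF j = - j by apply: scal_eqP => //=; rewrite oppr0.
have conjj z : conjF (j * z) = - (j * conjF z) by rewrite conjFM cj mulNr.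
have selfsum (A : 'M[scal R ComplexK]_n) : selfadjoint (A + adjmx A).
  by apply/matrixP => a b; rewrite !mxE conjFD conjFK addrC.
have c2 : (2^-1 : scal R ComplexK) = inF ComplexK 2^-1.
  by rewrite [RHS]fmorphV rmorph_nat.
have selfZ (A : 'M[scal R ComplexK]_n) :
    selfadjoint A -> selfadjoint (2^-1 *: A).
  move=> sA; apply/matrixP => a b; rewrite -{2}sA !mxE conjFM c2 inF_conj.
  by [].
have [H1 [H2 [sH1 sH2 ->]]] : exists H1 H2, [/\ selfadjoint H1, selfadjoint H2 &
    V = H1 + (- j) *: H2].
  exists (2^-1 *: (V + adjmx V)), (2^-1 *: (j *: V + adjmx (j *: V))).
  split; [exact/selfZ/selfsum|exact/selfZ/selfsum|].
  apply/matrixP => a b; rewrite !mxE conjj.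
  have : j * j = -1 := jj; move: (V a b) (conjF _) => x y {}jj.
  have -> : - j * (2^-1 * (j * x - j * y)) = 2^-1 * (- (j * j)) * (x - y) by ring.
  by rewrite jj; field.
by rewrite frame_lin (frame_selfadjoint sH1) (frame_selfadjoint sH2).
Qed.

(** * Lebesgue measure on tuples: coordinate lines and dilations *)

Section tuple_integral.
Variable R : realType.
Local Notation T := (measurableTypeR R).
Local Notation lam := (@lebesgue_tuple R).
Local Open Scope ereal_scope.

Lemma ge0_integral_tupleS d (f : d.+1.-tuple T -> \bar R) :
  measurable_fun setT f -> (forall x, 0 <= f x) ->
  \int[lam d.+1]_x f x =
  \int[(lebesgue_measure \x lam d)%E]_p f (tuple_cons p).
Proof.
move=> mf f0.
have mc := @measurable_tuple_cons R d.
rewrite -[RHS](@ge0_integral_pushforward _ _ _ _ _ _ mc _ setT f)//.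
Qed.

Lemma tonelli_tuple_head d (f : d.+1.-tuple T -> \bar R) :
  measurable_fun setT f -> (forall x, 0 <= f x) ->
  \int[lam d.+1]_x f x = \int[lam d]_y \int[lebesgue_measure]_t f (tuple_cons (t, y)).
Proof.
move=> mf f0; rewrite ge0_integral_tupleS//.
rewrite (fubini_tonelli2 (fun p => f (tuple_cons p)))//.
by apply: measurableT_comp => //; exact: measurable_tuple_cons.
Qed.

Lemma tonelli_tuple_tail d (f : d.+1.-tuple T -> \bar R) :
  measurable_fun setT f -> (forall x, 0 <= f x) ->
  \int[lam d.+1]_x f x = \int[lebesgue_measure]_t \int[lam d]_y f (tuple_cons (t, y)).
Proof.
move=> mf f0; rewrite ge0_integral_tupleS//.
rewrite (fubini_tonelli1 (fun p => f (tuple_cons p)))//.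
by apply: measurableT_comp => //; exact: measurable_tuple_cons.
Qed.

Lemma measurable_tuple_consr d (t : T) :
  measurable_fun setT (fun y : d.-tuple T => tuple_cons (t, y)).
Proof.
apply: measurableT_comp; first exact: measurable_tuple_cons.
exact: pair1_measurable.
Qed.

Lemma measurable_tuple_consl d (y : d.-tuple T) :
  measurable_fun setT (fun t : T => tuple_cons (t, y)).
Proof.
apply: measurableT_comp; first exact: measurable_tuple_cons.
exact: pair2_measurable.
Qed.

Definition tset d (k : 'I_d) (t : T) (x : d.-tuple T) : d.-tuple T :=
  [tuple if j == k then t else tnth x j | j < d].

Lemma tset_head d t s (y : d.-tuple T) :
  tset ord0 t (tuple_cons (s, y)) = tuple_cons (t, y).
Proof.
apply: eq_from_tnth => j; rewrite tnth_mktuple.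
by case: (unliftP ord0 j) => [i|] ->; rewrite ?eqxx ?(tnth_nth 0%R).
Qed.

Lemma tset_tail d (k : 'I_d) t s (y : d.-tuple T) :
  tset (lift ord0 k) t (tuple_cons (s, y)) = tuple_cons (s, tset k t y).
Proof.
apply: eq_from_tnth => j; rewrite tnth_mktuple.
case: (unliftP ord0 j) => [i|] ->.
  rewrite (inj_eq lift_inj) !(tnth_nth 0%R)/= -[LHS]/(if i == k then t else nth 0%R y i).
  by rewrite -(tnth_nth 0%R (tset k t y) i) tnth_mktuple -tnth_nth.
by rewrite !(tnth_nth 0%R).
Qed.

(** Comparing two nonnegative functions, rather than computing one iterated
    integral, keeps the induction on the coordinates inside Tonelli's theorem: no
    integrability on the intermediate slices has to be known. *)
Lemma ge0_eq_integral_lines d (k : 'I_d) (f g : d.-tuple T -> \bar R) :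
  measurable_fun setT f -> (forall x, 0 <= f x) ->
  measurable_fun setT g -> (forall x, 0 <= g x) ->
  (forall x, \int[lebesgue_measure]_t f (tset k t x) =
             \int[lebesgue_measure]_t g (tset k t x)) ->
  \int[lam d]_x f x = \int[lam d]_x g x.
Proof.
elim: d k f g => [[]//|d IH] k f g mf f0 mg g0 fg.
case: (unliftP ord0 k) fg => [k'|] -> fg.
  rewrite (tonelli_tuple_tail mf f0) (tonelli_tuple_tail mg g0); apply: eq_integral => t _.
  apply: (IH k') => //.
  - exact: measurableT_comp mf (measurable_tuple_consr _).
  - exact: measurableT_comp mg (measurable_tuple_consr _).
  move=> y; have := fg (tuple_cons (t, y)).
  under eq_integral do rewrite tset_tail.
  by under [in RHS]eq_integral do rewrite tset_tail.
rewrite (tonelli_tuple_head mf f0) (tonelli_tuple_head mg g0); apply: eq_integral => y _.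
have := fg (tuple_cons (0%R, y)).
under eq_integral do rewrite tset_head.
by under [in RHS]eq_integral do rewrite tset_head.
Qed.

Lemma ge0_integral_scale1 (c : R) (f : T -> \bar R) : (0 < c)%R ->
  measurable_fun setT f -> (forall x, 0 <= f x) ->
  \int[lebesgue_measure]_t f t = c%:E * \int[lebesgue_measure]_t f (c * t)%R.
Proof.
move=> c0 mf f0; pose cn : {nonneg R} := NngNum (ltW c0).
have mc : measurable_fun setT (fun t : T => (c * t)%R : T) by exact: measurable_funM.
pose nu := measure_function_pushforward__canonical__measure_function_Measure
  (@lebesgue_measure R) mc.
pose mu : {measure set T -> \bar R} := mscale cn nu.
transitivity (\int[mu]_t f t).
  apply: eq_measure_integral => A mA _; apply: lebesgue_measure_unique => //.
  move=> X /ocitvP[->|[[a b] /= ab ->]]; first by rewrite !measure0.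
  rewrite /mu /= /mscale /= /nu /= /pushforward /=.
  have -> : (fun t : T => (c * t)%R : T) @^-1` `]a, b]%classic =
      `](a / c)%R, (b / c)%R]%classic.
    by apply/seteqP; split=> t /=; rewrite !in_itv/= ltr_pdivrMr// ler_pdivlMr// mulrC.
  rewrite !lebesgue_measure_itv/= !lte_fin ab ltr_pM2r ?invr_gt0// ab.
  by rewrite -!EFinB -EFinM -mulrBl mulrC divfK// gt_eqF.
rewrite ge0_integral_mscale//; congr (_ * _).
by rewrite (ge0_integral_pushforward mc).
Qed.

End tuple_integral.

Section tuple_scaling.
Variable R : realType.
Local Notation T := (measurableTypeR R).
Local Notation lam := (@lebesgue_tuple R).
Local Open Scope ereal_scope.

Definition tscale d (c : R) (x : d.-tuple T) : d.-tuple T :=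
  [tuple (c * tnth x j)%R | j < d].

Lemma measurable_tscale d c : measurable_fun setT (@tscale d c).
Proof.
apply/measurable_fun_tnthP => k /=.
rewrite (_ : _ \o _ = (fun x : d.-tuple T => (c * tnth x k)%R)); last first.
  by apply/funext => x /=; rewrite tnth_mktuple.
by apply: measurable_funM => //; exact: measurable_tnth.
Qed.

Lemma ge0_integral_tscale d (c : R) (f : d.-tuple T -> \bar R) : (0 < c)%R ->
  measurable_fun setT f -> (forall x, 0 <= f x) ->
  \int[lam d]_x f x = (c ^+ d)%:E * \int[lam d]_x f (tscale c x).
Proof.
move=> c0; elim: d f => [|d IH] f mf f0.
  rewrite expr0 mul1e; apply: eq_integral => x _; congr f.
  by rewrite (tuple0 x) [RHS]tuple0.
have mfs : measurable_fun setT (fun x => f (tscale c x)).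
  exact: measurableT_comp mf (measurable_tscale c).
rewrite !tonelli_tuple_head//.
have mh : measurable_fun setT
    (fun y : d.-tuple T => \int[lebesgue_measure]_t f (tuple_cons (t, y))).
  apply: (measurable_fun_fubini_tonelli_G (fun p => f (tuple_cons p))) => //.
  exact: measurableT_comp mf (@measurable_tuple_cons R d).
rewrite (IH _ mh); last by move=> y; exact: integral_ge0.
rewrite exprSr EFinM -muleA; congr (_ * _).
rewrite -ge0_integralZl_EFin ?ltW//; last 2 first.
- by move=> y _; exact: integral_ge0.
- apply: (measurable_fun_fubini_tonelli_G (fun p => f (tscale c (tuple_cons p)))) => //.
  exact: measurableT_comp mfs (@measurable_tuple_cons R d).
apply: eq_integral => y _; rewrite (ge0_integral_scale1 c0)//; last first.
  exact: measurableT_comp mf (measurable_tuple_consl _).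
congr (_ * _); apply: eq_integral => t _; congr f.
apply: eq_from_tnth => j; rewrite tnth_mktuple.
by case: (unliftP ord0 j) => [i|] ->; rewrite !(tnth_nth 0%R)//=
  -[in LHS](tnth_nth 0%R (tscale c y) i) tnth_mktuple (tnth_nth 0%R).
Qed.

Lemma integral_tuple_prod d (phi : T -> R) (a : R) :
  measurable_fun setT phi -> (forall t, 0 <= phi t)%R ->
  \int[lebesgue_measure]_t (phi t)%:E = a%:E ->
  \int[lam d]_x (\prod_(k < d) phi (tnth x k))%:E = (a ^+ d)%:E.
Proof.
move=> mphi phi0 phia.
have a0 : (0 <= a)%R by rewrite -lee_fin -phia integral_ge0// => t _; rewrite lee_fin.
have mprod m : measurable_fun setT (fun x : m.-tuple T => (\prod_(k < m) phi (tnth x k))%:E).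
  apply/measurable_EFinP; apply: measurable_prod => k _.
  by apply: measurableT_comp => //; exact: measurable_tnth.
elim: d => [|d IH].
  rewrite [LHS]integral_dirac; [|exact: measurableT|exact: (mprod 0%N)].
  by rewrite [X in X * _](diracT R ([tuple] : 0.-tuple T)) mul1e big_ord0 expr0.
rewrite tonelli_tuple_tail//; last by move=> x; rewrite lee_fin; exact: prodr_ge0.
transitivity (\int[lebesgue_measure]_t ((a ^+ d)%:E * (phi t)%:E)).
  apply: eq_integral => t _.
  transitivity (\int[lam d]_y ((phi t)%:E * (\prod_(k < d) phi (tnth y k))%:E)).
    apply: eq_integral => y _; rewrite big_ord_recl EFinM (tnth_nth 0%R)/=.
    congr (_ * _%:E); apply: eq_bigr => k _.
    by rewrite (tnth_nth 0%R)/= -(tnth_nth 0%R y).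
  rewrite ge0_integralZl_EFin//; [by rewrite IH muleC|move=> y _|exact: mprod].
  by rewrite lee_fin; exact: prodr_ge0.
rewrite /= ge0_integralZl_EFin//.
- by rewrite phia -EFinM exprSr.
- by move=> t _; rewrite lee_fin.
- exact/measurable_EFinP.
- exact: exprn_ge0.
Qed.

End tuple_scaling.

(** * Diagonalisation of self-adjoint matrices *)

Local Open Scope sesquilinear_scope.

Section diagonalised.
Variables (C : numClosedFieldType) (n : nat) (P : 'M[C]_n).
Hypothesis unitP : P \is unitarymx.

Let PPt : P *m P^t* = 1%:M. Proof. exact/unitarymxP. Qed.
Let PtP : P^t* *m P = 1%:M. Proof. exact: mulmx1C. Qed.

Definition dconj (f : 'I_n -> C) : 'M[C]_n := P^t* *m diag_mx (\row_i f i) *m P.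

Lemma dconjM f g : dconj f *m dconj g = dconj (fun i => f i * g i).
Proof.
rewrite /dconj !mulmxA -(mulmxA _ P) PPt mulmx1 -(mulmxA _ (diag_mx _) (diag_mx _)).
by rewrite mulmx_diag; congr (_ *m diag_mx _ *m _); apply/rowP => i; rewrite !mxE.
Qed.

Lemma dconjB f g : dconj f - dconj g = dconj (fun i => f i - g i).
Proof.
rewrite /dconj -mulmxBl -mulmxBr -linearB; congr (_ *m diag_mx _ *m _).
by apply/rowP => i; rewrite !mxE.
Qed.

Lemma dconjZ c f : c *: dconj f = dconj (fun i => c * f i).
Proof.
rewrite /dconj scalemxAl scalemxAr -linearZ; congr (_ *m diag_mx _ *m _).
by apply/rowP => i; rewrite !mxE.
Qed.

Lemma dconj_scalar c : dconj (fun=> c) = c%:M.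
Proof.
rewrite /dconj (_ : diag_mx _ = c%:M); last first.
  by rewrite -diag_const_mx; congr diag_mx; apply/rowP => i; rewrite !mxE.
by rewrite mul_mx_scalar -scalemxAl PtP scalemx1.
Qed.

Lemma dconjX f k : dconj f ^+ k = dconj (fun i => f i ^+ k).
Proof.
elim: k => [|k IH]; first exact/esym/(dconj_scalar 1).
by rewrite exprS IH [LHS]dconjM; congr dconj; apply/funext => i; rewrite exprS.
Qed.

Lemma det_dconj f : \det (dconj f) = \prod_i f i.
Proof.
rewrite /dconj !det_mulmx mulrAC -det_mulmx PtP det1 mul1r det_diag.
by apply: eq_bigr => i _; rewrite mxE.
Qed.

Lemma tr_dconj f : \tr (dconj f) = \sum_i f i.
Proof.
rewrite /dconj mxtrace_mulC mulmxA PPt mul1mx mxtrace_diag.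
by apply: eq_bigr => i _; rewrite mxE.
Qed.

Lemma eigenvalue_dconj f a : eigenvalue (dconj f) a = [exists i, f i == a].
Proof.
rewrite eigenvalue_root_char; transitivity (\det (dconj f - a%:M) == 0).
  rewrite /eigenvalue -eigenvalue_root_char /eigenvalue /eigenspace kermx_eq0.
  by rewrite row_free_unit unitmxE unitfE negbK.
rewrite -dconj_scalar dconjB det_dconj; apply/idP/existsP => [|[i /eqP fi]].
  by move=> /prodf_eq0[i _]; rewrite subr_eq0 => fi; exists i.
by apply/prodf_eq0; exists i => //; rewrite fi subrr.
Qed.

Lemma form_dconj f (v : 'rV[C]_n) :
  (v *m dconj f *m v^t*) 0 0 = \sum_i f i * `|(v *m P^t*) 0 i| ^+ 2.
Proof.
have -> : v *m dconj f *m v^t* =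
    (v *m P^t*) *m diag_mx (\row_i f i) *m (v *m P^t*)^t*.
  by rewrite trmx_mul map_mxM trmxCK /dconj !mulmxA.
rewrite mul_mx_diag mxE; apply: eq_bigr => i _.
by rewrite !mxE normCK mulrAC mulrA mulrC mulrA.
Qed.

End diagonalised.

Lemma hermitian_dconj (C : numClosedFieldType) n (A : 'M[C]_n) :
  A \is hermsymmx -> A = dconj (spectralmx A) (fun i => spectral_diag A 0 i).
Proof.
move=> /hermitian_normalmx/orthomx_spectralP.
rewrite invmx_unitary ?spectral_unitarymx// => {1}->.
by rewrite /dconj; congr (_ *m diag_mx _ *m _); apply/rowP => i; rewrite mxE.
Qed.

Section spectrum.
Variable R : realType.
Local Notation C := R[i].

(** Symmetric real matrices are diagonalised over the complex numbers too, so that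
    both cases come from a single spectral theorem. *)
Definition emb K : {rmorphism scal R K -> C} :=
  match K return {rmorphism scal R K -> C} with
  | RealK => real_complex R
  | ComplexK => idfun
  end.

Lemma emb_inF K a : emb K (inF K a) = real_complex R a.
Proof. by case: K. Qed.

Lemma emb_conj K z : emb K (conjF z) = (emb K z)^*.
Proof.
case: K z => [z|[a b]] //.
by rewrite [RHS]conjc_real.
Qed.

Definition spectrum K n (T : 'M[scal R K]_n) (l : 'I_n -> R) :=
  exists2 P : 'M[C]_n, P \is unitarymx &
  map_mx (emb K) T = dconj P (fun i => real_complex R (l i)).

Lemma spectrum_ex K n (T : 'M[scal R K]_n) : selfadjoint T -> exists l, spectrum T l.
Proof.
move=> sT; pose A := map_mx (emb K) T.
have hA : A \is hermsymmx.
  apply/is_hermitianmxP; rewrite expr0 scale1r; apply/matrixP => i j.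
  by rewrite !mxE -[in LHS]sT !mxE emb_conj.
exists (fun i => complex.Re (spectral_diag A 0 i)).
exists (spectralmx A); first exact: spectral_unitarymx.
rewrite -/A [LHS](hermitian_dconj hA); congr dconj; apply/funext => i.
have /mxOverP/(_ 0 i) := hermitian_spectral_diag_real hA.
by move=> /RRe_real.
Qed.

End spectrum.

Section spectral_facts.
Variables (R : realType) (K : scalar_kind) (n : nat).
Local Notation M := 'M[scal R K]_n.
Local Notation toC := (real_complex R).
Local Notation em := (@emb R K).
Implicit Types (T H : M) (l : 'I_n -> R).

Lemma emb_scale r T : map_mx em (inF K r *: T) = toC r *: map_mx em T.
Proof. by apply/matrixP => i j; rewrite !mxE [LHS]rmorphM emb_inF. Qed.

Lemma spectrum_bdet T l : spectrum T l -> bdet T = inF K (\prod_i (1 - l i ^+ 2)).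
Proof.
move=> [P uP TE]; apply: (fmorph_inj em); rewrite emb_inF /bdet -det_map_mx.
rewrite map_mxB map_mx1 map_mxM TE dconjM// -(dconj_scalar uP) dconjB det_dconj//.
rewrite rmorph_prod; apply: eq_bigr => i _.
by rewrite rmorphB rmorph1 expr2 rmorphM.
Qed.

Lemma spectrum_trX T l k : spectrum T l -> \tr (T ^+ k) = inF K (\sum_i l i ^+ k).
Proof.
move=> [P uP TE]; apply: (fmorph_inj em); rewrite emb_inF -trace_map_mx.
have -> : map_mx em (T ^+ k) = map_mx em T ^+ k.
  by elim: k => [|k IH]; [exact: map_mx1|rewrite !exprS -IH; exact: map_mxM].
rewrite TE dconjX// tr_dconj// rmorph_sum; apply: eq_bigr => i _.
by rewrite rmorphXn.
Qed.

Lemma spectrum_scale T l r : spectrum T l -> spectrum (inF K r *: T) (fun i => r * l i).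
Proof.
move=> [P uP TE]; exists P; first exact: uP.
rewrite emb_scale TE dconjZ.
by congr dconj; apply/funext => i; rewrite -rmorphM.
Qed.

Lemma spectrum_ball T l : selfadjoint T -> spectrum T l ->
  op_ball T <-> (forall i, `|l i| <= 1).
Proof.
move=> sT [P uP TE].
have sigE s : singular_value T s <-> 0 <= s /\ exists i, s = `|l i|.
  rewrite /singular_value/= -(eigenvalue_map em) map_mxM.
  have -> : adjmx T = T by [].
  rewrite TE dconjM// eigenvalue_dconj// rmorphXn emb_inF.
  split=> -[s0]; last first.
    move=> [i sE]; split=> //; apply/existsP; exists i.
    by rewrite -rmorphM -rmorphXn sE real_normK ?num_real// expr2.
  move=> /existsP[i /eqP]; rewrite -rmorphM -rmorphXn => /complexI lE; split=> //.
  by exists i; rewrite -[s]ger0_norm// -sqrtr_sqr -lE -expr2 sqrtr_sqr.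
split=> [[_ sle] i|l1].
  apply: le_trans sle; apply: ub_le_sup; last by apply/sigE; split=> //; exists i.
  exists (\sum_j `|l j|) => _ /sigE[_ [j ->]].
  by rewrite (bigD1 j)//= lerDl sumr_ge0.
split=> //; rewrite /s_max.
have [->|/set0P[s0 s0P]] := eqVneq (singular_value T) set0; first by rewrite sup0 ler01.
by apply: ge_sup; [exists s0|move=> s /sigE[_ [i ->]]].
Qed.

(** The unit ball is cut out by the conditions |hform T v| <= vnormsq v, which are
    affine in T; convexity and closedness of the slices of the ball are read from
    them. *)
Definition hform T (v : 'rV[R[i]]_n) : R :=
  complex.Re ((v *m map_mx em T *m v^t*) 0 0).
Definition vnormsq (v : 'rV[R[i]]_n) : R := complex.Re ((v *m v^t*) 0 0).

Lemma hform_lin T H t v : hform (T + inF K t *: H) v = hform T v + t * hform H v.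
Proof.
rewrite /hform map_mxD emb_scale mulmxDr mulmxDl -scalemxAr -scalemxAl.
rewrite [in LHS]mxE [X in complex.Re (_ + X)]mxE.
by case: (_ 0 0) => a b; case: (_ 0 0) => a' b' /=; rewrite mul0r subr0.
Qed.

Lemma spectrum_form T l : spectrum T l ->
  exists2 P : 'M[R[i]]_n, P \is unitarymx &
  (forall v, hform T v = \sum_i l i * complex.Re (`|(v *m P^t*) 0 i| ^+ 2)) /\
  (forall v, vnormsq v = \sum_i complex.Re (`|(v *m P^t*) 0 i| ^+ 2)).
Proof.
move=> [P uP TE]; exists P => //; split=> v.
  rewrite /hform TE form_dconj// raddf_sum; apply: eq_bigr => i _.
  by case: (_ ^+ 2) => a b /=; rewrite mul0r subr0.
rewrite /vnormsq -[v in v *m _]mulmx1 -(dconj_scalar uP 1) form_dconj// raddf_sum.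
by apply: eq_bigr => i _; rewrite mul1r.
Qed.

Lemma Re_normsq_ge0 (z : R[i]) : 0 <= complex.Re (`|z| ^+ 2).
Proof.
have : 0 <= `|z| ^+ 2 by rewrite exprn_ge0.
by case: (`|z| ^+ 2) => a b; rewrite lecE /= => /andP[].
Qed.

(** Both forms are weighted sums of the squared coordinates of v in an eigenbasis;
    the converse takes for v the eigenvectors. *)
Lemma ball_formP T : selfadjoint T ->
  op_ball T <-> (forall v, `|hform T v| <= vnormsq v).
Proof.
move=> sT; have [l lT] := spectrum_ex sT.
have [P uP [TE vE]] := spectrum_form lT.
split=> [/(spectrum_ball sT lT) l1 v|Tv].
  rewrite TE vE; apply: le_trans (ler_norm_sum _ _ _) _.
  by apply: ler_sum => i _; rewrite normrM (ger0_norm (Re_normsq_ge0 _)) ler_piMl ?Re_normsq_ge0.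
apply/(spectrum_ball sT lT) => i.
have := Tv (row i P); rewrite TE vE.
have E j : (row i P *m P^t*) 0 j = (i == j)%:R.
  have /unitarymxP/matrixP/(_ i j) := uP; rewrite [RHS]mxE => <-.
  by rewrite -row_mul mxE.
have E2 j : complex.Re (`|(row i P *m P^t*) 0 j| ^+ 2) = (i == j)%:R.
  by rewrite E; case: (i == j); rewrite ?normr1 ?normr0 ?expr1n ?expr0n.
have pick (f : 'I_n -> R) : \sum_j f j * complex.Re (`|(row i P *m P^t*) 0 j| ^+ 2) = f i.
  rewrite (bigD1 i)// big1 => [|j /andP[_ ji]]; last by rewrite E2 eq_sym (negPf ji) mulr0.
  by rewrite E2 eqxx mulr1 [LHS]addr0.
rewrite pick; have := pick (fun=> 1); under eq_bigr do rewrite mul1r.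
by move=> ->.
Qed.

End spectral_facts.

(** * Geometry of the unit ball of the operator norm *)

Section ball_geometry.
Variables (R : realType) (K : scalar_kind) (n : nat).
Local Notation M := 'M[scal R K]_n.
Local Notation ball := (@op_ball R K n).
Implicit Types (T H : M) (l : 'I_n -> R).

Definition sqtr T : R := reF (\tr (T *m T)).

Lemma spectrum_sqtr T l : spectrum T l -> sqtr T = \sum_i l i ^+ 2.
Proof. by move=> lT; rewrite /sqtr -[T *m T]/(T ^+ 2) (spectrum_trX _ lT) reF_inF. Qed.

Lemma spectrum_reF_bdet T l : spectrum T l ->
  reF (bdet T) = \prod_i (1 - l i ^+ 2) /\ imF (bdet T) = 0.
Proof. by move=> /spectrum_bdet ->; rewrite reF_inF imF_inF. Qed.

Lemma ball_spectrum T : ball T ->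
  exists2 l, spectrum T l & forall i, 0 <= l i ^+ 2 <= 1.
Proof.
move=> bT; have [sT _] := bT; have [l lT] := spectrum_ex sT.
exists l => // i; have /(_ i) l1 := (spectrum_ball sT lT).1 bT.
by rewrite sqr_ge0 -real_normK ?num_real// expr_le1.
Qed.

(** The third bound is the product over the eigenvalues of the inequality 
    (1 - x) e^x <= 1 for x = l^2. *)
Lemma ball_bdet T : ball T ->
  [/\ imF (bdet T) = 0, 0 <= reF (bdet T) <= 1,
      reF (bdet T) * expR (sqtr T) <= 1 & 0 <= sqtr T <= n%:R].
Proof.
move=> /ball_spectrum[l lT l1]; have [-> ->] := spectrum_reF_bdet lT.
rewrite (spectrum_sqtr lT); split=> //.
- apply/andP; split; first by apply: prodr_ge0 => i _; rewrite subr_ge0; case/andP: (l1 i).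
  apply: prodr_ile1 => i _; rewrite subr_ge0 lerBlDr lerDl.
  by rewrite andbC.
- rewrite expR_sum -big_split /=; apply: prodr_ile1 => i _.
  have [l0 l1i] := andP (l1 i); rewrite mulr_ge0 ?subr_ge0 ?expR_ge0//=.
  by rewrite -ler_pdivlMr ?expR_gt0// div1r -expRN expR_ge1Dx.
- rewrite sumr_ge0 => [|i _]; last by case/andP: (l1 i).
  rewrite -[n in leRHS]card_ord -sumr_const; apply: ler_sum => i _.
  by case/andP: (l1 i).
Qed.

(** Weierstrass' product inequality. *)
Lemma prod_1sub_ge (I : finType) (a : I -> R) : (forall i, 0 <= a i <= 1) ->
  1 - \sum_i a i <= \prod_i (1 - a i).
Proof.
move=> a1; suff : 0 <= \prod_i (1 - a i) <= 1 /\ 1 - \sum_i a i <= \prod_i (1 - a i).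
  by case.
elim/big_ind2: _ => [|x1 x2 y1 y2 [/andP[? ?] ?] [/andP[? ?] ?]|i _].
- by rewrite ler01 lexx subr0.
- by split; [apply/andP; split|]; nra.
- by have /andP[? ?] := a1 i; split; [apply/andP; split|]; lra.
Qed.

Lemma small_ball T : selfadjoint T -> sqtr T <= 1 ->
  ball T /\ 1 - sqtr T <= reF (bdet T).
Proof.
move=> sT; have [l lT] := spectrum_ex sT; rewrite (spectrum_sqtr lT) => l1.
have li i : 0 <= l i ^+ 2 <= 1.
  rewrite sqr_ge0 (le_trans _ l1)//= (bigD1 i)//= lerDl.
  by apply: sumr_ge0 => j _; exact: sqr_ge0.
split.
  apply/(spectrum_ball sT lT) => i; have /andP[_] := li i.
  by rewrite -[l i ^+ 2]real_normK ?num_real// expr_le1.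
by rewrite (spectrum_reF_bdet lT).1; exact: prod_1sub_ge.
Qed.

(** The eigenvalues of the shrunken matrix have modulus less than 1, so [bdet] is
    a product of positive factors. *)
Lemma ball_scale T r : ball T -> 0 <= r < 1 ->
  ball (inF K r *: T) /\ reF (bdet (inF K r *: T)) != 0.
Proof.
move=> bT /andP[r0 r1]; have [sT _] := bT; have [l lT l1] := ball_spectrum bT.
have sr : selfadjoint (inF K r *: T).
  by apply/matrixP => i j; rewrite -[in RHS]sT !mxE conjFM inF_conj.
have lr := spectrum_scale r lT.
have small i : (r * l i) ^+ 2 < 1.
  have /andP[l0 l1i] := l1 i; rewrite exprMn; nra.
split; last first.
  rewrite (spectrum_reF_bdet lr).1; apply/prodf_neq0 => i _.
  by rewrite subr_eq0 gt_eqF.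
apply/(spectrum_ball sr lr) => i; have := small i.
by rewrite -[_ ^+ 2]real_normK ?num_real// expr_lt1// => /ltW.
Qed.

Lemma vnormsq_ge0 (v : 'rV[R[i]]_n) : 0 <= vnormsq v.
Proof.
have b0 : ball 0 by apply: (small_ball _ _).1; rewrite /sqtr ?mulmx0 ?linear0 ?reF0//;
  apply/matrixP => i j; rewrite !mxE; apply: scal_eqP; rewrite ?reF_conj ?imF_conj ?imF0 ?oppr0.
by apply: le_trans (normr_ge0 _) ((ball_formP b0.1).1 b0 v).
Qed.

Lemma hform_bounded H : selfadjoint H ->
  exists2 C, 0 <= C & forall v, `|hform H v| <= C * vnormsq v.
Proof.
move=> /spectrum_ex[l lH]; have [P _ [HE vE]] := spectrum_form lH.
exists (\sum_i `|l i|); first exact: sumr_ge0.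
move=> v; rewrite HE vE mulr_sumr; apply: le_trans (ler_norm_sum _ _ _) _.
apply: ler_sum => i _; rewrite normrM (ger0_norm (Re_normsq_ge0 _)).
rewrite ler_wpM2r ?Re_normsq_ge0// (bigD1 i)//= lerDl; exact: sumr_ge0.
Qed.

Lemma selfadjoint_line T H t : selfadjoint T -> selfadjoint H ->
  selfadjoint (T + inF K t *: H).
Proof.
move=> sT sH; apply/matrixP => i j.
by rewrite -[in RHS]sT -[in RHS]sH !mxE conjFD conjFM inF_conj.
Qed.

(** Where [bdet] does not vanish, all the eigenvalues are bounded away from 1 in
    modulus, which leaves room for a small multiple of the bounded form of [H]. *)
Lemma ball_interior T H : ball T -> selfadjoint H -> reF (bdet T) != 0 ->
  exists2 e, 0 < e & forall t, `|t| <= e -> ball (T + inF K t *: H).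
Proof.
move=> bT sH dT; have [sT _] := bT; have [l lT l1] := ball_spectrum bT.
have [C C0 HC] := hform_bounded sH; have [P _ [TE vE]] := spectrum_form lT.
have ll i : `|l i| < 1.
  rewrite -(@expr_lt1 _ 2)// real_normK ?num_real// lt_neqAle; case/andP: (l1 i) => _ ->.
  rewrite andbT; apply: contra dT => /eqP li; rewrite (spectrum_reF_bdet lT).1.
  by apply/prodf_eq0; exists i => //; rewrite li subrr.
(* The default value 1 of the minimum serves the empty case n = 0. *)
pose eta := \big[Order.min/1]_i (1 - `|l i|).
have eta0 : 0 < eta.
  by rewrite /eta; elim/big_ind: _ => [|x y x0 y0|i _]; rewrite ?ltr01 ?lt_min ?x0 ?subr_gt0.
have etaT v : `|hform T v| <= (1 - eta) * vnormsq v.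
  rewrite TE vE mulr_sumr; apply: le_trans (ler_norm_sum _ _ _) _.
  apply: ler_sum => i _; rewrite normrM (ger0_norm (Re_normsq_ge0 _)).
  by rewrite ler_wpM2r ?Re_normsq_ge0// lerBrDr -lerBrDl; exact: bigmin_le_cond.
have C1 : 0 < C + 1 by rewrite ltr_wpDl.
exists (eta / (C + 1)); first exact: divr_gt0.
move=> t; rewrite (ler_pdivlMr _ _ C1) => tC.
apply/(ball_formP (selfadjoint_line t sT sH)) => v; rewrite hform_lin.
apply: le_trans (ler_normD _ _) _; rewrite normrM.
have := etaT v; have := HC v; have := vnormsq_ge0 v; have := normr_ge0 t.
move: (`|t|) (`|hform H v|) (`|hform T v|) (vnormsq v) tC => a b c d *; nra.
Qed.

(** A slice of the ball is closed, convex and bounded, hence a segment; at its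
    ends [bdet] vanishes, since otherwise [ball_interior] would extend it. *)
Lemma ball_slice T H (C : R) : selfadjoint T -> selfadjoint H ->
  (forall t, ball (T + inF K t *: H) -> `|t| <= C) ->
  [set t | ball (T + inF K t *: H)] = set0 \/
  exists a b, [/\ a <= b, [set t | ball (T + inF K t *: H)] = `[a, b]%classic,
    reF (bdet (T + inF K a *: H)) = 0 & reF (bdet (T + inF K b *: H)) = 0].
Proof.
move=> sT sH SC; set S := [set t | _].
have sTH t := selfadjoint_line t sT sH.
have [->|/set0P S0] := eqVneq S set0; [by left|right].
(* Closedness of the slice, in the form needed for its supremum and infimum. *)
have Sadh b : (forall e, 0 < e -> exists2 t, S t & `|t - b| <= e) -> S b.
  move=> adh; apply/(ball_formP (sTH b)) => v; rewrite hform_lin.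
  apply/ler_addgt0Pr => e e0; pose c := `|hform H v| + 1.
  have c0 : 0 < c by rewrite ltr_wpDl.
  have [t St tb] := adh (e / c) (divr_gt0 e0 c0).
  have := (ball_formP (sTH t)).1 St v; rewrite hform_lin => tv.
  have -> : hform T v + b * hform H v =
      (hform T v + t * hform H v) - (t - b) * hform H v.
    by rewrite mulrBl opprB addrA addrAC addrK.
  apply: le_trans (ler_normB _ _) _; rewrite lerD// normrM.
  rewrite ler_pdivlMr// in tb; apply: le_trans tb.
  by rewrite ler_wpM2l// lerDl.
have Sitv : is_interval S.
  move=> x y Sx Sy t /andP[xt ty].
  apply/(ball_formP (sTH t)) => v; rewrite hform_lin.
  have := (ball_formP (sTH x)).1 Sx v; have := (ball_formP (sTH y)).1 Sy v.
  rewrite !hform_lin !ler_norml; move: (hform T v) (hform H v) (vnormsq v) => p q r.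
  move=> /andP[? ?] /andP[? ?]; apply/andP; have [q0|q0] := leP 0 q; split; nra.
have ubS : has_ubound S by exists C => t /SC; rewrite ler_norml => /andP[].
have lbS : has_lbound S by exists (- C) => t /SC; rewrite ler_norml => /andP[].
have Ssup : S (sup S).
  apply: Sadh => e e0; have [t St te] := sup_adherent e0 (conj S0 ubS).
  exists t => //; have tS : t <= sup S := ub_le_sup ubS St.
  by move: (sup S) te tS => u *; rewrite ler_norml; apply/andP; split; lra.
have Sinf : S (inf S).
  apply: Sadh => e e0; have [t St te] := inf_adherent e0 (conj S0 lbS).
  exists t => //; have tS : inf S <= t := ge_inf lbS St.
  by move: (inf S) te tS => u *; rewrite ler_norml; apply/andP; split; lra.
have shift s t : T + inF K (s + t) *: H = T + inF K s *: H + inF K t *: H.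
  by rewrite rmorphD scalerDl addrA.
exists (inf S), (sup S); split.
- exact: ge_inf.
- apply/seteqP; split=> t /=; rewrite in_itv/=.
    by move=> St; rewrite ge_inf//= ub_le_sup.
  by move=> ?; exact: (Sitv (inf S) (sup S)).
- apply/eqP/negPn/negP => /(ball_interior Sinf sH)[e e0] /(_ (- e)).
  rewrite normrN ger0_norm ?lexx ?ltW// -shift => /(_ isT) /(ge_inf lbS).
  by rewrite lerDl oppr_ge0 leNgt e0.
- apply/eqP/negPn/negP => /(ball_interior Ssup sH)[e e0] /(_ e).
  rewrite ger0_norm ?lexx ?ltW// -shift => /(_ isT) /(ub_le_sup ubS).
  by rewrite gerDl leNgt e0.
Qed.

(** An eigenvalue of modulus larger than 1 would make the power sums unbounded.
    These countably many polynomial inequalities make the ball measurable. *)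
Lemma ball_trX T : selfadjoint T ->
  ball T <-> (forall m, reF (\tr (T ^+ (2 * m))) <= n%:R).
Proof.
move=> sT; have [l lT] := spectrum_ex sT.
have trE m : reF (\tr (T ^+ (2 * m))) = \sum_i (l i ^+ 2) ^+ m.
  by rewrite (spectrum_trX _ lT) reF_inF; apply: eq_bigr => i _; rewrite exprM.
split=> [bT m|Tm].
  have l1 := (spectrum_ball sT lT).1 bT.
  rewrite trE -[n in leRHS]card_ord -sumr_const; apply: ler_sum => i _.
  by rewrite exprn_ile1 ?sqr_ge0// -real_normK ?num_real// expr_le1.
apply/(spectrum_ball sT lT) => i; rewrite leNgt; apply/negP => li.
have h0 : 0 < l i ^+ 2 - 1.
  by rewrite subr_gt0 -real_normK ?num_real// expr_gt1.
pose m := Num.truncn (n%:R / (l i ^+ 2 - 1)).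
have : n%:R / (l i ^+ 2 - 1) < m.+1%:R by apply: real_truncnS_gt; exact: num_real.
rewrite ltr_pdivrMr// ltNge => /negP; apply.
have := Tm m.+1; rewrite trE; apply: le_trans.
apply: le_trans (_ : (l i ^+ 2) ^+ m.+1 <= _); last first.
  rewrite (bigD1 i)//= lerDl; apply: sumr_ge0 => j _.
  by rewrite exprn_ge0// sqr_ge0.
have bern k : 0 <= (l i ^+ 2) ^+ k - 1 - k%:R * (l i ^+ 2 - 1).
  elim: k => [|k IH]; first by rewrite expr0 mul0r !subrr.
  rewrite exprS -natr1; have : 0 <= k%:R :> R by [].
  move: h0 IH; move: (l i ^+ 2) => a; move: (a ^+ k) (k%:R) => b c h0 IH c0.
  have a0 : 0 <= a by lra.
  have := mulr_ge0 a0 IH; have := mulr_ge0 c0 (sqr_ge0 (a - 1)); nra.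
by have := bern m.+1; lra.
Qed.

End ball_geometry.

(** * Integration by parts on the ball *)

Section real_lines.
Variable R : realType.
Local Notation T := (measurableTypeR R).
Local Notation lam := (@lebesgue_tuple R).
Local Open Scope ereal_scope.

Lemma integral_deriv_poly (p : {poly R}) (a b : R) : (a <= b)%R ->
  \int[lebesgue_measure]_(t in `[a, b]) (p^`().[t])%:E = (p.[b] - p.[a])%:E.
Proof.
rewrite le_eqVlt => /predU1P[->|ab].
  by rewrite set_itv1 integral_set1 subrr.
rewrite (@continuous_FTC2 _ _ (horner p))//.
- by apply: continuous_subspaceT => x; exact: continuous_horner.
- split.
  + by move=> x _; exact: derivable_horner.
  + exact/cvg_at_right_filter/continuous_horner.
  + exact/cvg_at_left_filter/continuous_horner.
- by move=> x _; rewrite -derivE.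
Qed.

(** The positive and the negative parts of [g] have the same integral on each
    line, hence the same integral. *)
Lemma integral_lines_eq0 d (k : 'I_d) (g : d.-tuple T -> \bar R) :
  (lam d).-integrable setT g ->
  (forall x, lebesgue_measure.-integrable setT (fun t : T => g (tset k t x)) /\
             \int[lebesgue_measure]_t g (tset k t x) = 0) ->
  \int[lam d]_x g x = 0.
Proof.
move=> ig glines; have mg := measurable_int _ ig.
have pn : \int[lam d]_x g^\+ x = \int[lam d]_x g^\- x.
  apply: (@ge0_eq_integral_lines _ _ k (g^\+) (g^\-)).
  - exact: measurable_funepos.
  - by move=> x; exact: funepos_ge0.
  - exact: measurable_funeneg.
  - by move=> x; exact: funeneg_ge0.
  move=> x; have [ix] := glines x.
  rewrite [in X in X = _ -> _]integralE => /eqP.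
  rewrite sube_eq; last 2 first.
  - exact/integrable_fin_num/integrable_funepos.
  - by rewrite fin_num_adde_defl//; exact/integrable_fin_num/integrable_funeneg.
  rewrite (funepos_comp g (fun t => tset k t x)) (funeneg_comp g (fun t => tset k t x)).
  by rewrite add0e => /eqP.
rewrite integralE pn subee//.
exact/integrable_fin_num/integrable_funeneg.
Qed.

End real_lines.

Section polyfun_analysis.
Variables (R : realType) (K : scalar_kind) (n : nat).
Local Notation T := (measurableTypeR R).
Local Notation M := 'M[scal R K]_n.
Local Notation X := ((dimE K n).-tuple T).

(** Integrals are real-valued; indexing the real and the imaginary part by a
    boolean lets a single argument treat both. *)
Definition part (b : bool) (z : scal R K) : R := if b then reF z else imF z.

Lemma partD b z w : part b (z + w) = part b z + part b w.
Proof. by case: b; [exact: reFD|exact: imFD]. Qed.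

Lemma part0 b : part b 0 = 0.
Proof. by case: b; [exact: reF0|exact: imF0]. Qed.

Lemma part_inFM b a z : part b (inF K a * z) = a * part b z.
Proof. by case: b; [exact: reF_inFM|exact: imF_inFM]. Qed.

Lemma part_sum b I (r : seq I) (P : pred I) (F : I -> scal R K) :
  part b (\sum_(i <- r | P i) F i) = \sum_(i <- r | P i) part b (F i).
Proof. exact: (big_morph _ (partD b) (part0 b)). Qed.

Lemma partMn b z m : part b (z *+ m) = part b z *+ m.
Proof. by elim: m => [|m IH]; rewrite ?part0// !mulrS partD IH. Qed.

Lemma part_horner b (p : {poly scal R K}) (q : {poly R}) :
  (forall i, q`_i = part b p`_i) -> forall t, q.[t] = part b p.[inF K t].
Proof.
move=> qp t; have qs := leq_maxl (size q) (size p); have ps := leq_maxr (size q) (size p).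
rewrite (horner_coef_wide _ qs) (horner_coef_wide _ ps) part_sum.
by apply: eq_bigr => i _; rewrite qp mulrC -part_inFM rmorphXn mulrC.
Qed.

Lemma part_poly b (p : {poly scal R K}) : exists q : {poly R}, forall t,
  q.[t] = part b p.[inF K t] /\ q^`().[t] = part b p^`().[inF K t].
Proof.
pose q := \poly_(i < size p) part b p`_i.
have qE i : q`_i = part b p`_i.
  by rewrite coef_poly; case: ltnP => // pi; rewrite nth_default ?part0.
exists q => t; split; apply: part_horner => // i.
by rewrite !coef_deriv qE partMn.
Qed.

Lemma polyfun_measurable (f : M -> scal R K) Df : polyfun f Df ->
  forall b, measurable_fun setT (fun x : X => part b (f (coordmx x))).
Proof.
elim=> {f Df} [c|i j|f g Df Dg _ IHf _ IHg|f g Df Dg _ IHf _ IHg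
    |f g Df Dg _ IHf fg _] b.
- exact: measurable_cst.
- rewrite (_ : (fun x => _) = (fun x : X =>
      \sum_k (tnth x k : R) * part b (basis k i j))); last first.
    apply/funext => x; rewrite coordmx_basis summxE part_sum; apply: eq_bigr => k _.
    by rewrite mxE part_inFM.
  apply: measurable_sum => k; apply: measurable_funM; last exact: measurable_cst.
  exact: measurable_tnth.
- rewrite (_ : (fun x => _) = (fun x : X =>
    part b (f (coordmx x)) + part b (g (coordmx x)))); last first.
    by apply/funext => x; rewrite partD.
  exact: (measurable_funD (IHf b) (IHg b)).
- case: b => /=.
    rewrite (_ : (fun x => _) = (fun x : X => part true (f (coordmx x)) * part true (g (coordmx x))
      - part false (f (coordmx x)) * part false (g (coordmx x)))); last first.
      by apply/funext => x; rewrite reF_mul.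
    exact: (measurable_funB (measurable_funM (IHf true) (IHg true)) (measurable_funM (IHf false) (IHg false))).
  rewrite (_ : (fun x => _) = (fun x : X => part true (f (coordmx x)) * part false (g (coordmx x))
      + part false (f (coordmx x)) * part true (g (coordmx x)))); last first.
    by apply/funext => x; rewrite imF_mul.
  exact: (measurable_funD (measurable_funM (IHf true) (IHg false)) (measurable_funM (IHf false) (IHg true))).
- by move: (IHf b); congr (measurable_fun _ _); apply/funext => x; rewrite fg.
Qed.

Lemma polyfun_bounded (f : M -> scal R K) Df : polyfun f Df -> forall C,
  exists N : R, forall A : M, (forall i j b, `|part b (A i j)| <= C) ->
    forall b, `|part b (f A)| <= N.
Proof.
elim=> {f Df} [c|i j|f g Df Dg _ IHf _ IHg|f g Df Dg _ IHf _ IHg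
    |f g Df Dg _ IHf fg _] C.
- exists (`|part true c| + `|part false c|) => A _ b.
  by case: b; rewrite ?lerDl ?lerDr normr_ge0.
- by exists C => A hA b; exact: hA.
- have [N fB] := IHf C; have [N' gB] := IHg C; exists (N + N') => A hA b.
  by rewrite partD (le_trans (ler_normD _ _))// lerD ?fB ?gB.
- have [N fB] := IHf C; have [N' gB] := IHg C; exists (N * N' + N * N') => A hA b.
  have pp b1 b2 : `|part b1 (f A) * part b2 (g A)| <= N * N'.
    by rewrite normrM ler_pM ?fB ?gB.
  case: b => /=.
    by rewrite reF_mul (le_trans (ler_normB _ _))// lerD// (pp true true, pp false false).
  by rewrite imF_mul (le_trans (ler_normD _ _))// lerD// (pp true false, pp false true).
- by have [N fB] := IHf C; exists N => A hA b; rewrite -fg fB.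
Qed.

Definition ballset : set X := @coordmx R K n @^-1` @op_ball R K n.

Lemma ballset_measurable : measurable ballset.
Proof.
have -> : ballset = \bigcap_m [set x : X |
    part true (\tr (coordmx x ^+ (2 * m))) <= n%:R].
  apply/seteqP; split=> x; rewrite /ballset /preimage /=.
    by move=> /(ball_trX (coordmx_selfadjoint x)) h m _; exact: h.
  by move=> h; apply/(ball_trX (coordmx_selfadjoint x)) => m; exact: h.
apply: bigcap_measurable => // m _.
have [D DP] : exists D, polymx (fun A : M => A ^+ (2 * m)) D.
  elim: (2 * m)%N => [|k [D IH]]; first by eexists; exact: (polymx_cst _ 1%:M).
  have [D' D'P] : exists D', polymx (fun A : M => A *m A ^+ k) D'.
    by eexists; exact: (polymxM (polymx_id _ _) IH).
  exists D'; move: D'P; congr polymx; apply/funext => A; rewrite exprS//.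
have mt := polyfun_measurable (polyfun_trace DP) true.
rewrite (_ : [set x | _] = [set: X] `&`
    (fun x : X => part true (\tr (coordmx x ^+ (2 * m)))) @^-1` `]-oo, n%:R]).
  by apply: mt => //; exact: measurable_itv.
by apply/seteqP; split=> [x|x [_]]; rewrite /preimage /= in_itv.
Qed.

Lemma ballset_entries (x : X) : ballset x ->
  (forall k, `|tnth x k : R| <= n%:R) /\
  (forall i j b, `|part b (coordmx x i j)| <= n%:R).
Proof.
move=> bx; have [_ _ _ /andP[_ sn]] := ball_bdet bx.
have small (r : R) : r ^+ 2 <= n%:R -> `|r| <= n%:R.
  move=> rn; rewrite -(@ler_pXn2r _ 2)// ?nnegrE// real_normK ?num_real//.
  by apply: le_trans rn _; rewrite -natrX ler_nat; case: (n) => // m; rewrite -[leqLHS]expn1 leq_pexp2l.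
have xs : sqtr (coordmx x) = \sum_k (tnth x k : R) ^+ 2.
  by rewrite /sqtr trace_coordmx reF_inF; apply: eq_bigr => k _; rewrite expr2.
split=> [k|i j b]; apply: small; apply: le_trans sn.
  rewrite xs (bigD1 k)//= lerDl; apply: sumr_ge0 => j _; exact: sqr_ge0.
have -> : sqtr (coordmx x) = \sum_i \sum_j
    (reF (coordmx x i j) ^+ 2 + imF (coordmx x i j) ^+ 2).
  rewrite -hs_norm_sqr /hs_norm coordmx_selfadjoint sqr_sqrtr//.
  by rewrite -/(sqtr _) xs sumr_ge0// => k _; exact: sqr_ge0.
rewrite (bigD1 i)//= (bigD1 j)//= -!addrA.
apply: le_trans (_ : reF (coordmx x i j) ^+ 2 + imF (coordmx x i j) ^+ 2 <= _).
  by case: b; rewrite ?lerDl ?lerDr sqr_ge0.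
rewrite addrA lerDl addr_ge0//; apply: sumr_ge0 => i' _; last apply: sumr_ge0 => j' _.
  by rewrite addr_ge0 ?sqr_ge0.
by rewrite addr_ge0 ?sqr_ge0.
Qed.

End polyfun_analysis.

Section ball_ibp.
Variables (R : realType) (K : scalar_kind) (n : nat).
Local Notation T := (measurableTypeR R).
Local Notation M := 'M[scal R K]_n.
Local Notation lam := (@lebesgue_tuple R (dimE K n)).
Local Notation D := (@ballset R K n).
Implicit Types (f : M -> scal R K).

Lemma ballset_lty : (lam D < +oo)%E.
Proof.
pose phi (t : T) : R := \1_(`[- (n%:R : R), n%:R]%classic : set R) t.
have mphi : measurable_fun setT phi by exact: measurable_indic.
have [a phiE] : exists a, (\int[lebesgue_measure]_t (phi t)%:E = a%:E)%E.
  rewrite integral_indic// setIT; have := @lebesgue_measure_itv R `[- n%:R, n%:R]; rewrite /=.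
  by case: ifP => _ E; [exists (n%:R - - n%:R)|exists 0]; exact: E.
have mD : measurable D := @ballset_measurable R K n.
rewrite -[D]setIT -integral_indic//.
apply: (@le_lt_trans _ _ (\int[lam]_x (\prod_(k < dimE K n) phi (tnth x k))%:E)%E).
  apply: ge0_le_integral => //.
  - exact/measurable_EFinP/measurable_indic.
  - apply/measurable_EFinP/measurable_prod => k _.
    by apply: measurableT_comp => //; exact: measurable_tnth.
  move=> x _; rewrite lee_fin indicE; case: (boolP (x \in D)) => [|_]; last first.
    by rewrite prodr_ge0.
  rewrite inE => /ballset_entries[xn _]; rewrite big1// => k _.
  by rewrite /phi indicE mem_set//= in_itv/= -ler_norml.
by rewrite (integral_tuple_prod _ mphi _ phiE)// ltry.
Qed.

Lemma polyfun_integrable f Df b : polyfun f Df ->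
  lam.-integrable D (fun x => (part b (f (coordmx x)))%:E).
Proof.
move=> fP; have [N fN] := polyfun_bounded fP n%:R.
apply: measurable_bounded_integrable.
- exact: ballset_measurable.
- exact: ballset_lty.
- apply: measurable_funTS; exact: (polyfun_measurable fP b).
exists N; split; first exact: num_real.
move=> y Ny x /ballset_entries[_ xn]; apply: le_trans (ltW Ny).
exact: fN.
Qed.

(** On a line parallel to [basis k], the integrand is the derivative of a
    univariate polynomial, integrated over a segment at the ends of which [f]
    vanishes by [ball_slice]. *)
Lemma ball_ibp f Df k b : polyfun f Df ->
  (forall A, op_ball A -> reF (bdet A) = 0 -> f A = 0) ->
  (\int[lam]_(x in D) (part b (Df (coordmx x) (basis k)))%:E = 0)%E.
Proof.
move=> fP f0; have [D2 DfP] := polyfun_derivative (basis k) fP.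
have mD : measurable D := @ballset_measurable R K n.
have iD := polyfun_integrable b DfP.
rewrite integral_mkcond; apply: (integral_lines_eq0 (k := k)).
  exact/(integrable_mkcond _ mD).
move=> x; pose A := coordmx (tset k (0 : T) x); pose H : M := basis k.
have lineE t : coordmx (tset k t x) = A + inF K t *: H.
  apply: coordmx_lin => j; rewrite !tnth_mktuple eq_sym.
  by case: eqP; rewrite ?add0r ?mulr1 ?mulr0 ?addr0.
pose S := [set t | op_ball (A + inF K t *: H)].
have [p pE] := polyfun_line fP A H; have [q qE] := part_poly b p.
have DS t : D (tset k t x) = S t by rewrite /S /mkset -lineE.
have gE : (fun t : T => ((fun x => (part b (Df (coordmx x) (basis k)))%:E) \_ D) (tset k t x))
    = (fun t => (q^`().[t])%:E) \_ S.
  apply/funext => t; rewrite !patchE.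
  have -> : (tset k t x \in D) = (t \in S).
    by apply/idP/idP => /set_mem h; apply/mem_set; move: h; rewrite DS.
  case: ifP => // _; congr (_%:E).
  by have [_ ->] := qE t; have [_ ->] := pE (inF K t); rewrite lineE.
have sA : selfadjoint A by exact: coordmx_selfadjoint.
have sH : selfadjoint H by exact: coordmx_selfadjoint.
have Sn t : S t -> `|t| <= n%:R.
  rewrite -DS => /(@ballset_entries R K n)[/(_ k) + _].
  by rewrite tnth_mktuple eqxx.
rewrite gE; have [S0|[a [c [ac SE ba bc]]]] := ball_slice sA sH Sn.
  rewrite (S0 : S = set0) patch_set0; split; first exact: integrable0.
  by rewrite integral0.
have St t : S t -> reF (bdet (A + inF K t *: H)) = 0 -> q.[t] = 0.
  move=> tS dt; have [-> _] := qE t; have [-> _] := pE (inF K t).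
  by rewrite f0// part0.
have Sa : S a by rewrite (SE : S = _) /= in_itv/= lexx ac.
have Sc : S c by rewrite (SE : S = _) /= in_itv/= lexx ac.
rewrite (SE : S = _); split.
  have mI : measurable (`[a, c]%classic : set T) by exact: measurable_itv.
  apply/(integrable_mkcond _ mI).
  apply: continuous_compact_integrable; first exact: segment_compact.
  by apply: continuous_subspaceT => t; exact: continuous_horner.
by rewrite -integral_mkcond integral_deriv_poly// !St ?subrr.
Qed.

End ball_ibp.

Section ball_integral.
Variables (R : realType) (K : scalar_kind) (n : nat).
Local Notation T := (measurableTypeR R).
Local Notation F := (scal R K).
Local Notation M := 'M[F]_n.
Local Notation lam := (@lebesgue_tuple R (dimE K n)).
Local Notation D := (@ballset R K n).
Implicit Types (f g : M -> F) (A : M).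

Definition bint (h : M -> R) : R := (\int[lam]_(x in D) h (coordmx x))%R.

Definition cint f : F :=
  mkF K (bint (fun A => part true (f A))) (bint (fun A => part false (f A))).

Definition ispoly f := exists Df, polyfun f Df.

Let mD : measurable D := @ballset_measurable R K n.

Lemma ispoly_integrable f b : ispoly f ->
  lam.-integrable D (EFin \o (fun x => part b (f (coordmx x)))).
Proof. by move=> [Df fP]; exact: polyfun_integrable fP. Qed.

Lemma ispoly_cst c : ispoly (fun=> c). Proof. by eexists; exact: polyfun_cst. Qed.

Lemma ispoly_entry i j : ispoly (fun A => A i j).
Proof. by eexists; exact: polyfun_entry. Qed.

Lemma ispolyD f g : ispoly f -> ispoly g -> ispoly (fun A => f A + g A).
Proof. by move=> [? fP] [? gP]; eexists; exact: polyfun_add fP gP. Qed.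

Lemma ispolyM f g : ispoly f -> ispoly g -> ispoly (fun A => f A * g A).
Proof. by move=> [? fP] [? gP]; eexists; exact: polyfun_mul fP gP. Qed.

Lemma ispoly_bdetX s : ispoly (fun A => bdet A ^+ s).
Proof.
elim: s => [|s IH]; first exact: (ispoly_cst 1).
have [D' DP] := ispolyM (ex_intro _ _ (@polyfun_bdet F n)) IH.
by exists D'; apply: (polyfun_ext DP) => // A; rewrite exprS.
Qed.

Lemma part_cint b f : part b (cint f) = bint (fun A => part b (f A)).
Proof.
rewrite /cint; case: b; first exact: reF_mkF.
rewrite /= imF_mkF; move: f; rewrite /bint; case: K => // f.
by rewrite /= Rintegral_cst ?mul0r//; exact: ballset_measurable.
Qed.

Lemma part_inj (z w : F) : (forall b, part b z = part b w) -> z = w.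
Proof. by move=> zw; apply: scal_eqP; [exact: (zw true)|exact: (zw false)]. Qed.

Lemma cint_eq f g : (forall A, op_ball A -> f A = g A) -> cint f = cint g.
Proof.
move=> fg; apply: part_inj => b; rewrite !part_cint.
by apply: eq_Rintegral => x /set_mem xD; rewrite fg.
Qed.

Lemma cintD f g : ispoly f -> ispoly g ->
  cint (fun A => f A + g A) = cint f + cint g.
Proof.
move=> fP gP; apply: part_inj => b; rewrite partD !part_cint -RintegralD//.
- by apply: eq_Rintegral => x _; rewrite partD.
- exact: ispoly_integrable.
- exact: ispoly_integrable.
Qed.

Lemma cintZ c f : ispoly f -> cint (fun A => c * f A) = c * cint f.
Proof.
move=> fP; have ib b := ispoly_integrable b fP.
have iZ r b : lam.-integrable D (EFin \o (fun x => r * part b (f (coordmx x)))).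
  have := ispoly_integrable b (ispolyM (ispoly_cst (inF K r)) fP).
  by congr (_.-integrable _ _); apply/funext => x /=; rewrite part_inFM.
apply: part_inj => b; rewrite part_cint.
have p1 b' r : r * part b' (cint f) = bint (fun A => r * part b' (f A)).
  by rewrite part_cint -RintegralZl.
case: b => /=.
  rewrite reF_mul -!/(part true _) -!/(part false _) !p1 -RintegralB//.
  by apply: eq_Rintegral => x _; rewrite /= reF_mul.
rewrite imF_mul -!/(part true _) -!/(part false _) !p1 -RintegralD//.
by apply: eq_Rintegral => x _; rewrite /= imF_mul.
Qed.

Lemma cint_sum0 (I : finType) (f : I -> M -> F) :
  (forall i, ispoly (f i)) -> (forall i, cint (f i) = 0) ->
  cint (fun A => \sum_i f i A) = 0.
Proof.
move=> fP f0.
suff [_ //] : ispoly (fun A => \sum_i f i A) /\ cint (fun A => \sum_i f i A) = 0.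
elim: index_enum => [|i r [IHp IH]].
  have -> : (fun A => \sum_(i <- [::]) f i A) = (fun=> 0 * 0).
    by apply/funext => A; rewrite big_nil mul0r.
  by split; [exact: ispoly_cst|rewrite cintZ ?mul0r//; exact: ispoly_cst].
have -> : (fun A => \sum_(j <- i :: r) f j A) =
    (fun A => f i A + \sum_(j <- r) f j A).
  by apply/funext => A; rewrite big_cons.
by split; [exact: ispolyD|rewrite cintD// f0 IH addr0].
Qed.

Lemma tau_tr A : selfadjoint A -> tau R K *: A^T = tau R K *: A.
Proof.
move=> sA; rewrite -{2}sA /tau; move: A {sA}; case: K => A; last by rewrite !scale0r.
by congr (_ *: _); apply/matrixP => i j; rewrite !mxE.
Qed.

Definition sympart A : M := (1 - tau R K) *: A + tau R K *: A^T.

(** The divergence theorem for the field of components [flux]: its weight kills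
    the boundary values since [w] vanishes at 0. *)
Lemma cint_flux A g Dg (w : {poly F}) : polyfun g Dg -> w.[0] = 0 ->
  cint (fun B => w.[bdet B] * (Dg B (sympart (mobius A B))
                    - 2 * frame_dim n (tau R K) * \tr (A *m B) * g B)
    - 2 * (w^`().[bdet B] * bdet B) * (\tr (A *m B) * g B)) = 0.
Proof.
move=> gP w0.
pose fl k : M -> F := flux (@basis R K n) A g w k.
pose dfl k : M -> M -> F := dflux (@basis R K n) A g Dg w k.
have flP k : polyfun (fl k) (dfl k) by exact: polyfun_flux.
rewrite -[RHS](@cint_sum0 _ (fun k B => dfl k B (basis k))).
- apply: cint_eq => B [sB _].
  by rewrite (divergence_flux (@frameP R K n) A w gP (tau_tr sB)).
- by move=> k; exact: polyfun_derivative (flP k).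
move=> k; apply: part_inj => b; rewrite part_cint part0.
rewrite /bint /Rintegral (ball_ibp k b (flP k))// => B bB dB.
have d0 : bdet B = 0.
  by apply: scal_eqP; rewrite ?reF0 ?imF0 ?dB//; have [-> _] := ball_bdet bB.
by rewrite /fl /flux d0 w0 !mulr0.
Qed.

End ball_integral.

(** * The boundary is a null set, and the limit to the constant weight *)

Section boundary_limit.
Variables (R : realType) (K : scalar_kind) (n : nat).
Local Notation T := (measurableTypeR R).
Local Notation F := (scal R K).
Local Notation X := ((dimE K n).-tuple T).
Local Notation lam := (@lebesgue_tuple R (dimE K n)).
Local Notation D := (@ballset R K n).
Let mD : measurable D := @ballset_measurable R K n.

Definition boundary : set X := [set x | D x /\ reF (bdet (coordmx x)) = 0].

Lemma boundary_measurable : measurable boundary.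
Proof.
have mb := polyfun_measurable (@polyfun_bdet F n) true.
rewrite (_ : boundary = D `&` ((fun x : X => part true (bdet (coordmx x))) @^-1` [set 0])) //.
apply: measurableI => //; rewrite -[X in measurable X]setTI.
by apply: mb => //; exact: measurable_set1.
Qed.

Lemma scale_ballset r (x : X) : D x -> 0 <= r < 1 -> (D `\` boundary) (tscale r x).
Proof.
move=> xD r01.
have sE : coordmx (tscale r x) = inF K r *: coordmx x.
  by apply: coordmx_scale => k; rewrite tnth_mktuple.
have [br dr] := ball_scale xD r01.
split; first by rewrite /ballset /preimage /= sE.
by case=> _; rewrite sE; exact/eqP.
Qed.

(** For r < 1, the ball shrunk by r avoids the boundary, so that
    r^d vol(D) <= vol(D minus the boundary); let r tend to 1. *)
Lemma boundary_null : lam boundary = 0.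
Proof.
have mE : measurable (D `\` boundary) by apply: measurableD => //; exact: boundary_measurable.
have Dfin : lam D \is a fin_num by rewrite ge0_fin_numE//; exact: ballset_lty.
have Elty : (lam (D `\` boundary) < +oo)%E.
  apply: le_lt_trans (ballset_lty R K n); apply: le_measure; [exact/mem_set|exact/mem_set|exact: subDsetl].
have Efin : lam (D `\` boundary) \is a fin_num by rewrite ge0_fin_numE.
pose u := fine (lam D); pose v := fine (lam (D `\` boundary)).
have u0 : 0 <= u by exact: fine_ge0.
have scl r : 0 < r < 1 -> r ^+ dimE K n * u <= v.
  move=> /andP[r0 r1]; rewrite -lee_fin EFinM !fineK//.
  rewrite -[in leRHS](setIT (D `\` boundary)) -[in leLHS](setIT D) -!integral_indic//.
  rewrite [leRHS](ge0_integral_tscale r0)//; last first.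
    exact/measurable_EFinP/measurable_indic.
  rewrite lee_pmul2l ?lte_fin ?exprn_gt0//.
  apply: ge0_le_integral => //.
  - exact/measurable_EFinP/measurable_indic.
  - apply/measurable_EFinP; apply: measurableT_comp; last exact: measurable_tscale.
    exact: measurable_indic.
  move=> x _; rewrite lee_fin !indicE; case: (boolP (x \in D)) => [/set_mem xD|_]; last by [].
  have r01 : 0 <= r < 1 by rewrite (ltW r0).
  by rewrite (mem_set (scale_ballset xD r01)).
have uv : u <= v.
  rewrite leNgt; apply/negP => vu; have up : 0 < u by apply: le_lt_trans vu; exact: fine_ge0.
  pose d := dimE K n; pose e := (u - v) / u.
  have e0 : 0 < e by rewrite divr_gt0// subr_gt0.
  (* By Bernoulli's inequality r ^ d > 1 - e, which contradicts [scl r]. *)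
  pose r := 1 - e / (2 * d.+1%:R).
  have e1 : e <= 1 by rewrite ler_pdivrMr// mul1r gerBl; exact: fine_ge0.
  have dp : (1 : R) <= d.+1%:R by rewrite ler1n.
  have q0 : 0 < e / (2 * d.+1%:R) by rewrite divr_gt0//; lra.
  have q1 : e / (2 * d.+1%:R) < 1 by rewrite ltr_pdivrMr; lra.
  have bern : 1 - d%:R * (e / (2 * d.+1%:R)) <= r ^+ d.
    rewrite /r; move: (e / _) q0 q1 => q q0 q1; elim: (d) => [|k IH].
      by rewrite mul0r subr0.
    rewrite exprS -natr1; have : 0 <= k%:R :> R by [].
    move: (k%:R) ((1 - q) ^+ k) IH => a b IH a0.
    have IH0 : 0 <= b - (1 - a * q) by rewrite subr_ge0.
    have q1' : 0 <= 1 - q by lra.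
    have := mulr_ge0 q1' IH0; have := mulr_ge0 a0 (sqr_ge0 q); nra.
  have r01 : 0 < r < 1 by rewrite /r; move: (e / _) q0 q1 => q ? ?; apply/andP; split; lra.
  have := scl r r01; rewrite -/d leNgt => /negP; apply.
  apply: lt_le_trans (_ : (1 - d%:R * (e / (2 * d.+1%:R))) * u <= _); last by rewrite ler_pM2r.
  have ve : v = (1 - e) * u by rewrite /e mulrBl mul1r divfK ?gt_eqF// opprB addrC subrK.
  rewrite ve ltr_pM2r// ltrD2l ltrN2 mulrCA gtr_pMr//.
  by rewrite ltr_pdivrMr; [rewrite mul1r -natr1|]; lra.
have bfin : lam boundary \is a fin_num.
  rewrite ge0_fin_numE//; apply: le_lt_trans (ballset_lty R K n).
  by apply: le_measure; [exact: (mem_set boundary_measurable)|exact/mem_set|move=> x []].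
have : lam D = (lam (D `\` boundary) + lam (D `&` boundary))%E :=
  measureDI lam mD boundary_measurable.
rewrite (_ : D `&` boundary = boundary); last by apply/seteqP; split=> x [].
rewrite -(fineK Dfin) -(fineK Efin) -(fineK bfin) -EFinD => -[] uvb.
congr (_%:E); apply/eqP; rewrite eq_le fine_ge0// andbT.
by move: uv; rewrite /u /v uvb gerDl.
Qed.

End boundary_limit.

Section truncation.
Variable R : realType.

(** The second factor is the beginning of the power series of (1 - r)^(-m), whose
    coefficients are all nonnegative. *)
Lemma geometric_weight (r : R) m : 0 <= r <= 1 ->
  (1 - r) ^+ m * (1 + m%:R * r + m%:R * (m%:R + 1) / 2 * r ^+ 2) <= 1.
Proof.
move=> /andP[r0 r1]; elim: m => [|m IH].
  by rewrite expr0 !mul0r !addr0 mul1r.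
apply: le_trans IH; rewrite exprSr -mulrA ler_wpM2l ?exprn_ge0 ?subr_ge0//.
rewrite -(natr1 m); have : 0 <= m%:R :> R by [].
move: (m%:R) => a a0; rewrite -subr_ge0.
rewrite [leRHS](_ : _ = (a + 1) * (a + 1 + 1) / 2 * r ^+ 3); last by field.
by rewrite mulr_ge0 ?exprn_ge0// divr_ge0// mulr_ge0; lra.
Qed.

(** Here and below, the sequence is r w'(r) for w(x) = 1 - (1 - x)^(m + 1). It has
    to be dominated and to tend to 0 for the term of the divergence that contains
    w' to disappear in the limit. *)
Lemma truncation_bound (r : R) m : 0 <= r <= 1 ->
  0 <= m.+1%:R * (1 - r) ^+ m * r <= 1.
Proof.
move=> r01; have := geometric_weight m r01; have /andP[r0 r1] := r01.
have q0 : 0 <= (1 - r) ^+ m by rewrite exprn_ge0// subr_ge0.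
have m0 : 0 <= m%:R :> R by [].
rewrite -(natr1 m); move: (m%:R) ((1 - r) ^+ m) m0 q0 => a q a0 q0 h.
apply/andP; split; first by rewrite !mulr_ge0//; lra.
apply: le_trans h; rewrite [leLHS](_ : _ = q * (r + a * r)); last by ring.
rewrite ler_wpM2l// -addrA lerD// lerDl.
by rewrite !mulr_ge0// ?sqr_ge0//; lra.
Qed.

Lemma truncation_cvg (r : R) : 0 < r <= 1 ->
  (fun m => m.+1%:R * (1 - r) ^+ m * r) @ \oo --> 0.
Proof.
move=> /andP[r0 r1]; have r01 : 0 <= r <= 1 by rewrite ltW.
rewrite -cvg_shiftS /=.
apply: (@squeeze_cvgr _ _ _ _ (fun=> 0 : R) (fun m => 2 / r * harmonic m)).
- near=> m; have /andP[-> _] /= := truncation_bound m.+1 r01.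
  have := geometric_weight m.+1 r01.
  have q0 : 0 <= (1 - r) ^+ m.+1 by rewrite exprn_ge0// subr_ge0.
  have m1 : 0 < m.+1%:R :> R by [].
  rewrite /harmonic/= -(natr1 m.+1).
  move: (m.+1%:R) ((1 - r) ^+ m.+1) m1 q0 => a q a0 q0 h.
  rewrite -[leRHS]mulrA -invfM ler_pdivlMr ?mulr_gt0//.
  have : q * (a * (a + 1) / 2 * r ^+ 2) <= 1.
    apply: le_trans h; rewrite ler_wpM2l// lerDr addr_ge0// mulr_ge0//; lra.
  by move: q0 => _ h2; have : 2 * (q * (a * (a + 1) / 2 * r ^+ 2)) = (a + 1) * q * r * (r * a);
    [by field | lra].
- exact: cvg_cst.
- rewrite -[0](mulr0 (2 / r)); apply: cvgMr; exact: cvg_harmonic.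
Unshelve. all: by end_near.
Qed.

End truncation.

Section limit.
Variables (R : realType) (K : scalar_kind) (n : nat).
Local Notation T := (measurableTypeR R).
Local Notation F := (scal R K).
Local Notation M := 'M[F]_n.
Local Notation X := ((dimE K n).-tuple T).
Local Notation lam := (@lebesgue_tuple R (dimE K n)).
Local Notation D := (@ballset R K n).
Implicit Types (f g G Q : M -> F) (A : M).

Let mD : measurable D := @ballset_measurable R K n.

(** Polynomials that vanish at 0 and increase to 1 on the interval ]0, 1]. *)
Definition truncpoly m : {poly F} := 1 - (1 - 'X) ^+ m.+1.

Lemma truncpoly_0 m : (truncpoly m).[0] = 0.
Proof. by rewrite /truncpoly !(hornerE, horner_exp) subr0 expr1n subrr. Qed.

Lemma truncpolyE m r : (truncpoly m).[inF K r] = inF K (1 - (1 - r) ^+ m.+1).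
Proof. by rewrite /truncpoly !(hornerE, horner_exp) rmorphB rmorphXn rmorphB rmorph1. Qed.

Lemma deriv_truncpolyE m r : (truncpoly m)^`().[inF K r] = inF K (m.+1%:R * (1 - r) ^+ m).
Proof.
rewrite /truncpoly derivB derivC sub0r deriv_exp derivB derivC derivX sub0r /=.
rewrite mulN1r mulNrn opprK hornerMn !(hornerE, horner_exp) -mulr_natl.
by rewrite rmorphM rmorphXn rmorphB rmorph1 rmorph_nat.
Qed.

Lemma ball_bdet_inF A : op_ball A -> bdet A = inF K (reF (bdet A)).
Proof.
by move=> /ball_bdet[im0 _ _ _]; apply: scal_eqP; rewrite ?reF_inF ?imF_inF.
Qed.

(** Dominated convergence: off the boundary 0 < bdet A <= 1, so the first weight
    tends to 1 and the second one to 0, while on the boundary, a null set, both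
    are 0. *)
Lemma cint_limit G Q : ispoly G -> ispoly Q ->
  (forall m, cint (fun A => (truncpoly m).[bdet A] * G A
     - 2 * ((truncpoly m)^`().[bdet A] * bdet A) * Q A) = 0) ->
  cint G = 0.
Proof.
move=> Gp Qp G0; apply: part_inj => b; rewrite part_cint part0.
have [DG GP] := Gp; have [DQ QP] := Qp.
have [N1 GN] := polyfun_bounded GP n%:R; have [N2 QN] := polyfun_bounded QP n%:R.
pose u m A := (truncpoly m).[bdet A] * G A - 2 * ((truncpoly m)^`().[bdet A] * bdet A) * Q A.
have up m : ispoly (u m).
  have hp w : ispoly (fun A => w.[bdet A]).
    by eexists; exact: polyfun_horner (@polyfun_bdet F n).
  have bp : ispoly (@bdet F n) by eexists; exact: polyfun_bdet.
  apply: ispolyD (ispolyM (hp _) Gp) _.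
  have := ispolyM (ispoly_cst _ (-2))
    (ispolyM (ispolyM (hp (truncpoly m)^`()) bp) Qp).
  by congr ispoly; apply/funext => A; ring.
have uE m A : op_ball A -> let r := reF (bdet A) in
    part b (u m A) = (1 - (1 - r) ^+ m.+1) * part b (G A)
      - 2 * (m.+1%:R * (1 - r) ^+ m * r) * part b (Q A).
  move=> bA r; rewrite /u (ball_bdet_inF bA) -/r truncpolyE deriv_truncpolyE -rmorphM.
  have -> : 2 = inF K 2 :> F by rewrite rmorph_nat.
  by rewrite -rmorphM -mulNr -rmorphN partD !part_inFM mulNr.
pose h (x : X) := (part b (G (coordmx x)))%:E.
have hint : lam.-integrable D h by exact: ispoly_integrable.
have mbd := @boundary_measurable R K n.
have mDb : measurable (D `\` @boundary R K n) by exact: measurableD.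
have lim0 : (\int[lam]_(x in D) (h \_ (D `\` @boundary R K n)) x = 0)%E.
  have uint m : (\int[lam]_(x in D) (part b (u m (coordmx x)))%:E = 0)%E.
    have := part_cint b (u m); rewrite G0 part0 /bint /Rintegral => /esym u0.
    have ui := ispoly_integrable b (up m).
    by rewrite -[LHS]fineK ?integrable_fin_num//; congr EFin.
  have : (fun m => \int[lam]_(x in D) (part b (u m (coordmx x)))%:E)%E @ \oo -->
      (\int[lam]_(x in D) (h \_ (D `\` @boundary R K n)) x)%E.
    apply: (@dominated_cvg _ _ _ _ _ mD _ _
      (fun x => (part true (inF K (N1 + 2 * N2)))%:E)).
    - by move=> m; have /integrableP[] := ispoly_integrable b (up m).
    - move=> x Dx; under eq_fun do rewrite uE//.
      have [_ r01 _ _] := ball_bdet Dx.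
      move: r01; rewrite /h patchE; set r := reF _ => r01.
      have [bx|bx] := boolP (x \in D `\` @boundary R K n); last first.
        have -> : r = 0.
          by apply: contrapT => r0; move/negP: bx; apply; apply/mem_set; split => // -[].
        rewrite (_ : (fun _ => _) = cst (0 : \bar R)%E); first exact: cvg_cst.
        by apply/funext => m; rewrite subr0 expr1n subrr mul0r !mulr0 mul0r subrr.
      have r0 : 0 < r.
        have [_ nb] := set_mem bx; rewrite lt_neqAle eq_sym; case/andP: r01 => -> _.
        by rewrite andbT; apply/eqP => r0; apply: nb.
      apply: cvg_EFin; first exact: nearW.
      rewrite [X in _ --> X](_ : _ = (1 - 0) * part b (G (coordmx x))
          - 2 * 0 * part b (Q (coordmx x))); last by ring.
      apply: cvgB; apply: cvgMl; last first.
        by apply: cvgMr; apply: truncation_cvg; rewrite r0; case/andP: r01.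
      apply: cvgB; first exact: cvg_cst.
      rewrite (cvg_shiftS (fun m => (1 - r) ^+ m)); apply: cvg_expr.
      by rewrite ltr_norml; case/andP: r01 => *; apply/andP; split; lra.
    - by [].
    - exact: ispoly_integrable (ispoly_cst _ _).
    move=> m x Dx; rewrite /= lee_fin uE// reF_inF.
    have [_ r01 _ _] := ball_bdet Dx; move: r01; set r := reF _ => r01.
    have [_ xn] := ballset_entries Dx.
    have := GN _ xn b; have := QN _ xn b.
    have /andP[t0 t1] := truncation_bound m r01.
    have q01 : 0 <= (1 - r) ^+ m.+1 <= 1.
      by case/andP: r01 => r0 r1; rewrite exprn_ge0 ?exprn_ile1 ?subr_ge0 ?lerBlDr ?lerDl.
    move: (_ * r) t0 t1 ((1 - r) ^+ m.+1) q01 (part b _) (part b _) => t t0 t1 q /andP[q0 q1] z y zN yN.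
    apply: le_trans (ler_normB _ _) _; rewrite !normrM !(ger0_norm (_ : 0 <= 1 - q)) ?subr_ge0//.
    rewrite (ger0_norm t0) (ger0_norm (_ : 0 <= 2))//.
    have := normr_ge0 z; have := normr_ge0 y; nra.
  rewrite (_ : (fun m => _) = cst 0%E); last by apply/funext => m; exact: uint.
  by move/cvg_unique => /(_ _ _ (@cvg_cst _ _ _ _ _))->.
move: lim0; rewrite -integral_mkcondr.
rewrite (_ : D `&` (D `\` _) = D `\` @boundary R K n); last first.
  by apply/seteqP; split=> x [] // ? [].
rewrite -(negligible_integral mbd mD hint (@boundary_null R K n)) => h0.
by rewrite /bint /Rintegral h0.
Qed.

End limit.

(** * Linear equations for the second moments *)

Section wick.
Variables (R : realType) (K : scalar_kind) (n : nat).
Local Notation F := (scal R K).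
Local Notation M := 'M[F]_n.
Local Notation tau := (tau R K).
Implicit Types (f g : M -> F) (A B : M).

Definition wint s f : F := cint (fun A => bdet A ^+ s * f A).

Lemma wintD s f g : ispoly f -> ispoly g ->
  wint s (fun A => f A + g A) = wint s f + wint s g.
Proof.
move=> fP gP; have dP := @ispoly_bdetX R K n s.
rewrite /wint -cintD; [|exact: ispolyM..].
by apply: cint_eq => A _; rewrite mulrDr.
Qed.

Lemma wintZ s c f : ispoly f -> wint s (fun A => c * f A) = c * wint s f.
Proof.
move=> fP; have dP := @ispoly_bdetX R K n s.
rewrite /wint -cintZ; last exact: ispolyM.
by apply: cint_eq => A _; rewrite mulrCA.
Qed.

Definition mass s : F := wint s (fun=> 1).
Definition moment s i j l k : F := wint s (fun A => A i j * A l k).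

Lemma ispoly_moment i j l k : ispoly (fun A => A i j * A l k).
Proof. by apply: ispolyM; exact: ispoly_entry. Qed.

Lemma mul_delta_mul A B i j l k : (A *m delta_mx j i *m B) l k = A l j * B i k.
Proof.
rewrite -mulmxA mxE (bigD1 j)//= big1 => [|p pj]; last first.
  by rewrite mxE big1 ?mulr0// => q _; rewrite mxE (negPf pj) mul0r.
rewrite addr0 mxE (bigD1 i)//= big1 => [|q qi]; last first.
  by rewrite mxE (negPf qi) andbF mul0r.
by rewrite mxE !eqxx mul1r addr0.
Qed.

Lemma tr_delta_mul B i j : \tr (delta_mx j i *m B) = B i j.
Proof.
rewrite /mxtrace (bigD1 j)//= big1 => [|p pj].
  by have := mul_delta_mul 1%:M B i j j j; rewrite mul1mx => ->; rewrite mxE eqxx mul1r addr0.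
by have := mul_delta_mul 1%:M B i j p p; rewrite mul1mx => ->; rewrite mxE (negPf pj) mul0r.
Qed.

Lemma sympartE A l k : sympart A l k = (1 - tau) * A l k + tau * A k l.
Proof. by rewrite !mxE. Qed.

Lemma mobius_deltaE B i j l k : mobius (delta_mx j i) B l k =
  ((l == j) && (k == i))%:R - B l j * B i k.
Proof. by rewrite /mobius mxE [X in _ + X]mxE mul_delta_mul mxE. Qed.

(** [cint_flux] for the matrix unit A = E_ji, so that tr(A T) = T_ij, for g = T_lk
    and for the weight w(x) = x^s, or its substitute [truncpoly] if s = 0. *)
Lemma wick_eq s i j l k :
  (1 - tau) * (((l == j) && (k == i))%:R * mass s - moment s l j i k)
  + tau * (((k == j) && (l == i))%:R * mass s - moment s k j i l)
  = (2 * frame_dim n tau + 2 * s%:R) * moment s i j l k.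
Proof.
pose G B := sympart (mobius (delta_mx j i) B) l k
  - 2 * frame_dim n tau * \tr (delta_mx j i *m B) * B l k.
pose Q B := B i j * B l k.
pose c1 : F := ((l == j) && (k == i))%:R; pose c2 : F := ((k == j) && (l == i))%:R.
have GE : G = fun B => ((1 - tau) * c1 + tau * c2) * 1
    + ((- (1 - tau)) * (B l j * B i k)
    + ((- tau) * (B k j * B i l) + (- (2 * frame_dim n tau)) * Q B)).
  apply/funext => B; rewrite /G /Q sympartE !mobius_deltaE tr_delta_mul -/c1 -/c2.
  by move: (B l j * B i k) (B k j * B i l) c1 c2 => *; ring.
have Zp c i' j' l' k' : ispoly (fun B => c * (B i' j' * B l' k')).
  by apply: ispolyM; [exact: ispoly_cst|exact: ispoly_moment].
have Cp : ispoly (fun B : M => ((1 - tau) * c1 + tau * c2) * 1) by exact: ispoly_cst.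
have Gp : ispoly G.
  rewrite GE.
  exact: ispolyD Cp (ispolyD (Zp _ _ _ _ _) (ispolyD (Zp _ _ _ _ _) (Zp _ _ _ _ _))).
have Qp : ispoly Q by exact: ispoly_moment.
have key : cint (fun B => bdet B ^+ s * (G B + (- (2 * s%:R)) * Q B)) = 0.
  case: s => [|s].
    rewrite -[RHS](@cint_limit _ _ _ G Q Gp Qp).
      by apply: cint_eq => B _; rewrite expr0 mul1r mulr0 oppr0 mul0r addr0.
    move=> m; have := cint_flux (delta_mx j i) (polyfun_entry F l k) (@truncpoly_0 R K m).
    by rewrite /G /Q; congr (cint _ = _); apply/funext => B; rewrite tr_delta_mul mulrA.
  have X0 : ('X^(s.+1) : {poly F}).[0] = 0 by rewrite hornerXn expr0n.
  rewrite -[RHS](cint_flux (delta_mx j i) (polyfun_entry F l k) X0).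
  apply: cint_eq => B _; rewrite derivXn hornerMn !hornerXn -/(G B) tr_delta_mul -/(Q B).
  rewrite (mulrnAl (bdet B ^+ s)) -exprSr -(mulr_natl (bdet B ^+ s.+1)).
  by move: (bdet B ^+ s.+1) (G B) (Q B) (s.+1%:R) => *; ring.
have : wint s (fun B => G B + (- (2 * s%:R)) * Q B) = 0 by [].
rewrite wintD//; last exact: Zp.
rewrite GE.
rewrite wintD; [|exact: Cp|exact: ispolyD (Zp _ _ _ _ _) (ispolyD (Zp _ _ _ _ _) (Zp _ _ _ _ _))].
rewrite wintD; [|exact: Zp|exact: ispolyD (Zp _ _ _ _ _) (Zp _ _ _ _ _)].
rewrite wintD; [|exact: Zp|exact: Zp].
rewrite !wintZ; [|exact: ispoly_moment|exact: ispoly_moment|exact: ispoly_moment|exact: ispoly_moment|exact: ispoly_cst].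
rewrite -/(mass s) -!/(moment s _ _ _ _) /c1 /c2 => /eqP; rewrite addr_eq0 => /eqP E.
apply/eqP; rewrite -subr_eq0; apply/eqP; move: E.
move: (moment s l j i k) (moment s k j i l) (moment s i j l k) (mass s) (frame_dim _ _).
move: (_%:R) (_%:R) (s%:R) => a b c x y z m d /eqP; rewrite -subr_eq0 => /eqP E.
by rewrite -[RHS]E; ring.
Qed.

End wick.

Section moments.
Variables (R : realType) (K : scalar_kind) (n : nat).

(** The Dyson index: the number of real parameters of an off-diagonal entry. *)
Definition beta : R := if K is RealK then 1 else 2.
(** The coefficient [2 * frame_dim] + 2 s of the equations [wick_eq]. *)
Definition kappa (s : nat) : R := beta * n%:R + 2 - beta + 2 * s%:R.

Lemma moment_comm s (i j l k : 'I_n) : moment R K s i j l k = moment R K s l k i j.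
Proof. by apply: cint_eq => A _; rewrite [A i j * _]mulrC. Qed.

End moments.
Arguments kappa {R} K n s.
Arguments beta {R} K.

Lemma inFM (R : realType) K (a b : R) : inF K (a * b) = inF K a * inF K b.
Proof. exact: rmorphM. Qed.

Lemma inFD (R : realType) K (a b : R) : inF K (a + b) = inF K a + inF K b.
Proof. exact: rmorphD. Qed.

Lemma inFB (R : realType) K (a b : R) : inF K (a - b) = inF K a - inF K b.
Proof. exact: rmorphB. Qed.

Lemma inF1 (R : realType) K : inF K (1 : R) = 1.
Proof. exact: rmorph1. Qed.

Lemma inF_nat (R : realType) K m : inF K (m%:R : R) = m%:R.
Proof. exact: rmorph_nat. Qed.

Lemma frame_dim_kappa (R : realType) K n : 2 * frame_dim n (tau R K) = inF K (kappa K n 0).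
Proof.
case: K.
  have : 2 * ((1 - 2^-1) * n%:R + 2^-1) = 1 * n%:R + 2 - 1 + 2 * 0%:R :> R by field.
  by [].
rewrite /frame_dim /tau (_ : kappa ComplexK n 0 = 2 * n%:R); last by rewrite /kappa /beta; ring.
by rewrite inFM !inF_nat subr0 mul1r addr0.
Qed.

(** This is [frame_trace_sqr] for the identity matrix, the elements of the basis
    having norm 1. *)
Lemma dimE_kappa (R : realType) K n : 2 * (dimE K n)%:R = n%:R * kappa K n 0 :> R.
Proof.
suff : inF K (2 * (dimE K n)%:R : R) = inF K (n%:R * kappa K n 0) by move/fmorph_inj.
rewrite !inFM !inF_nat -frame_dim_kappa.
rewrite mulrCA; congr (_ * _); rewrite mulrC -[n%:R]mxtrace1.
rewrite -(frame_trace_sqr (@frameP R K n)).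
under eq_bigr => k _.
  rewrite mulmx1 /basis trace_coordmx (bigD1 k)//= big1 => [|j jk].
    rewrite tnth_mktuple eqxx mulr1 addr0 rmorph1.
  over.
  by rewrite !tnth_mktuple (negPf jk) mulr0.
by rewrite sumr_const card_ord.
Qed.

Section wick_algebra.
Variable G : fieldType.
Implicit Types (t c m a b x y z : G).

Lemma symmetric_wick_solve t c m a b x y z : 2 * t = 1 ->
  (1 - t) * (a * m - x) + t * (b * m - y) = c * z ->
  2 * c * z + y + x = (a + b) * m.
Proof.
move=> t2 E; rewrite -mulrA -E.
transitivity ((2 - 2 * t) * (a * m - x) + 2 * t * (b * m - y) + y + x); first by ring.
by rewrite t2; ring.
Qed.

(** The three equations are permuted cyclically, so their sum yields x + y + z,
    and the first one then yields x. *)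
Lemma symmetric_wick_invert c m a b d x y z : 2 != 0 :> G ->
  2 * c * x + y + z = (a + b) * m -> 2 * c * y + z + x = (a + d) * m ->
  2 * c * z + x + y = (b + d) * m ->
  (c + 1) * (2 * c - 1) * x = ((a + b) * c - d) * m.
Proof.
move=> nz2 E1 E2 E3; apply: (mulfI nz2).
have E : (2 * c + 2) * (x + y + z) = 2 * (a + b + d) * m.
  transitivity ((a + b) * m + (a + d) * m + (b + d) * m); last by ring.
  by rewrite -E1 -E2 -E3; ring.
transitivity ((2 * c + 2) * ((2 * c * x + y + z) - (x + y + z))); first by ring.
by rewrite mulrBr E E1; ring.
Qed.

Lemma hermitian_wick_invert c m a b x y :
  c * x + y = a * m -> c * y + x = b * m ->
  (c + 1) * (2 * c - 2) * x = (2 * a * c - 2 * b) * m.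
Proof.
move=> E1 E2; transitivity (2 * (c * (c * x + y) - (c * y + x))); first by ring.
by rewrite E1 E2; ring.
Qed.

End wick_algebra.

Section real_moments.
Variables (R : realType) (n : nat).
Local Notation mo := (@moment R RealK n).

Lemma moment_sym s (i j l k : 'I_n) : mo s i j l k = mo s j i l k.
Proof.
apply: cint_eq => A [sA _]; congr (_ * (_ * _)).
by rewrite -[in LHS]sA !mxE.
Qed.

Lemma real_wick s (i j l k : 'I_n) :
  2 * inF RealK (kappa RealK n s) * mo s i j l k + mo s i l j k + mo s i k j l =
  (((l == j) && (k == i))%:R + ((k == j) && (l == i))%:R) * mass R RealK n s.
Proof.
have := wick_eq R RealK s i j l k.
rewrite (moment_sym s l j) (moment_comm R RealK s j l i k) (moment_sym s k j).
rewrite (moment_comm R RealK s j k i l).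
have -> : 2 * frame_dim n (tau R RealK) + 2 * s%:R = inF RealK (kappa RealK n s).
  by rewrite frame_dim_kappa -!inF_nat -inFM -inFD /kappa mulr0 addr0.
have t2 : 2 * tau R RealK = 1 by rewrite divff.
exact: (symmetric_wick_solve t2).
Qed.

(** Exchanging the indices in [real_wick] permutes the moments attached to the
    three pairings of the indices i, j, l, k. *)
Lemma real_moment s (i j l k : 'I_n) :
  inF RealK ((kappa RealK n s + 1) * (2 * kappa RealK n s - 1)) * mo s i j l k =
  ((((l == j) && (k == i))%:R + ((k == j) && (l == i))%:R) * inF RealK (kappa RealK n s)
   - ((i == j) && (k == l))%:R) * mass R RealK n s.
Proof.
have E1 := real_wick s i j l k.
have E2 := real_wick s i l j k; have E3 := real_wick s i k j l.
have sym2 i' j' l' k' : mo s i' j' l' k' = mo s i' j' k' l'.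
  by rewrite moment_comm moment_sym moment_comm.
rewrite (sym2 i k) addrAC (eq_sym j l) (eq_sym j i) in E2.
rewrite (sym2 i j k) (sym2 i l k) (eq_sym j k) (eq_sym l k) (eq_sym j i) in E3.
rewrite [(i == j) && _]andbC inFM inFD inFB !inFM !inF_nat !inF1.
by apply: symmetric_wick_invert E1 E2 E3; rewrite pnatr_eq0.
Qed.

End real_moments.

Section complex_moments.
Variables (R : realType) (n : nat).
Local Notation mo := (@moment R ComplexK n).

(** Here the equations couple only two moments, which are exchanged by swapping i
    and l. *)
Lemma complex_moment s (i j l k : 'I_n) :
  inF ComplexK ((kappa ComplexK n s + 1) * (2 * kappa ComplexK n s - 2)) * mo s i j l k =
  (2 * ((l == j) && (k == i))%:R * inF ComplexK (kappa ComplexK n s)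
   - 2 * ((i == j) && (k == l))%:R) * mass R ComplexK n s.
Proof.
have kE : 2 * frame_dim n (tau R ComplexK) + 2 * s%:R = inF ComplexK (kappa ComplexK n s).
  by rewrite frame_dim_kappa -!inF_nat -inFM -inFD /kappa mulr0 addr0.
have w i' j' l' k' : inF ComplexK (kappa ComplexK n s) * mo s i' j' l' k' + mo s l' j' i' k' =
    ((l' == j') && (k' == i'))%:R * mass R ComplexK n s.
  have := wick_eq R ComplexK s i' j' l' k'.
  by rewrite kE subr0 mul1r mul0r addr0 => <-; rewrite subrK.
have E1 := w i j l k; have E2 := w l j i k.
rewrite inFM inFD inFB !inFM !inF_nat !inF1.
exact: hermitian_wick_invert E1 E2.
Qed.

End complex_moments.

(** * Values of the second moments *)

Section moment_values.
Variables (R : realType) (K : scalar_kind) (n : nat).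
Local Notation kap := (kappa K n).
Local Notation be := (@beta R K).

Definition wvol s : R := reF (mass R K n s).

Lemma massE s : mass R K n s = inF K (wvol s).
Proof.
apply: scal_eqP; rewrite ?reF_inF ?imF_inF//.
rewrite -[LHS]/(part false _) [LHS]part_cint /bint.
rewrite (@eq_Rintegral _ _ _ _ _ (fun=> 0)) ?Rintegral_cst ?mul0r//.
  exact: ballset_measurable.
by move=> x /set_mem Dx; rewrite mulr1 (ball_bdet_inF Dx) -rmorphXn /= imF_inF.
Qed.

Lemma moment_formula s (i j l k : 'I_n) :
  inF K ((kap s + 1) * (2 * kap s - be)) * moment R K s i j l k =
  inF K (((if K is RealK then ((l == j) && (k == i))%:R + ((k == j) && (l == i))%:R
           else 2 * ((l == j) && (k == i))%:R) * kap s
          - be * ((i == j) && (k == l))%:R) * wvol s).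
Proof.
rewrite [in RHS]inFM -massE; move: i j l k; case: K => i j l k.
  rewrite [in LHS]real_moment; congr (_ * _).
  by rewrite mul1r inFB inFM inFD !inF_nat.
rewrite [in LHS]complex_moment; congr (_ * _).
by rewrite inFB !inFM !inF_nat.
Qed.

Lemma beta12 : be = 1 \/ be = 2. Proof. by rewrite /beta; case: K; [left|right]. Qed.

Lemma kappa_ge s : (0 < n)%N -> 2 <= kap s :> R.
Proof.
move=> n0; have : 1 <= n%:R :> R by rewrite ler1n.
have : 0 <= s%:R :> R by [].
by rewrite /kappa; case: beta12 => ->; lra.
Qed.

Lemma moment_den_gt0 s : (0 < n)%N -> 0 < (kap s + 1) * (2 * kap s - be).
Proof.
move=> /(kappa_ge s) k2; apply: mulr_gt0; first lra.
by case: beta12 => ->; lra.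
Qed.

Lemma moment_diag s (i : 'I_n) : moment R K s i i i i = inF K (wvol s / (kap s + 1)).
Proof.
have n0 : (0 < n)%N by apply: leq_ltn_trans (ltn_ord i).
have k2 := kappa_ge s n0.
have nz : (kap s + 1) * (2 * kap s - be) != 0.
  by rewrite gt_eqF// moment_den_gt0.
have := moment_formula s i i i i; rewrite !eqxx /=.
move=> E; apply: (@mulfI _ (inF K ((kap s + 1) * (2 * kap s - be)))).
  by rewrite fmorph_eq0.
rewrite E -inFM; congr inF.
have -> : (if K is RealK then 1 + 1 else 2 * 1) = 2 :> R by case: K; ring.
by field; rewrite gt_eqF//; lra.
Qed.

Lemma moment_abs s (i j : 'I_n) : i != j ->
  moment R K s i j j i = inF K (be * kap s / ((kap s + 1) * (2 * kap s - be)) * wvol s).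
Proof.
move=> ij; have n0 : (0 < n)%N by apply: leq_ltn_trans (ltn_ord i).
have k2 := kappa_ge s n0.
have nz : (kap s + 1) * (2 * kap s - be) != 0.
  by rewrite gt_eqF// moment_den_gt0.
have := moment_formula s i j j i; rewrite !eqxx (negPf ij) /=.
move=> E; apply: (@mulfI _ (inF K ((kap s + 1) * (2 * kap s - be)))).
  by rewrite fmorph_eq0.
rewrite E -inFM; congr inF.
have -> : (if K is RealK then 1 + 0 else 2 * 1) = be :> R by rewrite /beta; case: K; ring.
by rewrite mulr0 subr0 mulrA mulrCA divff// mulr1.
Qed.

Lemma moment_cov s (i k : 'I_n) : i != k ->
  moment R K s i i k k = inF K (- (be / ((kap s + 1) * (2 * kap s - be)) * wvol s)).
Proof.
move=> ik; have n0 : (0 < n)%N by apply: leq_ltn_trans (ltn_ord i).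
have k2 := kappa_ge s n0.
have nz : (kap s + 1) * (2 * kap s - be) != 0.
  by rewrite gt_eqF// moment_den_gt0.
have := moment_formula s i i k k; rewrite !eqxx (eq_sym k i) (negPf ik) /=.
move=> E; apply: (@mulfI _ (inF K ((kap s + 1) * (2 * kap s - be)))).
  by rewrite fmorph_eq0.
rewrite E -inFM; congr inF.
have -> : (if K is RealK then 0 + 0 else 2 * 0) = 0 :> R by case: K; ring.
by rewrite mul0r mulr1 sub0r mulNr mulrN; congr (- _); rewrite mulrA mulrCA divff// mulr1.
Qed.

Lemma moment_zero s (i j l k : 'I_n) :
  (l, k) \notin [:: (i, j); (j, i)] -> ~~ ((i == j) && (l == k)) ->
  moment R K s i j l k = 0.
Proof.
rewrite !inE negb_or !xpair_eqE => /andP[lk1 lk2] ijlk.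
have n0 : (0 < n)%N by apply: leq_ltn_trans (ltn_ord i).
have k2 := kappa_ge s n0.
have nz : (kap s + 1) * (2 * kap s - be) != 0.
  by rewrite gt_eqF// moment_den_gt0.
have := moment_formula s i j l k.
rewrite (negPf lk2) [(k == j) && _]andbC (negPf lk1) (eq_sym k l) (negPf ijlk).
rewrite mulr0 addr0 mulr0 (_ : (if K is RealK then 0 else 0) = 0); last by case: K.
rewrite mul0r subr0 mul0r rmorph0 => /eqP; rewrite mulf_eq0 fmorph_eq0 (negPf nz) /=.
by move/eqP.
Qed.

End moment_values.

(** * Volume of the unit ball *)

Section weighted_volumes.
Variables (R : realType) (K : scalar_kind) (n : nat).
Local Notation F := (scal R K).
Local Notation M := 'M[F]_n.
Local Notation T := (measurableTypeR R).
Local Notation X := ((dimE K n).-tuple T).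
Local Notation lam := (@lebesgue_tuple R (dimE K n)).
Local Notation D := (@ballset R K n).
Local Notation kap := (@kappa R K n).
Local Notation be := (@beta R K).
Local Notation d := (dimE K n).
Local Notation wvol := (wvol R K n).
Hypothesis n_gt0 : (0 < n)%N.

Let mD : measurable D := @ballset_measurable R K n.

Lemma wvol_0 : wvol 0 = fine (lam D).
Proof.
rewrite /wvol -[LHS]/(part true _) [LHS]part_cint /bint.
rewrite (@eq_Rintegral _ _ _ _ _ (fun=> 1)) ?Rintegral_cst ?mul1r//.
by move=> x _; rewrite /= expr0 mulr1 -(inF1 R K) reF_inF.
Qed.

Lemma wvol_ge0 s : 0 <= wvol s.
Proof.
rewrite /wvol -[X in _ <= X]/(part true _) [X in _ <= X]part_cint /bint.
apply: Rintegral_ge0 => x Dx; have [_ /andP[r0 _] _ _] := ball_bdet Dx.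
by rewrite mulr1 (ball_bdet_inF Dx) -rmorphXn /= reF_inF exprn_ge0.
Qed.

Lemma le_cint f g : ispoly f -> ispoly g ->
  (forall A : M, op_ball A -> reF (f A) <= reF (g A)) -> reF (cint f) <= reF (cint g).
Proof.
move=> fP gP fg.
have E h : reF (cint h) = (\int[lam]_(x in D) part true (h (coordmx x)))%R.
  exact: (part_cint true h).
by rewrite !E; apply: le_Rintegral => [//|||x Dx]; [exact: ispoly_integrable..|exact: fg].
Qed.

Definition trsq (A : M) : F := \sum_i \sum_j A i j * A j i.

Lemma trsqE A : selfadjoint A -> trsq A = inF K (sqtr A).
Proof.
move=> sA; have trE : trsq A = \tr (A *m A).
  by apply: eq_bigr => i _; rewrite mxE.
have [l lA] := spectrum_ex sA.
by rewrite trE (spectrum_sqtr lA) -[A *m A]/(A ^+ 2) (spectrum_trX _ lA).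
Qed.

Lemma ispoly_sum (I : finType) (f : I -> M -> F) :
  (forall i, ispoly (f i)) -> ispoly (fun A => \sum_i f i A).
Proof.
move=> fP; have [Df DfP] : exists Df, forall i, polyfun (f i) (Df i).
  by have [Df DfP] := choice fP; exists Df.
by eexists; exact: polyfun_sum DfP.
Qed.

Lemma ispoly_trsq : ispoly trsq.
Proof. by do 2!apply: ispoly_sum => ?; exact: ispoly_moment. Qed.

Lemma wint_sum s (I : finType) (f : I -> M -> F) :
  (forall i, ispoly (f i)) -> wint s (fun A => \sum_i f i A) = \sum_i wint s (f i).
Proof.
move=> fP.
suff [_ //] : ispoly (fun A => \sum_i f i A) /\
  wint s (fun A => \sum_i f i A) = \sum_i wint s (f i).
elim: index_enum => [|i r [IHp IH]].
  have -> : (fun A => \sum_(i <- [::]) f i A) = (fun=> 0 * 0).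
    by apply/funext => A; rewrite big_nil mul0r.
  by split; [exact: ispoly_cst|rewrite big_nil wintZ ?mul0r//; exact: ispoly_cst].
have -> : (fun A => \sum_(j <- i :: r) f j A) =
    (fun A => f i A + \sum_(j <- r) f j A).
  by apply/funext => A; rewrite big_cons.
by split; [exact: ispolyD|rewrite wintD// IH big_cons].
Qed.

(** The mean of |T_ij|^2 for i <> j is at least beta/2 times that of T_ii^2, and
    n + n (n - 1) beta/2 = d. *)
Lemma wint_trsq s : d%:R / (kap s + 1) * wvol s <= reF (wint s trsq).
Proof.
rewrite /trsq wint_sum; last by move=> i; apply: ispoly_sum => j; exact: ispoly_moment.
have -> : \sum_(i < n) wint s (fun A : M => \sum_j A i j * A j i) =
    \sum_(i < n) \sum_j moment R K s i j j i.
  by apply: eq_bigr => i _; rewrite wint_sum// => j; exact: ispoly_moment.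
have k2 := kappa_ge R K s n_gt0.
have Z0 := wvol_ge0 s.
pose c : R := wvol s / (kap s + 1).
have c0 : 0 <= c by rewrite divr_ge0//; lra.
rewrite reF_sum; apply: le_trans (_ : \sum_(i < n) \sum_(j < n) (if i == j then c else be / 2 * c) <= _).
  rewrite [leLHS](_ : _ = (n%:R + n%:R * (n%:R - 1) * (be / 2)) * c); last first.
    have d2 := dimE_kappa R K n.
    rewrite /c mulrAC mulrA; do 2!congr (_ * _).
    apply: (@mulfI _ 2); rewrite ?pnatr_eq0// d2 /kappa mulr0 addr0.
    by move: be => b; field.
  rewrite [leRHS](_ : _ = \sum_(i < n) (c + (n%:R - 1) * (be / 2 * c))).
    by rewrite sumr_const card_ord -mulr_natl; lra.
  apply: eq_bigr => i _; rewrite (bigD1 i)//= eqxx; congr (_ + _).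
  rewrite (eq_bigr (fun=> be / 2 * c)) => [|j]; last by rewrite eq_sym => /negPf ->.
  rewrite sumr_const cardC1 card_ord -[LHS]mulr_natl; congr (_ * _).
  by case: (n) n_gt0 => // m _; rewrite -natr1 addrK.
apply: ler_sum => i _; rewrite reF_sum; apply: ler_sum => j _.
case: eqVneq => [->|ij]; first by rewrite moment_diag reF_inF.
rewrite moment_abs// reF_inF.
have b12 := beta12 R K; have b0 : 0 < be by case: b12 => ->.
have den : 0 < 2 * kap s - be by case: b12 => ->; lra.
have -> : be * kap s / ((kap s + 1) * (2 * kap s - be)) * wvol s =
    be / 2 * c * (2 * kap s / (2 * kap s - be)).
  by rewrite /c; field; apply/andP; split; rewrite gt_eqF//; lra.
rewrite ler_peMr//; first by rewrite mulr_ge0//; lra.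
by rewrite ler_pdivlMr// mul1r; lra.
Qed.

(** With t = tr T^2 one has delta^s >= delta^(s+1) e^t, and e^t is at least its
    tangent at sg = d / (kappa + 2 s + 3), a lower bound of the mean of t for the
    weight delta^(s+1). *)
Lemma wvol_step s : expR (d%:R / (kap s.+1 + 1)) * wvol s.+1 <= wvol s.
Proof.
pose sg : R := d%:R / (kap s.+1 + 1).
pose f (A : M) : F := inF K (expR sg) * (bdet A ^+ s.+1 * (inF K (1 - sg) * 1 + trsq A)).
have p1 : ispoly (fun A : M => inF K (1 - sg) * 1) by exact: ispoly_cst.
have fp : ispoly f.
  apply: ispolyM; first exact: ispoly_cst.
  by apply: ispolyM; [exact: ispoly_bdetX|apply: ispolyD => //; exact: ispoly_trsq].
have fE : reF (cint f) = expR sg * ((1 - sg) * wvol s.+1 + reF (wint s.+1 trsq)).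
  rewrite /f cintZ; last first.
    by apply: ispolyM; [exact: ispoly_bdetX|apply: ispolyD => //; exact: ispoly_trsq].
  rewrite reF_inFM -/(wint s.+1 _) wintD//; last exact: ispoly_trsq.
  by rewrite wintZ ?reFD ?reF_inFM//; exact: ispoly_cst.
apply: (@le_trans _ _ (reF (cint f))).
  rewrite fE ler_pM2l ?expR_gt0//; have := wint_trsq s.+1; rewrite -/sg.
  by move: (wvol _) (reF _) => z w; lra.
apply: le_cint => // [|A bA].
  by apply: ispolyM; [exact: ispoly_bdetX|exact: ispoly_cst].
have [sA _] := bA; have [_ /andP[r0 r1] re _] := ball_bdet bA.
rewrite /f (trsqE sA) (ball_bdet_inF bA).
move: r0 r1 re; set r := reF _; set t := sqtr _ => r0 r1 re.
rewrite !mulr1 -!inFD -!rmorphXn /= -!inFM !reF_inF exprSr.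
rewrite mulrCA -mulrA ler_piMr ?exprn_ge0//.
apply: le_trans re; rewrite ler_wpM2l//.
have -> : expR t = expR sg * expR (t - sg) by rewrite -expRD addrCA subrr addr0.
by rewrite ler_pM2l ?expR_gt0//; have := expR_ge1Dx (t - sg); lra.
Qed.

(** As e^(2 d/x) >= (1 + 2/x)^d = ((x + 2)/x)^d for x = kappa + 2 s + 3, the
    squares of the factors of [wvol_step] telescope. *)
Lemma wvol_telescope s :
  wvol s ^+ 2 * ((kap 0 + 3 + 2 * s%:R) / (kap 0 + 3)) ^+ d <= wvol 0 ^+ 2.
Proof.
have k2 := kappa_ge R K 0 n_gt0.
elim: s => [|s IH]; first by rewrite mulr0 addr0 divff ?expr1n ?mulr1// gt_eqF//; lra.
apply: le_trans IH; have s0 : 0 <= s%:R :> R by [].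
have kE : kap s.+1 + 1 = kap 0 + 3 + 2 * s%:R :> R.
  by rewrite /kappa -(natr1 s); ring.
have step := wvol_step s; rewrite kE in step.
move: step kE; rewrite -(natr1 s); move: (kap 0) (s%:R) k2 s0 => k a k2 a0 step _.
have a3 : 0 < k + 3 + 2 * a by lra.
have k3 : 0 < k + 3 by lra.
have -> : (k + 3 + 2 * (a + 1)) / (k + 3) =
    (1 + 2 / (k + 3 + 2 * a)) * ((k + 3 + 2 * a) / (k + 3)).
  by field; apply/andP; split; rewrite gt_eqF.
rewrite exprMn mulrA; rewrite ler_wpM2r//.
  by rewrite exprn_ge0// divr_ge0// ltW.
apply: le_trans (_ : (expR (d%:R / (k + 3 + 2 * a)) * wvol s.+1) ^+ 2 <= _); last first.
  by rewrite ler_pXn2r// ?nnegrE ?mulr_ge0 ?expR_ge0 ?wvol_ge0.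
rewrite exprMn mulrC ler_wpM2r ?sqr_ge0//.
rewrite -expRM_natl [X in expR X](_ : _ = d%:R * (2 / (k + 3 + 2 * a))); last by field; rewrite gt_eqF.
rewrite expRM_natl lerXn2r ?nnegrE ?expR_ge0 ?expR_ge1Dx//.
by rewrite addr_ge0// divr_ge0// ltW.
Qed.

End weighted_volumes.

Section volume_bounds.
Variables (R : realType) (K : scalar_kind) (n : nat).
Local Notation F := (scal R K).
Local Notation M := 'M[F]_n.
Local Notation T := (measurableTypeR R).
Local Notation X := ((dimE K n).-tuple T).
Local Notation lam := (@lebesgue_tuple R (dimE K n)).
Local Notation D := (@ballset R K n).
Local Notation kap := (@kappa R K n).
Local Notation d := (dimE K n).
Local Notation wvol := (wvol R K n).
Hypothesis n_gt0 : (0 < n)%N.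

Let mD : measurable D := @ballset_measurable R K n.

Lemma dimE_gt0 : (0 < d)%N.
Proof.
rewrite -(ltr_nat R) -(pmulr_rgt0 _ (_ : 0 < 2 :> R))// (dimE_kappa R K n).
by rewrite mulr_gt0 ?ltr0n// (lt_le_trans _ (kappa_ge R K 0 n_gt0)).
Qed.

Lemma sqtr_coordmx (x : X) : sqtr (coordmx x) = \sum_k (tnth x k : R) ^+ 2.
Proof.
by rewrite /sqtr trace_coordmx reF_inF; apply: eq_bigr => k _; rewrite expr2.
Qed.

Lemma wvol_integral s :
  (\int[lam]_(x in D) (reF (bdet (coordmx x)) ^+ s)%:E)%E = (wvol s)%:E.
Proof.
have -> : (\int[lam]_(x in D) (reF (bdet (coordmx x)) ^+ s)%:E)%E =
    (\int[lam]_(x in D) (part true (bdet (coordmx x) ^+ s * 1))%:E)%E.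
  apply: eq_integral => x /set_mem Dx.
  by rewrite mulr1 (ball_bdet_inF Dx) -rmorphXn /= !reF_inF.
have ip : ispoly (fun A : M => bdet A ^+ s * 1).
  by apply: ispolyM; [exact: ispoly_bdetX|exact: ispoly_cst].
rewrite -[LHS]fineK; last exact: integrable_fin_num (ispoly_integrable true ip).
by congr EFin; rewrite /wvol -[RHS]/(part true _) [RHS]part_cint.
Qed.

Lemma lebesgue_itv_sym (r : R) : 0 <= r ->
  (\int[lebesgue_measure]_t (\1_(`[- r, r]%classic : set R) (t : T) : R)%:E = (2 * r)%:E)%E.
Proof.
move=> r0; rewrite integral_indic// setIT.
have := @lebesgue_measure_itv R `[- r, r]; rewrite /= lte_fin => E.
rewrite [LHS]E; case: ltP => [_|]; first by rewrite -EFinB; congr EFin; ring.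
by move=> rr; rewrite (_ : r = 0) ?mulr0 //; lra.
Qed.

(** On the cube of half-side [rho], tr T^2 <= d rho^2 = 1/2, hence delta >= 1/2 by
    [small_ball]. *)
Lemma wvol_cube : (8 * d%:R)^-1 ^+ d <= wvol (2 * d) ^+ 2.
Proof.
have d0 : 0 < d%:R :> R by rewrite ltr0n dimE_gt0.
pose rho : R := Num.sqrt (2 * d%:R)^-1.
have rho0 : 0 <= rho by exact: sqrtr_ge0.
have rho2 : rho ^+ 2 = (2 * d%:R)^-1 by rewrite sqr_sqrtr// invr_ge0 mulr_ge0 ?ltW.
pose phi (t : T) : R := \1_(`[- rho, rho]%classic : set R) t.
have mphi : measurable_fun setT phi by exact: measurable_indic.
have phi0 t : 0 <= phi t by [].
have cube := integral_tuple_prod d mphi phi0 (lebesgue_itv_sym rho0).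
have mprod : measurable_fun setT (fun x : X => (\prod_(k < d) phi (tnth x k))%:E).
  apply/measurable_EFinP/measurable_prod => k _.
  by apply: measurableT_comp => //; exact: measurable_tnth.
have q0 : 0 <= 4^-1 ^+ d :> R by rewrite exprn_ge0// invr_ge0.
have le : 4^-1 ^+ d * (2 * rho) ^+ d <= wvol (2 * d).
  rewrite -lee_fin EFinM -cube -wvol_integral -ge0_integralZl_EFin//; last first.
    by move=> x _; rewrite lee_fin; exact: prodr_ge0.
  rewrite [leRHS]integral_mkcond; apply: ge0_le_integral => //.
  - by move=> x _; rewrite -EFinM lee_fin mulr_ge0// prodr_ge0.
  - exact: measurable_funeM.
  - apply/(measurable_restrictT _ mD)/measurable_EFinP/measurable_funTS/measurable_funX.
    exact: (polyfun_measurable (@polyfun_bdet F n) true).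
  move=> x _; rewrite patchE -EFinM.
  have [/forallP xr|/forallPn[k xk]] := boolP [forall k, `|tnth x k : R| <= rho]; last first.
    have -> : \prod_(k < d) phi (tnth x k) = 0.
      apply/eqP/prodf_eq0; exists k => //; rewrite /phi indicE memNset//=.
      by rewrite in_itv/= -ler_norml; exact/negP.
    rewrite mulr0; case: ifP => // /set_mem Dx; rewrite lee_fin exprn_ge0//.
    by have [_ /andP[]] := ball_bdet Dx.
  have sx : sqtr (coordmx x) <= 2^-1.
    rewrite sqtr_coordmx; apply: le_trans (_ : \sum_(k < d) rho ^+ 2 <= _).
      apply: ler_sum => k _; rewrite -[leLHS]real_normK ?num_real//.
      by rewrite ler_pXn2r ?nnegrE.
    rewrite rho2 sumr_const card_ord (_ : _ *+ d = 2^-1)//.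
    by rewrite -[LHS]mulr_natl; field; rewrite gt_eqF.
  have sx1 : sqtr (coordmx x) <= 1 by lra.
  have [bx rx] := small_ball (coordmx_selfadjoint x) sx1.
  rewrite mem_set//; rewrite lee_fin big1 => [|k _]; last first.
    by rewrite /phi indicE mem_set//= in_itv/= -ler_norml.
  have h4 : 4^-1 = 2^-1 ^+ 2 :> R by field.
  rewrite mulr1 h4 -exprM lerXn2r ?nnegrE ?invr_ge0//; last by lra.
  by case: (ball_bdet bx) => _ /andP[].
have L0 : 0 <= 4^-1 ^+ d * (2 * rho) ^+ d by rewrite mulr_ge0// exprn_ge0// mulr_ge0.
have -> : (8 * d%:R)^-1 ^+ d = (4^-1 ^+ d * (2 * rho) ^+ d) ^+ 2 :> R.
  rewrite -exprMn -exprM mulnC exprM; congr (_ ^+ _).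
  by rewrite exprMn exprMn rho2; field; rewrite gt_eqF.
by rewrite ler_pXn2r ?nnegrE ?wvol_ge0.
Qed.

(** For the squares and s = 2 d, the factor (4 d / kappa)^d from [wvol_telescope]
    compensates the d^(-d) from [wvol_cube], and kappa is of order n. *)
Lemma volume_lower : (10 * n%:R)^-1 ^+ d <= wvol 0 ^+ 2.
Proof.
have d0 : 0 < d%:R :> R by rewrite ltr0n dimE_gt0.
have n1 : 1 <= n%:R :> R by rewrite ler1n.
have k2 := kappa_ge R K 0 n_gt0.
apply: le_trans (@wvol_telescope R K n n_gt0 (2 * d)).
have t0 : 0 <= (kap 0 + 3 + 2 * (2 * d)%:R) / (kap 0 + 3).
  by have N0 : 0 <= (2 * d)%:R :> R by []; apply: divr_ge0; lra.
apply: le_trans (ler_wpM2r (exprn_ge0 _ t0) wvol_cube).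
rewrite -exprMn lerXn2r ?nnegrE ?mulr_ge0 ?invr_ge0 ?mulr_ge0//; try lra.
have kn : kap 0 + 3 <= 5 * n%:R by rewrite /kappa; case: (beta12 R K) => ->; lra.
rewrite natrM; move: (kap 0) (d%:R) (n%:R) k2 kn d0 n1 => k e m k2 kn e0 m1.
rewrite [leRHS]mulrA ler_pdivlMr; last lra.
apply: (@le_trans _ _ 2^-1); first by rewrite mulrC ler_pdivrMr; lra.
by rewrite mulrC ler_pdivlMr; lra.
Qed.

(** The centred Gaussian of variance 1/n in each coordinate has a density at least
    (n / 2 pi)^(d/2) e^(-d) on the ball, since there |x|^2 <= n and n^2 <= 2 d. *)
Lemma volume_upper : wvol 0 ^+ 2 <= (expR 2 * (2 * pi) / n%:R) ^+ d.
Proof.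
have n0 : 0 < n%:R :> R by rewrite ltr0n.
pose s : R := (Num.sqrt n%:R)^-1.
have s2 : s ^+ 2 = n%:R^-1 by rewrite exprVn sqr_sqrtr// ltW.
have s0 : s != 0 by rewrite invr_eq0 sqrtr_eq0 -ltNge.
pose peak : R := normal_peak s.
have peak0 : 0 < peak by exact: normal_peak_gt0.
have peak2 : peak ^+ 2 = n%:R / (2 * pi).
  rewrite exprVn sqr_sqrtr ?s2; last by rewrite mulrn_wge0// mulr_ge0 ?invr_ge0 ?pi_ge0// ltW.
  rewrite -mulr_natl; move: (@pi R) (pi_gt0 R) => p p0.
  by field; rewrite !gt_eqF.
pose phi (t : T) : R := normal_pdf 0 s t.
have phiE t : phi t = peak * expR (- (n%:R / 2 * t ^+ 2)).
  rewrite /phi normal_pdfE// /normal_fun subr0; congr (_ * expR _).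
  by rewrite s2 -mulr_natl; field; rewrite gt_eqF.
have mphi : measurable_fun setT phi by exact: measurable_normal_pdf.
have phi0 t : 0 <= phi t by exact: normal_pdf_ge0.
have gauss := integral_tuple_prod d mphi phi0 (integral_normal_pdf 0 s).
have mprod : measurable_fun setT (fun x : X => (\prod_(k < d) phi (tnth x k))%:E).
  apply/measurable_EFinP/measurable_prod => k _.
  by apply: measurableT_comp => //; exact: measurable_tnth.
pose c : R := peak ^+ d * expR (- d%:R).
have c0 : 0 < c by rewrite mulr_gt0 ?exprn_gt0 ?expR_gt0.
have le : c * wvol 0 <= 1.
  rewrite -lee_fin EFinM -wvol_integral -(expr1n R d) -gauss.
  rewrite -(ge0_integralZl_EFin _ mD _ _ (ltW c0))//; last by apply/measurable_EFinP; exact: measurable_cst.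
  rewrite [leLHS]integral_mkcond; apply: ge0_le_integral => //.
  - by move=> x _; rewrite patchE; case: ifP => // _; rewrite -EFinM lee_fin mulr_ge0// ltW.
  - apply/(measurable_restrictT _ mD)/measurable_funeM/measurable_EFinP; exact: measurable_cst.
  move=> x _; rewrite patchE; case: ifP => [/set_mem Dx|_]; last by rewrite lee_fin prodr_ge0.
  have [_ _ _ /andP[_ xn]] := ball_bdet Dx; rewrite sqtr_coordmx in xn.
  rewrite -EFinM lee_fin expr0 mulr1 (eq_bigr _ (fun k _ => phiE (tnth x k))).
  rewrite big_split /= prodr_const card_ord ler_pM2l ?exprn_gt0// -expR_sum ler_expR.
  rewrite sumrN lerN2 -mulr_sumr.
  have := dimE_kappa R K n; have k2 : n%:R <= kap 0.
    by rewrite /kappa; case: (beta12 R K) => ->; lra.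
  move=> d2; apply: le_trans (_ : n%:R / 2 * n%:R <= _).
    by rewrite ler_wpM2l// divr_ge0// ltW.
  nra.
have : (c * wvol 0) ^+ 2 <= 1 by rewrite expr_le1// mulr_ge0 ?wvol_ge0// ltW.
have -> : expR 2 * (2 * pi) / n%:R = (peak ^+ 2 * expR (- 2))^-1.
  by rewrite expRN peak2 invf_div [in RHS]invf_div [RHS]mulrA.
have -> : (peak ^+ 2 * expR (- 2))^-1 ^+ d = (c ^+ 2)^-1.
  have e1 : (peak ^+ 2) ^+ d = (peak ^+ d) ^+ 2 by rewrite -!exprM mulnC.
  have e2 : expR (- 2) ^+ d = expR (- d%:R) ^+ 2 :> R.
    by rewrite -!expRM_natl; congr expR; ring.
  by rewrite exprVn exprMn e1 e2 -exprMn.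
by rewrite exprMn -ler_pdivlMl ?exprn_gt0// mulr1.
Qed.

(** The ratio of the homothety that gives the ball unit volume. *)
Definition dilation : R := (fine (volE (@op_ball R K n)) `^ d%:R^-1)^-1.

Lemma dilation_bounds :
  [/\ n%:R / (expR 2 * (2 * pi)) <= dilation ^+ 2 <= 10 * n%:R, 0 < dilation &
      dilation ^+ d * wvol 0 = 1].
Proof.
have n0 : 0 < n%:R :> R by rewrite ltr0n.
have d0 : d%:R != 0 :> R by rewrite pnatr_eq0 -lt0n dimE_gt0.
have Z0 : 0 < wvol 0.
  rewrite lt_neqAle wvol_ge0 andbT; apply/eqP => Z0; have := volume_lower.
  by rewrite -Z0 expr0n/= leNgt exprn_gt0// invr_gt0 mulr_gt0.
pose u : R := wvol 0 `^ d%:R^-1.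
have u0 : 0 < u by exact: powR_gt0.
have ud : u ^+ d = wvol 0 by rewrite -powR_mulrn ?ltW// -powRrM mulVf// powRr1// ltW.
have sE : dilation = u^-1 by rewrite /dilation /u wvol_0.
have ud2 : (u ^+ 2) ^+ d = wvol 0 ^+ 2 by rewrite -ud -!exprM mulnC.
have c0 : 0 < expR 2 * (2 * pi) :> R by rewrite mulr_gt0 ?expR_gt0// mulr_gt0// pi_gt0.
have lo : (10 * n%:R)^-1 <= u ^+ 2.
  by have := volume_lower; rewrite -ud2 ler_pXn2r ?nnegrE ?sqr_ge0 ?dimE_gt0.
have up : u ^+ 2 <= expR 2 * (2 * pi) / n%:R.
  have := volume_upper; rewrite -ud2 ler_pXn2r ?nnegrE ?sqr_ge0 ?dimE_gt0//.
  by rewrite divr_ge0// ltW.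
have u2 : 0 < u ^+ 2 by rewrite exprn_gt0.
rewrite sE !exprVn; split; [|by rewrite invr_gt0|by rewrite ud mulVf// gt_eqF].
apply/andP; split.
  by rewrite -[leLHS]invrK lef_pV2 ?posrE ?invr_gt0 ?divr_gt0// invf_div.
by rewrite -[leRHS]invrK lef_pV2 ?posrE ?invr_gt0 ?mulr_gt0.
Qed.

End volume_bounds.

(** * The ball of volume one *)

Section normalised_ball.
Variables (R : realType) (K : scalar_kind) (n : nat).
Local Notation F := (scal R K).
Local Notation M := 'M[F]_n.
Local Notation T := (measurableTypeR R).
Local Notation X := ((dimE K n).-tuple T).
Local Notation lam := (@lebesgue_tuple R (dimE K n)).
Local Notation D := (@ballset R K n).
Local Notation d := (dimE K n).
Local Notation B := (normalized (@op_ball R K n)).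
Local Notation dilation := (dilation R K n).
Hypothesis n_gt0 : (0 < n)%N.

Let mD : measurable D := @ballset_measurable R K n.
Let dilation_gt0 : 0 < dilation. Proof. by case: (dilation_bounds R K n_gt0). Qed.

Lemma coordmx_tscale r (x : X) : coordmx (tscale r x) = inF K r *: coordmx x.
Proof. by apply: coordmx_scale => k; rewrite tnth_mktuple. Qed.

Lemma normalized_tscale (x : X) :
  (@coordmx R K n @^-1` B) (tscale dilation x) = D x.
Proof.
apply/propext; split; rewrite /ballset /preimage /= coordmx_tscale.
  move=> [A bA]; rewrite -/dilation => /(congr1 (fun C => (inF K dilation)^-1 *: C)).
  rewrite !scalerA mulVf ?scale1r; last by rewrite fmorph_eq0 gt_eqF.
  by move=> <-.
by move=> bx; exists (coordmx x).
Qed.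

Lemma intE_eq (f g : M -> R) : (forall A, selfadjoint A -> f A = g A) ->
  intE B f = intE B g.
Proof.
move=> fg; apply: eq_integral => x _; congr (_%:E).
by apply: fg; exact: coordmx_selfadjoint.
Qed.

(** Change of variables by the dilation, which multiplies the volume by its d-th
    power and a quadratic form by its square. *)
Lemma intE_quadratic (f : M -> F) b : ispoly f ->
  (forall r A, f (inF K r *: A) = inF K (r ^+ 2) * f A) ->
  intE B (fun A => part b (f A)) = (dilation ^+ d * (dilation ^+ 2 * part b (cint f)))%:E.
Proof.
move=> fP f2; pose P := @coordmx R K n @^-1` B.
have tsK (x : X) : tscale dilation (tscale dilation^-1 x) = x.
  by apply: eq_from_tnth => k; rewrite !tnth_mktuple mulVKf// gt_eqF.
have mP : measurable P.
  rewrite (_ : P = [set: X] `&` (@tscale R d dilation^-1) @^-1` D).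
    by apply: measurable_tscale.
  by rewrite setTI; apply/funext => x; rewrite /preimage /= -normalized_tscale tsK.
pose g (x : X) := (part b (f (coordmx x)))%:E.
have [Df fDf] := fP; have mg : measurable_fun setT g.
  by apply/measurable_EFinP; exact: (polyfun_measurable fDf b).
pose h (x : X) := (dilation ^+ 2 * part b (f (coordmx x)))%:E.
have hP : (g \_ P) \o @tscale R d dilation = h \_ D.
  apply/funext => x /=; rewrite !patchE.
  have -> : (tscale dilation x \in P) = (x \in D).
    by apply/idP/idP => /set_mem y; apply/mem_set; move: y; rewrite /P normalized_tscale.
  by case: ifP => // _; rewrite /g coordmx_tscale f2 part_inFM.
have fint := ispoly_integrable b fP.
have hint : lam.-integrable D h.
  have := ispoly_integrable b (ispolyM (ispoly_cst n (inF K (dilation ^+ 2))) fP).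
  by congr (_.-integrable _ _); apply/funext => x /=; rewrite part_inFM.
have mgP : measurable_fun setT (g \_ P).
  by apply/(measurable_restrictT _ mP); exact: measurable_funTS.
rewrite /intE -/P [LHS]integral_mkcond integralE.
rewrite (ge0_integral_tscale dilation_gt0 (measurable_funepos mgP) (fun x => funepos_ge0 _ x)).
rewrite (ge0_integral_tscale dilation_gt0 (measurable_funeneg mgP) (fun x => funeneg_ge0 _ x)).
have hint' : lam.-integrable setT (h \_ D) by exact/(integrable_mkcond _ mD).
have -> : (\int[lam]_x (g \_ P)^\+ (tscale dilation x))%E = (\int[lam]_x (h \_ D)^\+ x)%E.
  by rewrite -hP funepos_comp.
have -> : (\int[lam]_x (g \_ P)^\- (tscale dilation x))%E = (\int[lam]_x (h \_ D)^\- x)%E.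
  by rewrite -hP funeneg_comp.
rewrite -muleBr//; last first.
  rewrite fin_num_adde_defr//; exact/integrable_fin_num/integrable_funepos.
rewrite -integralE -integral_mkcond EFinM; congr (_ * _)%E.
rewrite part_cint /bint -RintegralZl//.
by rewrite /Rintegral fineK//; exact: integrable_fin_num.
Qed.

End normalised_ball.

Lemma absF_sqr (R : realType) K (z : scal R K) : absF z ^+ 2 = reF z ^+ 2 + imF z ^+ 2.
Proof.
case: K z => [z|[a b]].
  by rewrite /absF /= real_normK ?num_real// expr0n addr0.
by rewrite /absF normc_def /= sqr_sqrtr// addr_ge0 ?sqr_ge0.
Qed.

Lemma selfadjoint_conj (R : realType) K n (A : 'M[scal R K]_n) i j :
  selfadjoint A -> A j i = conjF (A i j).
Proof. by move=> sA; rewrite -[in LHS]sA !mxE. Qed.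

Section covariances.
Variables (R : realType) (K : scalar_kind) (n : nat).
Local Notation F := (scal R K).
Local Notation M := 'M[F]_n.
Local Notation d := (dimE K n).
Local Notation B := (normalized (@op_ball R K n)).
Local Notation dilation := (dilation R K n).
Local Notation kap := (@kappa R K n 0).
Local Notation be := (@beta R K).
Hypothesis n_gt0 : (0 < n)%N.

Let b12 : be = 1 \/ be = 2 := beta12 R K.

Lemma intE_moment (i j l k : 'I_n) b :
  intE B (fun A => part b (A i j * A l k)) =
  (dilation ^+ d * (dilation ^+ 2 * part b (moment R K 0 i j l k)))%:E.
Proof.
rewrite (intE_quadratic n_gt0); last 2 first.
- exact: ispoly_moment.
- by move=> r A; rewrite !mxE rmorphXn; ring.
by congr (_ * (_ * part b _))%:E; apply: cint_eq => A _; rewrite expr0 mul1r.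
Qed.

Lemma intE_moment_val (i j l k : 'I_n) (c : R) :
  moment R K 0 i j l k = inF K (c * wvol R K n 0) ->
  intE B (fun A => reF (A i j * A l k)) = (dilation ^+ 2 * c)%:E /\
  intE B (fun A => imF (A i j * A l k)) = 0%E.
Proof.
move=> mE; have [_ _ sZ] := dilation_bounds R K n_gt0.
have := intE_moment i j l k true; have := intE_moment i j l k false.
rewrite mE /= reF_inF imF_inF => -> ->; rewrite !mulr0; split=> //.
by congr EFin; rewrite -[RHS]mulr1 -sZ; ring.
Qed.

(** On self-adjoint matrices A_kl is the conjugate of A_lk, so the products of
    real and imaginary parts of A_ij and A_lk are parts of such combinations. *)
Lemma intE_mixed (i j l k : 'I_n) (s t : R) b :
  inF K s * moment R K 0 i j l k + inF K t * moment R K 0 i j k l = 0 ->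
  intE B (fun A => part b (inF K s * (A i j * A l k) + inF K t * (A i j * A k l))) = 0%E.
Proof.
have mp r l' k' : ispoly (fun A : M => inF K r * (A i j * A l' k')).
  by apply: ispolyM; [exact: ispoly_cst|exact: ispoly_moment].
rewrite (intE_quadratic n_gt0); last 2 first.
- exact: ispolyD.
- by move=> r A; rewrite !mxE rmorphXn; ring.
have cE l' k' : cint (fun A : M => A i j * A l' k') = moment R K 0 i j l' k'.
  by apply: cint_eq => A _; rewrite expr0 mul1r.
rewrite cintD// !cintZ ?cE; [|exact: ispoly_moment..].
by move=> ->; rewrite part0 !mulr0.
Qed.

Lemma kappa_le : n%:R <= kap /\ kap <= 2 * n%:R.
Proof.
have : 1 <= n%:R :> R by rewrite ler1n.
by move=> n1; rewrite /kappa; case: b12 => ->; split; lra.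
Qed.

(** The constants are the products of those for [c] with the bounds n / (2 pi e^2)
    and 10 n for the square of [dilation]. *)
Lemma simeq_dilation (w c : R) : 0 <= w -> w / (12 * n%:R) <= c <= 2 * w / n%:R ->
  simeq 20^-1 (12 * (expR 2 * (2 * pi))) (dilation ^+ 2 * c)%:E w%:E.
Proof.
move=> w0 /andP[lo hi]; have [/andP[]] := dilation_bounds R K n_gt0.
have n0 : 0 < n%:R :> R by rewrite ltr0n.
have C0 : 0 < expR 2 * (2 * pi) :> R by rewrite mulr_gt0 ?expR_gt0// mulr_gt0// pi_gt0.
move: (expR 2 * (2 * pi)) C0 (dilation ^+ 2) => C C0 x xlo xhi _ _.
have lo0 : 0 <= w / (12 * n%:R) by rewrite divr_ge0// mulr_ge0// ltW.
have x0 : 0 <= n%:R / C by rewrite divr_ge0// ltW.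
split; rewrite -EFinM lee_fin.
  have : x * c <= (10 * n%:R) * (2 * w / n%:R).
    by apply: ler_pM => //; [exact: le_trans xlo|exact: le_trans lo].
  rewrite (_ : _ * (2 * w / _) = 20 * w); last by field; rewrite gt_eqF.
  lra.
have : n%:R / C * (w / (12 * n%:R)) <= x * c by rewrite ler_pM.
rewrite (_ : _ / C * _ = w / (12 * C)); last by field; rewrite !gt_eqF.
by rewrite ler_pdivrMr ?mulr_gt0// mulrC.
Qed.

(** The common denominator of the moments is of order beta kappa n, because
    n <= kappa <= 2 n. *)
Lemma moment_den_bounds :
  be * kap * n%:R <= 2 * ((kap + 1) * (2 * kap - be)) <= 12 * (be * kap * n%:R).
Proof.
have k2 := kappa_ge R K 0 n_gt0; have [kn k2n] := kappa_le.
move: k2 kn k2n; move: kap (n%:R) => k m k2 km k2m.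
have [k0 e1 e2 e3] : [/\ 0 <= k, 0 <= k - 2, 0 <= k - m & 0 <= 2 * m - k] by split; lra.
have := mulr_ge0 k0 e1; have := mulr_ge0 k0 e2; have := mulr_ge0 k0 e3.
by case: b12 => ->; nra.
Qed.

Lemma variance_coef_bounds (c : R) :
  c = 1 / (kap + 1) \/ c = be * kap / ((kap + 1) * (2 * kap - be)) ->
  1 / (12 * n%:R) <= c <= 2 * 1 / n%:R.
Proof.
have k2 := kappa_ge R K 0 n_gt0; have [kn k2n] := kappa_le.
have n1 : 1 <= n%:R :> R by rewrite ler1n.
have [n0 n12 k1] : [/\ 0 < n%:R :> R, 0 < 12 * n%:R :> R & 0 < kap + 1] by split; lra.
have /andP[dlo dhi] := moment_den_bounds; have den := moment_den_gt0 R K 0 n_gt0.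
case=> ->; apply/andP; split.
- by rewrite ler_pdivrMr// mulrAC ler_pdivlMr//; lra.
- by rewrite ler_pdivrMr// mulrAC ler_pdivlMr//; lra.
- by rewrite ler_pdivrMr// mulrAC ler_pdivlMr//; lra.
- by rewrite ler_pdivrMr// mulrAC ler_pdivlMr//; lra.
Qed.

Lemma covariance_coef_bounds :
  n%:R^-1 / (12 * n%:R) <= be / ((kap + 1) * (2 * kap - be)) <= 2 * n%:R^-1 / n%:R.
Proof.
have [kn k2n] := kappa_le; have n0 : 0 < n%:R :> R by rewrite ltr0n.
have /andP[dlo dhi] := moment_den_bounds; have den := moment_den_gt0 R K 0 n_gt0.
have bn : 0 <= be * n%:R by rewrite mulr_ge0 ?ltW//; case: b12 => ->; lra.
have lo : be * n%:R * n%:R <= be * n%:R * kap by rewrite ler_wpM2l.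
have hi : be * n%:R * kap <= be * n%:R * (2 * n%:R) by rewrite ler_wpM2l.
rewrite -invfM -[_ * n%:R^-1 / _]mulrA -invfM; apply/andP; split.
  by rewrite -[leLHS]mul1r ler_pdivrMr ?mulr_gt0// mulrAC ler_pdivlMr//; lra.
by rewrite ler_pdivrMr// mulrAC ler_pdivlMr ?mulr_gt0//; lra.
Qed.

End covariances.

Theorem theorem5 (R : realType) :
  exists c1 c2 : R, [/\ 0 < c1, 0 < c2 &
  forall (K : scalar_kind) (n : nat),
  let B := normalized (@op_ball R K n) in
  [/\ (* (1) *)
      forall i j : 'I_n, simeq c1 c2 (intE B (fun T => absF (T i j) ^+ 2)) 1%E,
      (* (2) *)
      forall i j l k : 'I_n,
        (l, k) \notin [:: (i, j); (j, i)] -> ~ [/\ i = j, j <> l & l = k] ->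
        intE B (fun T => reF (T i j * T l k)) = 0%E /\
        intE B (fun T => imF (T i j * T l k)) = 0%E,
      (* (3) *)
      K = ComplexK -> forall i j : 'I_n, i != j ->
        (forall l k : 'I_n, (l, k) \notin [:: (i, j); (j, i)] ->
          [/\ intE B (fun T => reF (T i j) * reF (T l k)) = 0%E,
              intE B (fun T => imF (T i j) * imF (T l k)) = 0%E &
              intE B (fun T => reF (T i j) * imF (T l k)) = 0%E]) /\
        intE B (fun T => reF (T i j) * imF (T i j)) = 0%E
    & (* (4) *)
      forall i k : 'I_n, i != k ->
        simeq c1 c2 (- intE B (fun T => reF (T i i * T k k)))%E (n%:R^-1)%:E /\
        intE B (fun T => imF (T i i * T k k)) = 0%E]].
Proof.
exists 20^-1, (12 * (expR 2 * (2 * pi))); split=> //.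
  by rewrite !mulr_gt0 ?expR_gt0 ?pi_gt0.
move=> K n B; split.
- move=> i j; have n0 : (0 < n)%N := leq_ltn_trans (leq0n _) (ltn_ord i).
  have -> : intE B (fun T => absF (T i j) ^+ 2) = intE B (fun T => reF (T i j * T j i)).
    by apply: intE_eq => A sA; rewrite (selfadjoint_conj i j sA) reF_mulconj absF_sqr.
  have [<-|ij] := eqVneq i j.
    have mi : moment R K 0 i i i i = inF K (1 / (kappa K n 0 + 1) * wvol R K n 0).
      by rewrite moment_diag mul1r mulrC.
    rewrite (intE_moment_val n0 mi).1.
    by apply: (@simeq_dilation R K n n0 1) => //; apply: variance_coef_bounds => //; left.
  rewrite (intE_moment_val n0 (moment_abs R K 0 ij)).1.
  by apply: (@simeq_dilation R K n n0 1) => //; apply: variance_coef_bounds => //; right.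
- move=> i j l k lk nd; have n0 : (0 < n)%N := leq_ltn_trans (leq0n _) (ltn_ord i).
  have m0 : moment R K 0 i j l k = inF K (0 * wvol R K n 0).
    rewrite mul0r rmorph0; apply: moment_zero => //; apply/negP => /andP[/eqP ij /eqP elk].
    apply: nd; split=> // jl; move: lk; rewrite -elk -jl ij.
    by rewrite !inE eqxx.
  by have [-> ->] := intE_moment_val n0 m0; rewrite mulr0.
- move=> KC; subst K => i j ij; have n0 : (0 < n)%N := leq_ltn_trans (leq0n _) (ltn_ord i).
  split.
    move=> l k lk.
    have m1 : moment R ComplexK 0 i j l k = 0.
      by apply: moment_zero => //; rewrite (negPf ij).
    have m2 : moment R ComplexK 0 i j k l = 0.
      apply: moment_zero; last by rewrite (negPf ij).
      by move: lk; rewrite !inE !xpair_eqE !negb_or ![(l == _) && _]andbC andbC.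
    have m0 s t : inF ComplexK s * moment R ComplexK 0 i j l k + inF ComplexK t * moment R ComplexK 0 i j k l = 0.
      by rewrite m1 m2 !mulr0 addr0.
    split.
    + rewrite -[RHS](intE_mixed n0 true (m0 2^-1 2^-1)); apply: intE_eq => A sA.
      rewrite (selfadjoint_conj l k sA) /part reFD !reF_inFM !reF_mul reF_conj imF_conj.
      by field.
    + rewrite -[RHS](intE_mixed n0 true (m0 (- 2^-1) 2^-1)); apply: intE_eq => A sA.
      rewrite (selfadjoint_conj l k sA) /part reFD !reF_inFM !reF_mul reF_conj imF_conj.
      by field.
    + rewrite -[RHS](intE_mixed n0 false (m0 2^-1 (- 2^-1))); apply: intE_eq => A sA.
      rewrite (selfadjoint_conj l k sA) /part imFD !imF_inFM !imF_mul reF_conj imF_conj.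
      by field.
  have m0 : inF ComplexK 2^-1 * moment R ComplexK 0 i j i j + inF ComplexK 0 * moment R ComplexK 0 i j j i = 0.
    rewrite rmorph0 mul0r addr0; have := moment_formula R ComplexK 0 i j i j.
    rewrite (eq_sym j i) (negPf ij) !mulr0 mul0r subr0 mul0r rmorph0.
    move=> /eqP; rewrite mulf_eq0 fmorph_eq0 gt_eqF ?moment_den_gt0//= => /eqP ->.
    by rewrite mulr0.
  rewrite -[RHS](intE_mixed n0 false m0); apply: intE_eq => A _.
  rewrite rmorph0 mul0r addr0 /part imF_inFM imF_mul; by field.
- move=> i k ik; have n0 : (0 < n)%N := leq_ltn_trans (leq0n _) (ltn_ord i).
  have mE := moment_cov R K 0 ik; rewrite -mulNr in mE.
  have [-> ->] := intE_moment_val n0 mE; split=> //.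
  rewrite mulrN EFinN oppeK; apply: (@simeq_dilation R K n n0); first by rewrite invr_ge0.
  exact: covariance_coef_bounds.
Qed.
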